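(* Let $K$ be an imaginary quadratic field of class number one with ring of integers $\mathcal{O}_K$, and let $\mathds{1}_{\mathcal{P}}:\mathcal{O}_K\to\{0,1\}$ be the indicator function of the set $\mathcal{P}$ of prime elements of $\mathcal{O}_K$. If the primes have level of distribution $1/2$ (that is, $\mathds{1}_{\mathcal{P}}$ has level of distribution $1/2$), then products of two primes also have level of distribution $1/2$ (that is, the Dirichlet convolution $\mathds{1}_{\mathcal{P}}*\mathds{1}_{\mathcal{P}}$ has level of distribution $1/2$).
   Context: Let $K$ be an imaginary quadratic field of class number one and $\mathcal{O}_K$ its ring of integers. An element $w\in\mathcal{O}_K$ is a prime element if $w\mathcal{O}_K$ is a (nonzero) prime ideal; $\mathcal{P}$ is the set of prime elements, and $\mathds{1}_{\mathcal{P}}(w)=1$ if $w\in\mathcal{P}$ and $0$ otherwise. For a nonzero integral ideal $\mathfrak{q}$, $|\mathfrak{q}|$ denotes its norm and $\varphi(\mathfrak{q})=\#(\mathcal{O}_K/\mathfrak{q})^{\times}$. For $\alpha\in\mathcal{O}_K$, $(\alpha,\mathfrak{q})=1$ means that $\alpha\mathcal{O}_K$ and $\mathfrak{q}$ are coprime. For $N\ge 1$, $A^0(N)$ is the set of $\xi\in\mathcal{O}_K$ with $1\le|\sigma(\xi)|\le N$ for all embeddings $\sigma:K\to\mathbb{C}$ (usual complex absolute value), and $|A^0(N)|$ denotes its cardinality. Level of distribution: for $0<\vartheta\le 1$, $f:\mathcal{O}_K\to\mathbb{C}$ has level of distribution $\vartheta$ if for any $A>0$ there exists a constant $B=B(A)$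 such that, with $Q=|A^0(N)|^{\vartheta}/(\log N)^B$, $$\sum_{|\mathfrak{q}|\le Q}\ \max_{M\le N}\ \max_{(\gamma,\mathfrak{q})=1}|\varepsilon(M;\mathfrak{q},\gamma;f)|\ll_{A,K}|A^0(N)|(\log N)^{-A},$$ where the sum is over nonzero integral ideals $\mathfrak{q}$, $\gamma$ runs over elements of $\mathcal{O}_K$ coprime to $\mathfrak{q}$, and $$\varepsilon(M;\mathfrak{q},\gamma;f)=\sum_{\substack{\alpha\in A^0(M)\\ \alpha\equiv\gamma\ (\mathrm{mod}\ \mathfrak{q})}}f(\alpha)-\frac{1}{\varphi(\mathfrak{q})}\sum_{\substack{\alpha\in A^0(M)\\(\alpha,\mathfrak{q})=1}}f(\alpha).$$ Dirichlet convolution: for nonzero $\alpha\in\mathcal{O}_K$, $(f*g)(\alpha)=\sum_{\xi\eta=\alpha}f(\xi)g(\eta)$, the sum being over ordered pairs $(\xi,\eta)$ of elements of $\mathcal{O}_K$ with $\xi\eta=\alpha$. *)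

(* Defs.v *)
From HB Require Import structures.
From mathcomp Require Import all_boot all_order all_algebra all_field.
From mathcomp Require Import ring_quotient.
From mathcomp Require Import finmap complex.
From mathcomp Require Import all_classical all_reals ereal esum exp.
Set Implicit Arguments.
Unset Strict Implicit.
Unset Printing Implicit Defensive.
Import Order.TTheory GRing.Theory Num.Theory.
Local Open Scope ring_scope.
Local Open Scope classical_set_scope.

Definition imaginary_quadratic (R : realType) (K : fieldExtType rat) : Prop :=
  \dim {:K} = 2%N /\
  forall sigma : {rmorphism K -> R[i]}, exists x : K, sigma x \isn't Num.real.

Definition algint (K : fieldExtType rat) : {pred K} :=
  fun x => `[< integralOver (intr : int -> K) x >].

Arguments algint : clear implicits.

Lemma algint_subring (K : fieldExtType rat) : subring_closed (algint K).
Proof.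
split=> [|x y /asboolP hx /asboolP hy|x y /asboolP hx /asboolP hy];
  apply/asboolP.
- exact: integral1.
- exact: integral_sub.
- exact: integral_mul.
Qed.

HB.instance Definition _ (K : fieldExtType rat) :=
  GRing.isSubringClosed.Build K (algint K) (algint_subring K).

Definition ring_of_integers (K : fieldExtType rat) := {x : K | x \in algint K}.

HB.instance Definition _ (K : fieldExtType rat) := SubChoice.on (ring_of_integers K).
HB.instance Definition _ (K : fieldExtType rat) :=
  [SubChoice_isSubComNzRing of ring_of_integers K by <:].

Section Ideals.
Variable A : comNzRingType.
Implicit Types (I J q : set A) (x y w : A).

(* [idealr_closed] of the library excludes the unit ideal, which has to be
   allowed here. *)
Definition is_ideal I : Prop :=
  I 0 /\ forall a u v, I u -> I v -> I (a * u + v).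

Definition nz_ideal I : Prop := is_ideal I /\ I <> [set 0].

Definition prime_ideal I : Prop :=
  idealr_closed (mem I) /\ prime_idealr_closed (mem I).

Definition principal w : set A := [set a * w | a in [set: A]].

Definition prime_element w : Prop :=
  prime_ideal (principal w) /\ principal w <> [set 0].

Definition coprime_ideals I J : Prop := exists x y, [/\ I x, J y & x + y = 1].

(* The elements of A / q are the residue classes of q, finite in number when q
   is a nonzero ideal of a ring of integers. *)
Definition residue_class q x : set A := [set y | q (y - x)].

Definition ideal_norm q : nat :=
  #|` fset_set [set residue_class q x | x in [set: A]]|.

Definition ideal_totient q : nat :=
  #|` fset_set [set residue_class q x | x in [set x | exists y, q (x * y - 1)]]|.

(* Two nonzero integral ideals are in the same class when they differ by a
   principal fractional ideal (a / b); every class of fractional ideals contains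
   an integral one. *)
Definition same_class I J : Prop :=
  exists a b, [/\ a != 0, b != 0 &
    [set a * x | x in I] = [set b * y | y in J]].

(* [fset_set] of an infinite set is empty, so [class_number = 1] does assert
   that there is exactly one class. *)
Definition class_number : nat :=
  #|` fset_set [set [set J | nz_ideal J /\ same_class I J]
               | I in [set I | nz_ideal I]]|.

End Ideals.

Section LevelOfDistribution.
Variables (R : realType) (K : fieldExtType rat).
Implicit Types (f g : ring_of_integers K -> R[i]) (N M : R) (q : set (ring_of_integers K)).

Definition cabs (z : R[i]) : R := complex.Re `|z|.

(* Finite when K is imaginary quadratic, so that [fset_set] and the finitely
   supported sums below have their intended values; likewise the factorizations
   of a nonzero alpha in [dirichlet_conv] are then finitely many. *)
Definition A0 N : set (ring_of_integers K) :=
  [set xi | forall sigma : {rmorphism K -> R[i]}, 1 <= cabs (sigma (val xi)) <= N].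

Definition cardA0 N : nat := #|` fset_set (A0 N)|.

Definition eps M q (gamma : ring_of_integers K) f : R[i] :=
  \sum_(alpha \in A0 M `&` residue_class q gamma) f alpha -
  (ideal_totient q)%:R^-1 *
  \sum_(alpha \in A0 M `&` [set alpha | coprime_ideals (principal alpha) q])
     f alpha.

(* The maxima and the sum over ideals are taken in the extended reals, so that
   no convention about infinite or unbounded families intervenes. *)
Definition total_error (Q : R) N f : \bar R :=
  \esum_(q in [set q | nz_ideal q /\ (ideal_norm q)%:R <= Q])
    ereal_sup [set
      ereal_sup [set (cabs (eps M q gamma f))%:E
        | gamma in [set gamma | coprime_ideals (principal gamma) q]]
      | M in [set M | 1 <= M <= N]].

(* The bound is required for N >= 2, as log N vanishes at N = 1.  The implied
   constant C may depend on A, K and f, but not on N. *)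
Definition level_of_distribution (theta : R) f : Prop :=
  forall A : R, 0 < A -> exists B C : R, 0 < C /\
    forall N : R, 2 <= N ->
      (total_error ((cardA0 N)%:R `^ theta / (ln N) `^ B) N f
         <= (C * (cardA0 N)%:R * (ln N) `^ (- A))%:E)%E.

Definition ind_prime : ring_of_integers K -> R[i] :=
  fun w => if `[< prime_element w >] then 1 else 0.

Definition dirichlet_conv f g : ring_of_integers K -> R[i] :=
  fun alpha => \sum_(p \in [set p : ring_of_integers K * ring_of_integers K | p.1 * p.2 = alpha])
                  (f p.1 * g p.2).

End LevelOfDistribution.

(* Main.v *)
Require Import Defs.
From HB Require Import structures.
From mathcomp Require Import all_boot all_order all_algebra all_field.
From mathcomp Require Import ring_quotient ring lra zify.
From mathcomp Require Import finmap complex.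
From mathcomp Require Import all_classical all_reals ereal esum exp trigo.
From mathcomp Require Import topology normedtype derive sequences.
Set Implicit Arguments.
Unset Strict Implicit.
Unset Printing Implicit Defensive.
Import Order.TTheory GRing.Theory Num.Theory.
Local Open Scope ring_scope.

(** Why the statement holds.

    The ring of integers is [Z + Z w] with a positive definite norm form, and every
    ideal has a generator, so ideals are counted by one generator each (the
    canonical associate) and every sum over ideals is a sum over lattice points
    ([quadratic_ring], [total_errorE]).  The error of a product of two primes in
    the class of [g] modulo [q] is then a sum over pairs of primes [(x, y)] with
    [|x y| <= M], which is cut, in multiplicative steps by [1 + 1 / d] with [d] a
    power of [log N], into products of cells [x ~ X], [y ~ Y], plus the pairs
    that lie in no cell product below [M].

    - The leftover pairs have their product in a thin annulus; since an element has
      boundedly many factorizations into two primes up to units, it is enough to count lattice points of a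
      residue class in the annulus, and the average over [q] is harmless ([rest_bound],
      [boundary_sum]).

    - If one of the cells has radius at most a power of [log N], fix the prime in
      it: the other prime lies in a residue class, and the hypothesis for the
      modulus [q] applies ([small_pair]).

    - Otherwise both variables are long and the sum is bilinear ([pair_big]).
      Instead of Dirichlet characters the proof uses, for each conductor [r], the kernel
      [kk r u], the sum of the primitive characters modulo [r] at [u].  Summed
      over the divisors of [q] these kernels detect [u = 1] modulo [q], and the
      trivial divisor contributes the expected main term.  Conductors below a
      power of [log N] are handled by the hypothesis for the prime in the longer
      cell (a statement of Siegel-Walfisz type that the hypothesis contains, as every single
      modulus is bounded by the whole sum).  For larger conductors, Cauchy-Schwarz bounds
      the bilinear form by the two mean squares [kvar], which a large sieve controls: they are at
      most mean squares of exponential sums at the primitive fractions [b / r]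
      ([kvar_le]), these fractions are [1 / Z]-separated modulo the lattice when
      [|r| <= Z] since a nonzero element has norm at least one, and the dual large
      sieve follows from positivity of the Fejer kernel ([dual_sieve],
      [primal_sieve], [sieve_ball]).

    The passage from a single conductor to all moduli [q = c r] costs the divisor
    sum of [1 / phi c], a power of [log N], and [level_conv] adds up the cells.
    [level_of_hypothesis] and [conclusion_of_level] translate between the suprema and
    real powers of logarithms of the definition and pointwise bounds with
    natural powers. *)

(** * Quadratic principal ideal rings *)

(** An order [Z + Z w] with [w ^ 2 = t w - m] of negative discriminant in which every ideal is
    principal.  Working with coordinates makes the norm and all counting arguments computable
    without any field around. *)
Record quad_pid (O : comNzRingType) := QuadPid {
  qw : O;
  qt : int;
  qm : int;
  qw_sqr : qw * qw = qt%:~R * qw - qm%:~R;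
  q_span : forall x, exists a b : int, x = a%:~R + b%:~R * qw;
  q_free : forall a b : int, a%:~R + b%:~R * qw = 0 -> a = 0 /\ b = 0;
  q_disc : qt ^+ 2 < 4 * qm;
  q_pid : forall I : set O, is_ideal I -> exists w, I = principal w }.

Section Ring.
Variables (O : comNzRingType) (S : quad_pid O).
Implicit Types (x y z d q r u v w : O).

Local Notation om := (qw S).
Local Notation t := (qt S).
Local Notation m := (qm S).

Definition qc (a b : int) : O := a%:~R + b%:~R * om.

Lemma qcP x : {p : int * int | x = qc p.1 p.2}.
Proof.
by apply: cid; have [a [b ->]] := q_span S x; exists (a, b).
Qed.

Definition c0 x : int := (projT1 (qcP x)).1.
Definition c1 x : int := (projT1 (qcP x)).2.

Lemma qc_coord x : x = qc (c0 x) (c1 x).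
Proof. by rewrite /c0 /c1; case: (qcP x). Qed.

Lemma qc_inj a b a' b' : qc a b = qc a' b' -> a = a' /\ b = b'.
Proof.
move=> /eqP; rewrite -subr_eq0 /qc => /eqP h.
have [] := q_free (q := S) (a := a - a') (b := b - b').
  by rewrite -[RHS]h !intrB; ring.
by move=> /eqP; rewrite subr_eq0 => /eqP -> /eqP; rewrite subr_eq0 => /eqP ->.
Qed.

Lemma c0_qc a b : c0 (qc a b) = a.
Proof. by have [] := qc_inj (esym (qc_coord (qc a b))). Qed.

Lemma c1_qc a b : c1 (qc a b) = b.
Proof. by have [] := qc_inj (esym (qc_coord (qc a b))). Qed.

Lemma qcD a b a' b' : qc a b + qc a' b' = qc (a + a') (b + b').
Proof. by rewrite /qc !intrD; ring. Qed.

Lemma qcN a b : - qc a b = qc (- a) (- b).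
Proof. by rewrite /qc !intrN; ring. Qed.

Lemma qcM a b a' b' :
  qc a b * qc a' b' = qc (a * a' - m * b * b') (a * b' + b * a' + t * b * b').
Proof.
have h := qw_sqr S.
have -> : qc a b * qc a' b' = a%:~R * a'%:~R +
   (a%:~R * b'%:~R + b%:~R * a'%:~R) * om + b%:~R * b'%:~R * (om * om).
  by rewrite /qc; ring.
by rewrite h /qc !(intrD, intrN, intrM); ring.
Qed.

Lemma qc_nat (n : nat) : qc n 0 = n%:R.
Proof. by rewrite /qc mul0r addr0. Qed.

Lemma qc0 : qc 0 0 = 0. Proof. by rewrite (qc_nat 0). Qed.
Lemma qc1 : qc 1 0 = 1. Proof. by rewrite (qc_nat 1). Qed.

Lemma c0D x y : c0 (x + y) = c0 x + c0 y.
Proof. by rewrite {1}(qc_coord x) {1}(qc_coord y) qcD c0_qc. Qed.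
Lemma c1D x y : c1 (x + y) = c1 x + c1 y.
Proof. by rewrite {1}(qc_coord x) {1}(qc_coord y) qcD c1_qc. Qed.
Lemma c0N x : c0 (- x) = - c0 x.
Proof. by rewrite {1}(qc_coord x) qcN c0_qc. Qed.
Lemma c1N x : c1 (- x) = - c1 x.
Proof. by rewrite {1}(qc_coord x) qcN c1_qc. Qed.
Lemma c0M x y : c0 (x * y) = c0 x * c0 y - m * c1 x * c1 y.
Proof. by rewrite {1}(qc_coord x) {1}(qc_coord y) qcM c0_qc. Qed.
Lemma c1M x y : c1 (x * y) = c0 x * c1 y + c1 x * c0 y + t * c1 x * c1 y.
Proof. by rewrite {1}(qc_coord x) {1}(qc_coord y) qcM c1_qc. Qed.

Lemma coord_eq x y : c0 x = c0 y -> c1 x = c1 y -> x = y.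
Proof. by move=> e0 e1; rewrite (qc_coord x) (qc_coord y) e0 e1. Qed.

Lemma coord0 x : c0 x = 0 -> c1 x = 0 -> x = 0.
Proof. by move=> e0 e1; rewrite (qc_coord x) e0 e1 qc0. Qed.

Lemma c0_0 : c0 0 = 0. Proof. by rewrite -qc0 c0_qc. Qed.
Lemma c1_0 : c1 0 = 0. Proof. by rewrite -qc0 c1_qc. Qed.
Lemma c0_nat (n : nat) : c0 n%:R = n. Proof. by rewrite -qc_nat c0_qc. Qed.
Lemma c1_nat (n : nat) : c1 n%:R = 0. Proof. by rewrite -qc_nat c1_qc. Qed.

Definition conj x : O := qc (c0 x + t * c1 x) (- c1 x).
Definition nrmz x : int := c0 x ^+ 2 + t * c0 x * c1 x + m * c1 x ^+ 2.
Definition nrm x : nat := absz (nrmz x).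

Lemma conjM x y : conj (x * y) = conj x * conj y.
Proof.
apply: coord_eq; rewrite ?(c0_qc, c1_qc, c0M, c1M); ring.
Qed.

Lemma conjD x y : conj (x + y) = conj x + conj y.
Proof. by apply: coord_eq; rewrite ?(c0_qc, c1_qc, c0D, c1D); ring. Qed.

Lemma conjK : involutive conj.
Proof. by move=> x; apply: coord_eq; rewrite !(c0_qc, c1_qc); ring. Qed.

(** Completing the square: positivity of the norm form is negativity of the discriminant. *)
Lemma nrmz4 x : 4 * nrmz x = (2 * c0 x + t * c1 x) ^+ 2 + (4 * m - t ^+ 2) * c1 x ^+ 2.
Proof. by rewrite /nrmz; ring. Qed.

Lemma nrmz_ge0 x : 0 <= nrmz x.
Proof.
have h := nrmz4 x; have hd := q_disc S.
have h1 : 0 <= 4 * nrmz x.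
  by rewrite h; apply: addr_ge0; rewrite ?sqr_ge0// mulr_ge0 ?sqr_ge0// subr_ge0 ltW.
by lia.
Qed.

Lemma nrmzE x : (nrm x)%:Z = nrmz x.
Proof. by rewrite /nrm gez0_abs ?nrmz_ge0. Qed.

Lemma mul_conj x : x * conj x = (nrm x)%:R.
Proof.
by apply: coord_eq;
  rewrite ?(c0_qc, c1_qc, c0M, c1M, c0_nat, c1_nat) ?nrmzE /nrmz; ring.
Qed.

Lemma nrmM x y : nrm (x * y) = (nrm x * nrm y)%N.
Proof.
apply/eqP; rewrite -eqz_nat PoszM !nrmzE; apply/eqP.
by rewrite /nrmz c0M c1M; ring.
Qed.

Lemma nrm_conj x : nrm (conj x) = nrm x.
Proof.
by apply/eqP; rewrite -eqz_nat !nrmzE /nrmz !(c0_qc, c1_qc); apply/eqP; ring.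
Qed.


Lemma nrm1 : nrm 1 = 1%N.
Proof.
by apply/eqP; rewrite -eqz_nat nrmzE /nrmz -qc1 c0_qc c1_qc; apply/eqP; ring.
Qed.

Lemma nrm0 : nrm 0 = 0%N.
Proof.
by apply/eqP; rewrite -eqz_nat nrmzE /nrmz c0_0 c1_0; apply/eqP; ring.
Qed.

Lemma nrm_nat (n : nat) : nrm n%:R = (n ^ 2)%N.
Proof.
apply/eqP; rewrite -eqz_nat nrmzE /nrmz c0_nat c1_nat -mulnn PoszM; apply/eqP; ring.
Qed.

Lemma nrm_eq0 x : (nrm x == 0)%N = (x == 0).
Proof.
apply/idP/eqP => [|->]; last by rewrite nrm0.
move=> /eqP h0; have h := nrmz4 x; have hd := q_disc S.
rewrite -nrmzE h0 mulr0 in h.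
have s0 : (2 * c0 x + t * c1 x) ^+ 2 = 0.
  apply/eqP; rewrite eq_le sqr_ge0 andbT [leRHS]h lerDl.
  by rewrite mulr_ge0 ?sqr_ge0// subr_ge0 ltW.
have s1 : c1 x = 0.
  move/esym/eqP: h; rewrite s0 add0r mulf_eq0 subr_eq0 gt_eqF//=.
  by rewrite sqrf_eq0 => /eqP.
apply: coord0 => //; move/eqP: s0; rewrite s1 mulr0 addr0 sqrf_eq0; lia.
Qed.

Lemma nrm_gt0 x : x != 0 -> (0 < nrm x)%N.
Proof. by rewrite lt0n nrm_eq0. Qed.

Lemma mulO_eq0 x y : x * y = 0 -> x = 0 \/ y = 0.
Proof.
move=> h; have : nrm (x * y) == 0%N by rewrite h nrm0.
by rewrite nrmM muln_eq0 !nrm_eq0 => /orP[] /eqP; [left|right].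
Qed.

Lemma mulO_neq0 x y : x != 0 -> y != 0 -> x * y != 0.
Proof. by rewrite -!nrm_eq0 nrmM muln_eq0 => /negbTE -> /negbTE ->. Qed.

Lemma mulOI x y z : x != 0 -> x * y = x * z -> y = z.
Proof.
move=> x0 /eqP; rewrite -subr_eq0 -mulrBr => /eqP /mulO_eq0[/eqP|/eqP].
  by rewrite (negbTE x0).
by rewrite subr_eq0 => /eqP.
Qed.

Lemma mulIO x y z : x != 0 -> y * x = z * x -> y = z.
Proof. by rewrite ![_ * x]mulrC; exact: mulOI. Qed.

Definition dv d x : bool := `[< exists z, x = z * d >].
Definition cop x y : bool := `[< exists a b, a * x + b * y = 1 >].

Lemma dvP d x : reflect (exists z, x = z * d) (dv d x).
Proof. exact: asboolP. Qed.
Lemma copP x y : reflect (exists a b, a * x + b * y = 1) (cop x y).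
Proof. exact: asboolP. Qed.

Lemma dv0 d : dv d 0. Proof. by apply/dvP; exists 0; rewrite mul0r. Qed.
Lemma dvxx d : dv d d. Proof. by apply/dvP; exists 1; rewrite mul1r. Qed.
Lemma dv1 x : dv 1 x. Proof. by apply/dvP; exists x; rewrite mulr1. Qed.
Lemma dv_mull d x y : dv d y -> dv d (x * y).
Proof. by move=> /dvP[z ->]; apply/dvP; exists (x * z); rewrite mulrA. Qed.
Lemma dv_mulr d x y : dv d x -> dv d (x * y).
Proof. by rewrite mulrC; exact: dv_mull. Qed.
Lemma dvD d x y : dv d x -> dv d y -> dv d (x + y).
Proof.
by move=> /dvP[a ->] /dvP[b ->]; apply/dvP; exists (a + b); rewrite mulrDl.
Qed.
Lemma dvN d x : dv d (- x) = dv d x.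
Proof.
by apply/dvP/dvP => -[z e]; exists (- z); rewrite mulNr -e ?opprK.
Qed.
Lemma dvB d x y : dv d x -> dv d y -> dv d (x - y).
Proof. by move=> hx hy; rewrite dvD ?dvN. Qed.
Lemma dvBC d x y : dv d (x - y) = dv d (y - x).
Proof. by rewrite -dvN opprB. Qed.
Lemma dv_trans d x y : dv d x -> dv x y -> dv d y.
Proof. by move=> h /dvP[z ->]; exact: dv_mull. Qed.
Lemma dv_mul2l d x y : x != 0 -> dv (x * d) (x * y) = dv d y.
Proof.
move=> x0; apply/dvP/dvP => -[z e]; exists z; last by rewrite e; ring.
by apply: (mulOI x0); rewrite e; ring.
Qed.
Lemma dv_mulm d x e y : dv d x -> dv e y -> dv (d * e) (x * y).
Proof.
by move=> /dvP[a ->] /dvP[b ->]; apply/dvP; exists (a * b); ring.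
Qed.
Lemma dv_cong_trans d x y z : dv d (x - y) -> dv d (y - z) -> dv d (x - z).
Proof. by move=> h1 h2; have := dvD h1 h2; rewrite addrA subrK. Qed.

Lemma dv_nrm d x : dv d x -> (nrm d %| nrm x)%N.
Proof. by move=> /dvP[z ->]; rewrite nrmM dvdn_mull. Qed.
Lemma dv_nrm_le d x : x != 0 -> dv d x -> (nrm d <= nrm x)%N.
Proof. by move=> x0 /dv_nrm /dvdn_leq; apply; rewrite nrm_gt0. Qed.
Lemma dv_neq0 d x : x != 0 -> dv d x -> d != 0.
Proof. by move=> x0 /dvP[z e]; apply: contraNneq x0 => d0; rewrite e d0 mulr0. Qed.
Lemma dv_nrm_self x : dv x (nrm x)%:R.
Proof. by rewrite -mul_conj dv_mulr ?dvxx. Qed.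

Lemma unit_nrm1 x : (dv x 1) = (nrm x == 1)%N.
Proof.
apply/idP/eqP => [/dv_nrm|h]; first by rewrite nrm1 dvdn1 => /eqP.
by rewrite (_ : 1 = (nrm x)%:R) ?dv_nrm_self// h.
Qed.

Lemma copC x y : cop x y = cop y x.
Proof. by apply/copP/copP => -[a [b e]]; exists b, a; rewrite addrC. Qed.
Lemma cop1 x : cop x 1.
Proof. by apply/copP; exists 0, 1; ring. Qed.
Lemma cop_dv x d y : dv d y -> cop x y -> cop x d.
Proof.
move=> /dvP[z ->] /copP[a [b e]]; apply/copP; exists a, (b * z).
by rewrite -[RHS]e; ring.
Qed.
Lemma cop_dvl x d y : dv d x -> cop x y -> cop d y.
Proof. by rewrite ![cop _ y]copC; exact: cop_dv. Qed.
Lemma copMr x y z : cop x y -> cop x z -> cop x (y * z).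
Proof.
move=> /copP[a [b e]] /copP[c [d f]]; apply/copP.
by exists (a * c * x + a * d * z + b * y * c), (b * d); rewrite -[RHS]mulr1 -{1}e -f; ring.
Qed.
Lemma copMl x y z : cop x z -> cop y z -> cop (x * y) z.
Proof. by rewrite ![cop _ z]copC; exact: copMr. Qed.
Lemma copM_l x y z : cop (x * y) z -> cop x z.
Proof. by apply: cop_dvl; rewrite dv_mulr ?dvxx. Qed.
Lemma copM_r x y z : cop (x * y) z -> cop y z.
Proof. by rewrite mulrC; exact: copM_l. Qed.
Lemma copM x y z : cop (x * y) z = cop x z && cop y z.
Proof.
apply/idP/andP => [h|[]]; last exact: copMl.
by split; [exact: copM_l h|exact: copM_r h].
Qed.
Lemma copX x y n : cop x y -> cop x (y ^+ n).
Proof.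
by move=> h; elim: n => [|n IH]; rewrite ?expr0 ?cop1// exprS copMr.
Qed.
Lemma cop_cong x y q : dv q (x - y) -> cop x q = cop y q.
Proof.
move=> h; have {h}[z e] := dvP _ _ h.
have h x' y' z' : x' - y' = z' * q -> cop x' q -> cop y' q.
  move=> e' /copP[a [b f]]; apply/copP; exists a, (a * z' + b).
  by rewrite -[RHS]f -[x'](subrK y') e'; ring.
by apply/idP/idP; [exact: h e|apply: (h _ _ (- z)); rewrite mulNr -e opprB].
Qed.
Lemma cop_gauss d x y : cop d x -> dv d (x * y) -> dv d y.
Proof.
move=> /copP[a [b e]] h; rewrite -[y]mul1r -e mulrDl -mulrA -(mulrA b).
by rewrite dvD// dv_mull// dv_mulr// dvxx.
Qed.
Lemma cop_inv x q : cop x q -> exists y, dv q (x * y - 1).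
Proof.
move=> /copP[a [b e]]; exists a; apply/dvP; exists (- b); rewrite -e; ring.
Qed.
Lemma inv_cop x y q : dv q (x * y - 1) -> cop x q.
Proof.
move=> /dvP[z e]; apply/copP; exists y, (- z); rewrite mulNr -e; ring.
Qed.
Lemma cop_mul2 x y y' q : cop x q -> dv q (x * y - x * y') = dv q (y - y').
Proof.
move=> h; rewrite -mulrBr; apply/idP/idP; last exact: dv_mull.
by apply: cop_gauss; rewrite copC.
Qed.

Lemma bezout x y : exists g a b, [/\ g = a * x + b * y, dv g x & dv g y].
Proof.
pose I : set O := [set z | exists a b, z = a * x + b * y]%classic.
have [|g Ig] := q_pid S (I := I).
  split; first by exists 0, 0; ring.
  move=> a u v [b [c ->]] [d [e ->]]; exists (a * b + d), (a * c + e); ring.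
have : I g by rewrite Ig; exists 1 => //; rewrite mul1r.
move=> [a [b e]]; exists g, a, b; split => //.
  have : I x by exists 1, 0; ring.
  by rewrite Ig => -[z _ <-]; apply/dvP; exists z.
have : I y by exists 0, 1; ring.
by rewrite Ig => -[z _ <-]; apply/dvP; exists z.
Qed.

Lemma gcdP x y : exists g, [/\ dv g x, dv g y,
  (forall d, dv d x -> dv d y -> dv d g) & exists a b, g = a * x + b * y].
Proof.
have [g [a [b [e gx gy]]]] := bezout x y; exists g; split => //; last by exists a, b.
by move=> d dx dy; rewrite e dvD// dv_mull.
Qed.

Lemma noncop x y : ~~ cop x y -> exists2 g, ~~ dv g 1 & dv g x && dv g y.
Proof.
move=> h; have [g [a [b [e gx gy]]]] := bezout x y.
exists g; last by rewrite gx gy.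
apply: contra h => /dvP[z f]; apply/copP; exists (z * a), (z * b).
by rewrite f e; ring.
Qed.

(** The part of [q] prime to [x] exists because the chain of quotients of [q] by common divisors
    with [x] has decreasing norms. *)
Lemma copr_part q x : q != 0 ->
  exists2 s, cop s x & exists n, dv q (s * x ^+ n).
Proof.
have [n] := ubnP (nrm q); elim: n q => // n IH q; rewrite ltnS => qn q0.
have [h|/noncop[g gu /andP[gq gx]]] := boolP (cop q x).
  by exists q => //; exists 0%N; rewrite expr0 mulr1 dvxx.
have {gq}[q' eq] := dvP _ _ gq.
have q'0 : q' != 0 by apply: contraNneq q0 => e; rewrite eq e mul0r.
have g0 : g != 0 by apply: contraNneq q0 => e; rewrite eq e mulr0.
have [||s sx [k hk]] := IH q' => //.
  rewrite (leq_trans _ qn)// eq nrmM ltn_Pmulr ?nrm_gt0//.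
  by rewrite ltn_neqAle eq_sym -unit_nrm1 gu nrm_gt0.
exists s => //; exists k.+1; rewrite eq exprSr mulrA; exact: dv_mulm.
Qed.

(** Units modulo [m] lift to units modulo [q]: add to [x] a multiple of [m * s],
    where [s] collects the part of [q] prime to [x]. *)
Lemma unit_lift x m' q : q != 0 -> cop x m' -> exists s, cop (x + m' * s) q.
Proof.
move=> q0 xm; have [s sx [n hn]] := copr_part x q0; exists s.
apply: (cop_dv hn); apply: copMr; last first.
  apply: copX; rewrite (_ : cop _ _ = cop (m' * s) x); last first.
    by apply: cop_cong; rewrite addrK dvxx.
  by apply: copMl; rewrite // copC.
rewrite (_ : cop _ _ = cop x s); first by rewrite copC.
by apply: cop_cong; rewrite addrC addKr dv_mull ?dvxx.
Qed.

(** The compatible form of the Chinese remainder theorem: the moduli need not be coprime. *)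
Lemma crt x y r d g : dv g r -> dv g d -> (exists a b, g = a * r + b * d) ->
  dv g (x - y) -> exists z, dv r (z - x) && dv d (z - y).
Proof.
move=> gr gd [a [b e]] /dvP[z f]; exists (x - z * a * r).
apply/andP; split.
  by rewrite addrAC subrr sub0r dvN dv_mull// dvxx.
rewrite addrAC f e (_ : _ - _ = z * b * d) ?dv_mull ?dvxx//; ring.
Qed.

End Ring.

(** * Residue classes *)

Section Residues.
Variables (O : comNzRingType) (S : quad_pid O).
Implicit Types (x y z d q r u v w c m : O).
Local Notation nrm := (nrm S).

(** [choose] depends on the predicate only through its extension, so congruent elements get the
    same representative. *)
Definition rep q x : O := choose (fun y => dv q (x - y)) x.

Lemma rep_cong q x : dv q (x - rep q x).
Proof.
have h : dv q (x - x) by rewrite subrr dv0.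
exact: (@chooseP _ (fun y => dv q (x - y)) x h).
Qed.

Lemma rep_congr q x : dv q (rep q x - x).
Proof. by rewrite dvBC rep_cong. Qed.

Lemma rep_eq q x y : (rep q x == rep q y) = dv q (x - y).
Proof.
apply/eqP/idP => [e|h].
  by have := dv_cong_trans (rep_cong q x) (_ : dv q (rep q x - y)); apply; rewrite e rep_congr.
rewrite /rep; transitivity (choose (fun z => dv q (y - z)) x).
  apply: eq_choose => z; apply/idP/idP => hz.
    by apply: dv_cong_trans hz; rewrite dvBC.
  exact: dv_cong_trans hz.
apply: choose_id; first by rewrite dvBC.
by rewrite subrr dv0.
Qed.

Lemma rep_id q x : rep q (rep q x) = rep q x.
Proof. by apply/eqP; rewrite rep_eq rep_congr. Qed.

Definition res q : seq O :=
  undup [seq rep q (qc S a%:Z b%:Z) | a <- iota 0 (nrm q), b <- iota 0 (nrm q)].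

Lemma res_uniq q : uniq (res q). Proof. exact: undup_uniq. Qed.

Lemma mod_box n x : (0 < n)%N -> exists a b, [/\ (a < n)%N, (b < n)%N &
  dv n%:R (x - qc S a%:Z b%:Z)].
Proof.
move=> n0; have nz : (n : int) != 0 by rewrite eqz_nat -lt0n.
exists (absz (c0 S x %% n)%Z), (absz (c1 S x %% n)%Z).
have e a : (`|(a %% n)%Z|%N : int) = (a %% n)%Z by rewrite gez0_abs// modz_ge0.
have l a : (`|(a %% n)%Z| < n)%N by rewrite -ltz_nat e ltz_pmod.
split => //; apply/dvP; exists (qc S (c0 S x %/ n)%Z (c1 S x %/ n)%Z).
apply: (coord_eq (S := S)).
- rewrite !(c0D, c0M, c0N, c0_qc, c1D, c1M, c1N, c1_qc, c0_nat, c1_nat) !e.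
  by rewrite {1}(divz_eq (c0 S x) n); ring.
- rewrite !(c0D, c0M, c0N, c0_qc, c1D, c1M, c1N, c1_qc, c0_nat, c1_nat) !e.
  by rewrite {1}(divz_eq (c1 S x) n); ring.
Qed.

Lemma mem_res q x : q != 0 -> (x \in res q) = (rep q x == x).
Proof.
move=> q0; rewrite mem_undup; apply/allpairsP/eqP => [[p [_ _ ->]]|e].
  by rewrite rep_id.
have n0 : (0 < nrm q)%N by rewrite nrm_gt0.
have [a [b [an bn h]]] := mod_box x n0.
exists (a, b); rewrite /= !mem_iota; split => //.
rewrite -e; apply/eqP; rewrite rep_eq.
exact: dv_trans (dv_nrm_self S q) h.
Qed.

Lemma rep_res q x : q != 0 -> rep q x \in res q.
Proof. by move=> q0; rewrite mem_res// rep_id. Qed.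

Lemma res_inj q x y : q != 0 -> x \in res q -> y \in res q -> dv q (x - y) -> x = y.
Proof.
by move=> q0; rewrite !mem_res// => /eqP ex /eqP ey; rewrite -rep_eq => /eqP; rewrite ex ey.
Qed.

Definition per_mod (T : Type) q (F : O -> T) := forall x y, dv q (x - y) -> F x = F y.

Lemma periodic_rep (T : Type) q (F : O -> T) x : per_mod q F -> F (rep q x) = F x.
Proof. by apply; exact: rep_congr. Qed.


Lemma cop_periodic q : per_mod q (fun x => cop x q).
Proof. by move=> x y; exact: cop_cong. Qed.

Definition complete_system q (P : pred O) (s : seq O) :=
  [/\ uniq (map (rep q) s), all P s & forall x, P x -> exists2 y, y \in s & dv q (x - y)].

Lemma complete_res q : q != 0 -> complete_system q predT (res q).
Proof.
move=> q0; split=> [||x _]; last by exists (rep q x); rewrite ?rep_res ?rep_cong.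
  rewrite map_inj_in_uniq ?res_uniq// => x y xr yr /eqP.
  by rewrite rep_eq; exact: res_inj.
exact/allP.
Qed.

Lemma complete_perm q P s s' : per_mod q P ->
  complete_system q P s -> complete_system q P s' ->
  perm_eq (map (rep q) s) (map (rep q) s').
Proof.
move=> pP [u /allP a c] [u' /allP a' c']; apply: uniq_perm => // z.
by apply/mapP/mapP => -[x xs ->];
  [have [y ys h] := c' x (a x xs)|have [y ys h] := c x (a' x xs)];
  exists y => //; apply/eqP; rewrite rep_eq.
Qed.

(** A sum of a periodic function does not see which complete system of residues is summed over;
    multiplying by a unit or translating gives another complete system. *)
Lemma complete_sum (V : nmodType) q (P : pred O) s s' (F : O -> V) : per_mod q P -> per_mod q F ->
  complete_system q P s -> complete_system q P s' ->
  \sum_(x <- s) F x = \sum_(x <- s') F x.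
Proof.
move=> pP pF hs hs'.
have e l : \sum_(x <- l) F x = \sum_(x <- map (rep q) l) F x.
  by rewrite big_map; apply: eq_bigr => x _; rewrite periodic_rep.
by rewrite e [RHS]e; apply: perm_big; exact: complete_perm hs hs'.
Qed.

Lemma complete_size q (P : pred O) s s' : per_mod q P ->
  complete_system q P s -> complete_system q P s' -> size s = size s'.
Proof.
by move=> pP hs hs'; have := perm_size (complete_perm pP hs hs'); rewrite !size_map.
Qed.

Definition gres q := [seq x <- res q | cop x q].
Definition phi q : nat := size (gres q).
Lemma phiE q : phi q = size (gres q). Proof. by []. Qed.

Lemma gres_uniq q : uniq (gres q). Proof. by rewrite filter_uniq ?res_uniq. Qed.

Lemma mem_gres q x : q != 0 -> (x \in gres q) = cop x q && (rep q x == x).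
Proof. by move=> q0; rewrite mem_filter mem_res. Qed.

Lemma gres_cop q x : x \in gres q -> cop x q.
Proof. by rewrite mem_filter => /andP[]. Qed.

Lemma gres_res q x : x \in gres q -> x \in res q.
Proof. by rewrite mem_filter => /andP[]. Qed.

Lemma rep_gres q x : q != 0 -> cop x q -> rep q x \in gres q.
Proof.
by move=> q0 h; rewrite mem_gres// rep_id eqxx andbT (cop_cong (rep_congr q x)).
Qed.

Lemma complete_gres q : q != 0 -> complete_system q (fun x => cop x q) (gres q).
Proof.
move=> q0; split=> [||x h]; last by exists (rep q x); rewrite ?rep_gres ?rep_cong.
  rewrite map_inj_in_uniq ?gres_uniq// => x y /gres_res xr /gres_res yr /eqP.
  by rewrite rep_eq; exact: res_inj.
exact: filter_all.
Qed.

(** Multiplication by a unit permutes the reduced residues. *)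
Lemma sum_gres_mul (V : nmodType) q c (F : O -> V) : q != 0 -> cop c q -> per_mod q F ->
  \sum_(u <- gres q) F (c * u) = \sum_(u <- gres q) F u.
Proof.
move=> q0 cq pF; rewrite -(big_map ( *%R c) xpredT F).
apply: (complete_sum (cop_periodic (q := q)) pF _ (complete_gres q0)).
have [_ /allP a b] := complete_gres q0; split.
- rewrite map_inj_in_uniq ?map_inj_in_uniq ?gres_uniq//.
    move=> x y xr yr e.
    by apply: (res_inj q0); rewrite ?gres_res// -(cop_mul2 _ _ cq) e subrr dv0.
  move=> _ _ /mapP[x xr ->] /mapP[y yr ->] /eqP; rewrite rep_eq cop_mul2// => h.
  by congr (_ * _); apply: (res_inj q0); rewrite ?gres_res.
- by apply/allP => _ /mapP[x xr ->]; rewrite /= copMl// gres_cop.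
- move=> x xq; have [c' h] := cop_inv cq.
  have c'q : cop c' q by apply: (@inv_cop _ _ c); rewrite mulrC.
  have [|y yr hy] := b (c' * x); first by rewrite /= copMl.
  exists (c * y); first by rewrite map_f.
  have h1 : dv q (c * (c' * x) - c * y) by rewrite -mulrBr dv_mull.
  apply: dv_cong_trans h1; rewrite dvBC mulrA -[X in _ - X]mul1r -mulrBl.
  by rewrite dv_mulr.
Qed.

Lemma sum_res_add (V : nmodType) q c (F : O -> V) : q != 0 -> per_mod q F ->
  \sum_(u <- res q) F (u + c) = \sum_(u <- res q) F u.
Proof.
move=> q0 pF; rewrite -(big_map (+%R^~ c) xpredT F).
apply: (@complete_sum _ q predT) => //; last exact: complete_res.
split.
- rewrite map_inj_in_uniq ?map_inj_in_uniq ?res_uniq//.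
    by move=> x y _ _ /addIr.
  move=> _ _ /mapP[x xr ->] /mapP[y yr ->] /eqP; rewrite rep_eq => h.
  congr (_ + _); apply: (res_inj q0) => //.
  by rewrite (_ : x - y = x + c - (y + c))//; ring.
- exact/allP.
- move=> x _; exists (rep q (x - c) + c); first by apply/mapP; exists (rep q (x - c)); rewrite ?rep_res.
  by rewrite opprD addrA addrAC rep_cong.
Qed.

Lemma sum_res_fib (V : nmodType) m (F : V) u : m != 0 ->
  \sum_(c <- res m | dv m (u - c)) F = F.
Proof.
move=> m0; rewrite (big_rem (rep m u)) ?rep_res//= rep_cong big_seq_cond big1 ?addr0//.
move=> c /andP[]; rewrite mem_rem_uniq ?res_uniq// inE => /andP[ne cr] h.
by move: ne; rewrite /= -{1}(eqP (_ : rep m c == c)) ?rep_eq 1?dvBC ?h// -mem_res.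
Qed.

Lemma sum_fib (V : nmodType) m (P : pred O) (s : seq O) (F : O -> V) : m != 0 ->
  \sum_(u <- s | P u) F u = \sum_(c <- res m) \sum_(u <- s | P u && dv m (u - c)) F u.
Proof.
move=> m0; rewrite (exchange_big_dep P) => [|c u _ /andP[]//].
apply: eq_bigr => u Pu; rewrite -[LHS](sum_res_fib (F u) u m0).
by apply: eq_bigl => c; rewrite Pu.
Qed.

Lemma sum_gfib (V : nmodType) m (P : pred O) (s : seq O) (F : O -> V) : m != 0 ->
  (forall u, u \in s -> P u -> cop u m) ->
  \sum_(u <- s | P u) F u = \sum_(c <- gres m) \sum_(u <- s | P u && dv m (u - c)) F u.
Proof.
move=> m0 h; rewrite (sum_fib P s F m0) /gres big_filter.
rewrite (bigID (fun x => cop x m)) /= [X in _ + X]big1 ?addr0// => c cm.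
rewrite big_seq_cond big1// => u /andP[us /andP[Pu hc]].
by move: cm; rewrite -(cop_cong hc) h.
Qed.

End Residues.

(** * Counting elements and canonical generators *)

Section Counting.
Variables (O : comNzRingType) (S : quad_pid O).
Implicit Types (x y z d q r u v w c m : O).
Local Notation nrm := (nrm S).
Local Notation res := (res S).
Local Notation gres := (gres S).
Local Notation phi := (phi S).

(** The form [4 * nrm x] is at least the sum of two squares of integers that determine [x],
    because the discriminant is at most [-1]. *)
Lemma nrm_disc x : (2 * c0 S x + qt S * c1 S x) ^+ 2 + c1 S x ^+ 2 <= 4 * (nrm x)%:Z.
Proof.
rewrite nrmzE nrmz4 lerD2l -{1}[c1 S x ^+ 2]mul1r ler_wpM2r ?sqr_ge0//.
by have := q_disc S; lia.
Qed.

Let bound n : nat := (2 * (1 + `|qt S|%N) * n)%N.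

Lemma sqr_le_4 (a : int) (n : nat) : a ^+ 2 <= 4 * n%:Z -> `|a| <= 2 * n%:Z.
Proof.
move=> h; rewrite leNgt; apply/negP => h'.
have : (2 * n%:Z + 1) ^+ 2 <= `|a| ^+ 2.
  by rewrite ler_pXn2r// ?nnegrE; lia.
by rewrite -normrX ger0_norm ?sqr_ge0//; nia.
Qed.

Lemma coord_bound n x : (nrm x <= n)%N ->
  `|c0 S x| <= (bound n)%:Z /\ `|c1 S x| <= (bound n)%:Z.
Proof.
move=> h; have h2 := nrm_disc x.
have h1 : c1 S x ^+ 2 <= 4 * n%:Z by have := sqr_ge0 (2 * c0 S x + qt S * c1 S x); lia.
have h0 : (2 * c0 S x + qt S * c1 S x) ^+ 2 <= 4 * n%:Z by have := sqr_ge0 (c1 S x); lia.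
move/sqr_le_4: h1 => h1; move/sqr_le_4: h0 => h0.
have h3 : `|qt S * c1 S x| <= `|qt S| * (2 * n%:Z) by rewrite normrM ler_wpM2l.
have e : (bound n)%:Z = 2 * n%:Z + `|qt S| * (2 * n%:Z).
  by rewrite /bound !PoszM PoszD abszE; ring.
have h4 : 0 <= `|qt S| * (2 * n%:Z) by rewrite mulr_ge0.
by rewrite e; lia.
Qed.

Definition ball n : seq O := undup [seq x <- [seq qc S (a%:Z - (bound n)%:Z) (b%:Z - (bound n)%:Z)
   | a <- iota 0 (bound n).*2.+1, b <- iota 0 (bound n).*2.+1] | (nrm x <= n)%N].

Lemma ball_uniq n : uniq (ball n). Proof. exact: undup_uniq. Qed.

Lemma mem_ball n x : (x \in ball n) = (nrm x <= n)%N.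
Proof.
rewrite mem_undup mem_filter andb_idr// => /coord_bound[h0 h1].
apply/allpairsP; exists (absz (c0 S x + bound n), absz (c1 S x + bound n)).
rewrite !mem_iota /=; split; [lia|lia|].
by rewrite {1}(qc_coord S x); congr qc; lia.
Qed.

(** A residue modulo [x y] is [u + x v] for unique residues [u] modulo [x] and [v] modulo [y]. *)
Lemma res_mul_size x y : x != 0 -> y != 0 -> size (res (x * y)) = (size (res x) * size (res y))%N.
Proof.
move=> x0 y0; have xy0 := mulO_neq0 S x0 y0.
rewrite -(size_allpairs (fun a b => a + x * b)).
apply: (@complete_size _ (x * y) predT) => //; first exact: complete_res.
have inj a b a' b' : a \in res x -> a' \in res x -> b \in res y -> b' \in res y ->
    dv (x * y) (a + x * b - (a' + x * b')) -> a = a' /\ b = b'.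
  move=> ha ha' hb hb' h.
  have e : a = a'.
    apply: (res_inj x0 ha ha').
    rewrite (_ : a - a' = a + x * b - (a' + x * b') + x * (b' - b)); last by ring.
    by apply: dvD; [apply: dv_trans h|]; rewrite dv_mulr ?dvxx.
  split => //; apply: (res_inj y0 hb hb'); rewrite -(dv_mul2l S _ _ x0).
  by move: h; rewrite e; congr dv; ring.
split.
- rewrite map_inj_in_uniq.
    by apply: allpairs_uniq; rewrite ?res_uniq// => -[a b] [a' b'] /allpairsP[[/= c d] [h1 h2 [-> ->]]]
     /allpairsP[[/= c' d'] [h1' h2' [-> ->]]] /= e; have [|-> ->] := inj _ _ _ _ h1 h1' h2 h2'; rewrite ?e ?subrr ?dv0.
  move=> _ _ /allpairsP[[a b] [/= ha hb ->]] /allpairsP[[a' b'] [/= ha' hb' ->]] /eqP.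
  by rewrite rep_eq => /inj[]// -> ->.
- exact/allP.
- move=> z _; have /dvP[k ek] := rep_cong x z.
  exists (rep x z + x * rep y k).
    by apply/allpairsP; exists (rep x z, rep y k); rewrite /= !rep_res.
  rewrite (_ : z - _ = x * (k - rep y k)) ?(dv_mul2l S) ?rep_cong//.
  by rewrite opprD addrA ek; ring.
Qed.

Lemma res_conj_size x : x != 0 -> size (res (conj S x)) = size (res x).
Proof.
move=> x0.
have dc a b : dv a b -> dv (conj S a) (conj S b).
  by move=> /dvP[z ->]; rewrite conjM dv_mull ?dvxx.
have cB a b : conj S (a - b) = conj S a - conj S b.
  rewrite conjD; congr (_ + _); apply: (coord_eq (S := S));
  rewrite ?(c0N, c1N, c0_qc, c1_qc); ring.
have cx0 : conj S x != 0 by rewrite -(nrm_eq0 S) nrm_conj nrm_eq0.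
have ci : injective (conj S) := inv_inj (conjK S).
rewrite -(size_map (conj S) (res x)).
apply: (@complete_size _ (conj S x) predT) => //; first exact: complete_res.
split.
- rewrite map_inj_in_uniq ?(map_inj_uniq ci) ?res_uniq//.
  move=> _ _ /mapP[a ha ->] /mapP[b hb ->] /eqP; rewrite rep_eq -cB => /dc.
  by rewrite !conjK => /(res_inj x0 ha hb) ->.
- exact/allP.
- move=> z _; exists (conj S (rep x (conj S z))); first by rewrite map_f// rep_res.
  by rewrite -{1}(conjK S z) -cB; apply: dc; exact: rep_cong.
Qed.

Lemma dv_nat_coord n x : dv n%:R x <-> (n %| c0 S x)%Z /\ (n %| c1 S x)%Z.
Proof.
split=> [/dvP[z ->]|[/dvdzP[a ea] /dvdzP[b eb]]].
  rewrite c0M c1M c0_nat c1_nat !(mulr0, subr0, addr0, add0r).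
  by split; apply: dvdz_mull.
apply/dvP; exists (qc S a b); apply: (coord_eq (S := S));
rewrite ?(c0M, c1M) ?(c0_qc, c1_qc, c0_nat, c1_nat) ?ea ?eb; ring.
Qed.

Lemma res_nat_size n : (0 < n)%N -> size (res n%:R) = (n * n)%N.
Proof.
move=> n0; have nn0 : n%:R != 0 :> O by rewrite -(nrm_eq0 S) nrm_nat -lt0n expn_gt0 n0.
rewrite -{2 3}(size_iota 0 n) -(size_allpairs (fun a b : nat => qc S a%:Z b%:Z)).
apply: (@complete_size _ n%:R predT) => //; first exact: complete_res.
have inj (a b : nat) : (a < n)%N -> (b < n)%N -> (n %| a%:Z - b%:Z)%Z -> a = b.
  move=> ha hb; rewrite -eqz_mod_dvd => /eqP; rewrite !modz_small ?ltz_nat//=.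
  by case.
have qB (a b a' b' : int) : qc S a b - qc S a' b' = qc S (a - a') (b - b').
  by rewrite qcN qcD.
split.
- rewrite map_inj_in_uniq.
    apply: allpairs_uniq; rewrite ?iota_uniq// => -[a b] [a' b'] _ _ /= /qc_inj[].
    by case=> -> [->].
  move=> _ _ /allpairsP[[a b] [/= ha hb ->]] /allpairsP[[a' b'] [/= ha' hb' ->]] /eqP.
  rewrite rep_eq qB => /dv_nat_coord; rewrite c0_qc c1_qc => -[h1 h2].
  move: ha hb ha' hb'; rewrite !mem_iota /= => ha hb ha' hb'.
  by rewrite (inj _ _ _ _ h1)// (inj _ _ _ _ h2).
- exact/allP.
- move=> z _; have [a [b [ha hb h]]] := mod_box S z n0.
  by exists (qc S a b) => //; apply/allpairsP; exists (a, b); rewrite /= !mem_iota.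
Qed.

(** Conjugation preserves the number of residues, and [x * conj x] is the natural number [nrm x],
    for which the residues form a square grid: the number of residues of [x] is the square root of
    [nrm x ^ 2]. *)
Lemma res_size x : x != 0 -> size (res x) = nrm x.
Proof.
move=> x0; have cx0 : conj S x != 0 by rewrite -(nrm_eq0 S) nrm_conj nrm_eq0.
have n0 := nrm_gt0 S x0.
have := res_nat_size n0; rewrite -(mul_conj S x) res_mul_size// res_conj_size// => h.
by apply/eqP; rewrite -eqn_sqr -!mulnn h.
Qed.

(** One generator for each principal ideal. *)
Definition can x : O := choose (fun y => dv x y && dv y x) x.

Lemma can_assoc x : dv x (can x) /\ dv (can x) x.
Proof.
have h : dv x x && dv x x by rewrite dvxx.
by have /andP[] := @chooseP _ (fun y => dv x y && dv y x) x h.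
Qed.

Lemma assoc_can x y : dv x y -> dv y x -> can x = can y.
Proof.
move=> h1 h2; rewrite /can; transitivity (choose (fun z => dv y z && dv z y) x).
  apply: eq_choose => z; apply/andP/andP => -[a b]; split;
   by [exact: dv_trans h2 _ | exact: dv_trans b _ | exact: dv_trans h1 _].
by apply: choose_id; rewrite ?h1 ?h2 ?dvxx.
Qed.

Lemma can_id x : can (can x) = can x.
Proof. by have [a b] := can_assoc x; apply: assoc_can. Qed.

Lemma can_neq0 x : x != 0 -> can x != 0.
Proof. by move=> x0; apply: (dv_neq0 x0); have [] := can_assoc x. Qed.

Lemma nrm_assoc x y : dv x y -> dv y x -> nrm x = nrm y.
Proof. by move=> /(dv_nrm S) a /(dv_nrm S) b; apply/eqP; rewrite eqn_dvd a b. Qed.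

Lemma nrm_can x : nrm (can x) = nrm x.
Proof. by have [a b] := can_assoc x; exact: nrm_assoc. Qed.

Definition divs s : seq O := [seq d <- ball (nrm s) | dv d s && (can d == d)].

Lemma divs_uniq s : uniq (divs s). Proof. by rewrite filter_uniq ?ball_uniq. Qed.

Lemma mem_divs s d : s != 0 -> (d \in divs s) = dv d s && (can d == d).
Proof.
move=> s0; rewrite mem_filter mem_ball andb_idr// => /andP[/(dv_nrm_le S s0)//].
Qed.

Lemma divs_neq0 s d : s != 0 -> d \in divs s -> d != 0.
Proof. by move=> s0; rewrite mem_divs// => /andP[/(dv_neq0 s0)]. Qed.

Lemma phi_le_dv d s : s != 0 -> dv d s -> (phi d <= phi s)%N.
Proof.
move=> s0 ds; have d0 := dv_neq0 s0 ds.
rewrite -[leqRHS](size_map (rep d)); apply: uniq_leq_size; first exact: gres_uniq.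
move=> c; rewrite mem_gres// => /andP[cd /eqP <-].
have [k hk] := unit_lift S s0 cd.
apply/mapP; exists (rep s (c + d * k)); first exact: rep_gres.
apply/eqP; rewrite rep_eq.
apply: dv_cong_trans (_ : dv d (c - (c + d * k))) (dv_trans ds (rep_cong s _)).
by rewrite opprD addrA subrr sub0r dvN dv_mulr ?dvxx.
Qed.

Definition quo s d : O :=
  if pselect (exists z, s = z * d) is left h then projT1 (cid h) else 0.

Lemma quoP s d : dv d s -> s = quo s d * d.
Proof. by rewrite /quo => /dvP h; case: pselect => // h'; exact: projT2 (cid h'). Qed.

(** Every residue [x] mod [s] is [g * u] with [g = gcd x s] and [u] a unit mod [s / g]. *)
Lemma nrm_le_sum_phi s : s != 0 -> (nrm s <= \sum_(d <- divs s) phi d)%N.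
Proof.
move=> s0; rewrite -res_size//.
pose l := [seq rep s (quo s d * u) | d <- divs s, u <- gres d].
have -> : (\sum_(d <- divs s) phi d = size l)%N.
  by rewrite size_allpairs_dep sumnE big_map.
apply: uniq_leq_size => [|x]; first exact: res_uniq.
rewrite mem_res// => /eqP ex.
have [g [gx gs _ [a [b e]]]] := gcdP S x s.
have [d' es] := dvP _ _ gs; pose d := can d'.
have d'0 : d' != 0 by apply: contraNneq s0 => h; rewrite es h mul0r.
have g0 := dv_neq0 s0 gs.
have [h1 h2] := can_assoc d'.
have ds : dv d s by apply: dv_trans h2 _; rewrite es dv_mulr ?dvxx.
have d0 := can_neq0 d'0; rewrite -/d in d0.
have dg : dv (quo s d) g.
  rewrite -(dv_mul2l S _ _ d0) [d * quo _ _]mulrC -quoP//.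
  by rewrite es; apply: dv_mulm => //; exact: dvxx.
have gd : dv g (quo s d).
  rewrite -(dv_mul2l S _ _ d0) [d * quo _ _]mulrC -quoP//.
  by rewrite es; apply: dv_mulm => //; exact: dvxx.
have [x' ex'] := dvP _ _ (dv_trans dg gx).
have q0 : quo s d != 0 by apply: contraNneq s0 => h; rewrite (quoP ds) h mul0r.
have cx : cop x' d.
  have [z ez] := dvP _ _ gd.
  have [w ew] := dvP _ _ dg.
  apply/copP; exists (z * a), (z * b).
  apply: (mulIO S q0); rewrite mul1r.
  transitivity (z * (a * (x' * quo s d) + b * (quo s d * d))); first by ring.
  by rewrite -ex' -(quoP ds) -e -ez.
apply/allpairsPdep; exists d, (rep d x'); split.
- by rewrite mem_divs// ds /d can_id eqxx.
- exact: rep_gres.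
- rewrite -ex; apply/eqP; rewrite rep_eq ex' mulrC -mulrBr {1}(quoP ds).
  by apply: dv_mulm; rewrite ?dvxx ?rep_cong.
Qed.

Lemma phi_gt0 s : s != 0 -> (0 < phi s)%N.
Proof.
move=> s0; have : rep s 1 \in gres s by rewrite rep_gres// copC cop1.
by rewrite phiE; case: (gres s).
Qed.

Lemma phi_le s : s != 0 -> (phi s <= nrm s)%N.
Proof. by move=> s0; rewrite -res_size// phiE size_filter count_size. Qed.

Lemma nrm_le_phi s : s != 0 -> (nrm s <= size (divs s) * phi s)%N.
Proof.
move=> s0; apply: leq_trans (nrm_le_sum_phi s0) _.
rewrite -sum1_size big_distrl /= big_seq [leqRHS]big_seq.
by apply: leq_sum => d; rewrite mem_divs// mul1n => /andP[ds _]; exact: phi_le_dv.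
Qed.

Definition cnt q (P : pred O) : nat := count P (gres q).

Lemma cntE q P : cnt q P = (\sum_(u <- gres q | P u) 1)%N.
Proof. by rewrite /cnt sum1_count. Qed.

Lemma cnt_mul q c (P : pred O) : q != 0 -> cop c q -> per_mod q P ->
  cnt q (fun u => P (c * u)) = cnt q P.
Proof.
move=> q0 cq pP; rewrite /cnt -!sumn_count !sumnE !big_map.
by apply: (@sum_gres_mul _ S nat q c (fun x => P x : nat)) => // x y h; rewrite (pP x y h).
Qed.

Lemma dv_periodic m c : per_mod m (fun u => dv m (u - c)).
Proof.
move=> x y h; apply/idP/idP; last exact: dv_cong_trans.
by apply: dv_cong_trans; rewrite dvBC.
Qed.

Lemma cnt_coset q d r y : q != 0 -> cop y q -> dv d q -> dv r q ->
  cnt q (fun u => dv d (u - y) && dv r (u - y)) = cnt q (fun u => dv d (u - 1) && dv r (u - 1)).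
Proof.
move=> q0 yq dq rq; rewrite -(cnt_mul q0 yq); last first.
  move=> a b h; congr (_ && _); first exact: (@dv_periodic d y _ _ (dv_trans dq h)).
  exact: (@dv_periodic r y _ _ (dv_trans rq h)).
rewrite /cnt; apply: eq_count => u /=; rewrite -[X in _ - X]mulr1.
by rewrite (cop_mul2 _ _ (cop_dv dq yq)) (cop_mul2 _ _ (cop_dv rq yq)).
Qed.

Lemma dv_cong d x y z : dv d (y - z) -> dv d (x - y) = dv d (x - z).
Proof.
move=> h; apply/idP/idP => h'; apply: dv_cong_trans h' _ => //.
by rewrite dvBC.
Qed.

Lemma cnt_coset1 q d c : q != 0 -> cop c d -> dv d q ->
  cnt q (fun u => dv d (u - c)) = cnt q (fun u => dv d (u - 1)).
Proof.
move=> q0 cd dq; have [s hs] := unit_lift S q0 cd.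
have h := @cnt_coset q d d _ q0 hs dq dq.
transitivity (cnt q (fun u => dv d (u - (c + d * s)) && dv d (u - (c + d * s)))).
  apply: eq_count => u; rewrite andbb; apply: dv_cong.
  by rewrite opprD addrA subrr sub0r dvN dv_mulr ?dvxx.
by rewrite h; apply: eq_count => u; rewrite andbb.
Qed.

Lemma cnt_fib q d (P : pred O) : d != 0 -> dv d q ->
  cnt q P = (\sum_(c <- gres d) cnt q (fun u => P u && dv d (u - c)))%N.
Proof.
move=> d0 dq; rewrite cntE (@sum_gfib _ S nat d P (gres q) (fun=> 1%N) d0) => [|u /gres_cop uq _]; last exact: cop_dv uq.
by apply: eq_bigr => c _; rewrite cntE.
Qed.

Lemma phi_cnt q d c : q != 0 -> dv d q -> cop c d ->
  (phi d * cnt q (fun u => dv d (u - c)) = phi q)%N.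
Proof.
move=> q0 dq cd; have d0 := dv_neq0 q0 dq.
have -> : phi q = cnt q predT by rewrite /cnt count_predT.
rewrite (cnt_fib predT d0 dq) big_seq.
rewrite (eq_bigr (fun _ => cnt q (fun u => dv d (u - c)))) => [|c' /gres_cop hc'].
  rewrite -big_seq big_const_seq count_predT iter_addn_0 phiE mulnC; reflexivity.
by rewrite /= cnt_coset1// -(cnt_coset1 _ cd).
Qed.

(** The units mod [q] that are [c] mod [d] and [1] mod [r]: the fibres of
    [G_q -> G_d x G_r], whose image is given by compatibility mod [gcd r d]. *)
Lemma phi_cnt2 q d r g c : q != 0 -> dv d q -> dv r q -> cop c q ->
  dv g r -> dv g d -> (exists a b, g = a * r + b * d) ->
  (phi r * phi d * cnt q (fun u => dv d (u - c) && dv r (u - 1)) =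
   phi q * phi g * dv g (c - 1))%N.
Proof.
move=> q0 dq rq cq gr gd bez.
have d0 := dv_neq0 q0 dq; have r0 := dv_neq0 q0 rq; have g0 := dv_neq0 d0 gd.
have [hg|hg] := boolP (dv g (c - 1)); last first.
  rewrite muln0 /cnt (eq_count (a2 := pred0)) ?count_pred0 ?muln0// => u /=.
  apply: contraNF hg => /andP[/(dv_trans gd) h1 /(dv_trans gr) h2].
  by apply: dv_cong_trans h2; rewrite dvBC.
have same c' : cop c' d -> dv g (c' - 1) ->
    cnt q (fun u => dv d (u - c') && dv r (u - 1)) =
    cnt q (fun u => dv d (u - 1) && dv r (u - 1)).
  move=> c'd hc'; have hz : dv g (1 - c') by rewrite dvBC.
  have [z /andP[z1 z2]] := crt gr gd bez hz.
  have [zr zd] : cop z r /\ cop z d.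
    by rewrite (cop_cong z1) (cop_cong z2) copC cop1.
  have [s hs] := unit_lift S q0 (copMr zr zd).
  set y := z + r * d * s in hs.
  have yz : dv r (y - 1) /\ dv d (y - c').
    split; [apply: (dv_cong_trans _ z1)|apply: (dv_cong_trans _ z2)];
      rewrite /y addrAC subrr add0r; last by rewrite [r * d]mulrC -mulrA dv_mulr ?dvxx.
    by rewrite -mulrA dv_mulr ?dvxx.
  transitivity (cnt q (fun u => dv d (u - y) && dv r (u - y))); last exact: cnt_coset.
  apply: eq_count => u /=.
  by case: yz => yz1 yz2; rewrite (dv_cong u yz1) (dv_cong u yz2).
rewrite (same c)//; last exact: cop_dv dq cq.
(* summing over all classes mod [d] compatible with [1] mod [r] *)
have e1 : (phi q = phi r * (count (fun c => dv g (c - 1)) (gres d) *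
   cnt q (fun u => dv d (u - 1) && dv r (u - 1%R))))%N.
  rewrite -(@phi_cnt q r 1)// 1?copC ?cop1//; congr (_ * _)%N.
  rewrite (cnt_fib _ d0 dq) -sum1_count big_distrl /= [RHS]big_mkcond /=.
  rewrite big_seq [RHS]big_seq; apply: eq_bigr => c' hc'; case: ifP => hg'.
    rewrite mul1n -(same c')//; last exact: gres_cop hc'.
    by apply: eq_count => u; rewrite andbC.
  apply/eqP; rewrite -leqn0 leqNgt -has_count; apply/hasPn => u _ /=.
  apply: contraFN hg' => /andP[/(dv_trans gr) h1 /(dv_trans gd) h2].
  by apply: dv_cong_trans h1; rewrite dvBC.
have e2 := phi_cnt d0 gd (_ : cop 1 g); rewrite copC cop1 in e2.
rewrite muln1 e1 -(e2 isT) /cnt; ring.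
Qed.

End Counting.

(** * Kernels of primitive characters *)

Section CauchySchwarz.
Variables (R : rcfType) (I : Type).

(** The discriminant of a nonnegative quadratic polynomial. *)
Lemma cauchy_schwarz (s : seq I) (P : pred I) (a b : I -> R) :
  (\sum_(i <- s | P i) a i * b i) ^+ 2 <=
  (\sum_(i <- s | P i) a i ^+ 2) * (\sum_(i <- s | P i) b i ^+ 2).
Proof.
set A := \sum_(i <- s | P i) a i ^+ 2; set B := \sum_(i <- s | P i) b i ^+ 2.
set C := \sum_(i <- s | P i) a i * b i.
have A0 : 0 <= A by apply: sumr_ge0 => i _; exact: sqr_ge0.
have B0 : 0 <= B by apply: sumr_ge0 => i _; exact: sqr_ge0.
have h x y : 0 <= x ^+ 2 * A - 2 * (x * y) * C + y ^+ 2 * B.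
  have -> : x ^+ 2 * A - 2 * (x * y) * C + y ^+ 2 * B = \sum_(i <- s | P i) (x * a i - y * b i) ^+ 2.
    rewrite /A /B /C !mulr_sumr -sumrB -big_split /=; apply: eq_bigr => i _; ring.
  by apply: sumr_ge0 => i _; exact: sqr_ge0.
have [AB|] := eqVneq (A + B) 0; last first.
  move=> nz; have [A1|Az] := ltP 0 A.
    have := h C A; rewrite (_ : _ + _ = A * (A * B - C ^+ 2)); last by ring.
    by rewrite pmulr_rge0// subr_ge0.
  have {Az} Az : A = 0 by apply/eqP; rewrite eq_le Az A0.
  have B1 : 0 < B by rewrite lt_def B0 andbT; move: nz; rewrite Az add0r.
  have := h B C; rewrite (_ : _ + _ = B * (A * B - C ^+ 2)); last by ring.
  by rewrite pmulr_rge0// subr_ge0.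
have Az : A = 0 by apply/eqP; rewrite eq_le A0 andbT -AB lerDl.
have Bz : B = 0 by move: AB; rewrite Az add0r.
have := h 1 1; have := h 1 (-1); rewrite Az Bz => h1 h2.
by have -> : C = 0 by lra; rewrite mul0r expr0n.
Qed.

Lemma cauchy_schwarz_sqrt (s : seq I) (P : pred I) (a b : I -> R) :
  `|\sum_(i <- s | P i) a i * b i| <=
  Num.sqrt (\sum_(i <- s | P i) a i ^+ 2) * Num.sqrt (\sum_(i <- s | P i) b i ^+ 2).
Proof.
rewrite -sqrtrM; last by apply: sumr_ge0 => i _; exact: sqr_ge0.
by rewrite -sqrtr_sqr ler_wsqrtr// cauchy_schwarz.
Qed.

End CauchySchwarz.

Section Kernel.
Variables (O : comNzRingType) (S : quad_pid O) (R : rcfType).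
Implicit Types (x y z d e q r u v w c m : O).
Local Notation nrm := (nrm S).
Local Notation gres := (gres S).
Local Notation phi := (phi S).
Local Notation divs := (divs S).

Lemma divs_self r : r != 0 -> can r = r -> r \in divs r.
Proof. by move=> r0 cr; rewrite mem_divs// dvxx cr eqxx. Qed.

Lemma divs_can s d : s != 0 -> d \in divs s -> can d = d.
Proof. by move=> s0; rewrite mem_divs// => /andP[_ /eqP]. Qed.

Lemma divs_dv s d : s != 0 -> d \in divs s -> dv d s.
Proof. by move=> s0; rewrite mem_divs// => /andP[]. Qed.

Lemma can_dv_eq d r : can d = d -> can r = r -> dv d r -> dv r d -> d = r.
Proof. by move=> e1 e2 h1 h2; rewrite -e1 -e2; exact: assoc_can. Qed.

Lemma nrm_eq_assoc d r : r != 0 -> dv d r -> (nrm r <= nrm d)%N -> dv r d.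
Proof.
move=> r0 /dvP[z e] h; have d0 : d != 0 by apply: contraNneq r0 => h'; rewrite e h' mulr0.
have : dv z 1.
  rewrite (unit_nrm1 S) eqn_leq nrm_gt0 ?andbT; last by apply: contraNneq r0 => h'; rewrite e h' mul0r.
  by move: h; rewrite e nrmM -{2}[nrm d]mul1n leq_pmul2r ?nrm_gt0.
move=> /dvP[w ew]; apply/dvP; exists w; by rewrite e mulrA -ew mul1r.
Qed.

Lemma proper_divs_lt r d : r != 0 -> can r = r -> d \in divs r -> d != r -> (nrm d < nrm r)%N.
Proof.
move=> r0 cr; rewrite mem_divs// => /andP[dr /eqP cd]; rewrite ltnNge; apply: contra => h.
by apply/eqP; apply: can_dv_eq => //; exact: nrm_eq_assoc.
Qed.

Fixpoint kf (n : nat) r u : R :=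
  if n is n'.+1 then
    (phi r)%:R * (dv r (u - 1))%:R - \sum_(d <- divs r | d != r) kf n' d u
  else 0.

(** The sum of the values at [u] of the primitive characters mod [r], for [u]
    prime to [r]; [kk_sum] determines it. *)
Definition kk r u : R := kf (nrm r).+1 r u.

Lemma kf_stable n r u : r != 0 -> can r = r -> (nrm r < n)%N -> kf n r u = kk r u.
Proof.
move: n r u; suff H N : forall n n' r u, (nrm r < N)%N -> (nrm r < n)%N -> (nrm r < n')%N -> r != 0 ->
    can r = r -> kf n r u = kf n' r u.
  by move=> n r u r0 cr h; exact: (H (nrm r).+1).
elim: N => // N IH [|n] // [|n'] // r u hN hn hn' r0 cr /=; congr (_ - _).
rewrite big_seq_cond [RHS]big_seq_cond; apply: eq_bigr => d /andP[dr ne].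
have lt := proper_divs_lt r0 cr dr ne.
by apply: IH; rewrite ?(leq_trans lt)// ?(divs_neq0 r0 dr) ?(divs_can r0 dr).
Qed.

Lemma kkE r u : r != 0 -> can r = r ->
  kk r u = (phi r)%:R * (dv r (u - 1))%:R - \sum_(d <- divs r | d != r) kk d u.
Proof.
move=> r0 cr; rewrite /kk /=; congr (_ - _).
rewrite big_seq_cond [RHS]big_seq_cond; apply: eq_bigr => d /andP[dr ne].
by apply: kf_stable; rewrite ?(divs_neq0 r0 dr) ?(divs_can r0 dr) ?proper_divs_lt.
Qed.

Lemma kk_sum r u : r != 0 -> can r = r ->
  \sum_(d <- divs r) kk d u = (phi r)%:R * (dv r (u - 1))%:R.
Proof.
by move=> r0 cr; rewrite (bigD1_seq r) ?divs_self ?divs_uniq//= kkE// subrK.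
Qed.

Lemma can_ind (P : O -> Prop) :
  (forall r, r != 0 -> can r = r -> (forall d, d \in divs r -> d != r -> P d) -> P r) ->
  forall r, r != 0 -> can r = r -> P r.
Proof.
move=> H r; have [n] := ubnP (nrm r); elim: n r => // n IH r; rewrite ltnS => h r0 cr.
apply: H => // d dr ne; apply: IH; rewrite ?(divs_neq0 r0 dr) ?(divs_can r0 dr)//.
exact: leq_trans (proper_divs_lt r0 cr dr ne) h.
Qed.

Lemma kk_per r : r != 0 -> can r = r -> per_mod r (kk r).
Proof.
move: r; apply: can_ind => r r0 cr IH x y h; rewrite !kkE//.
rewrite (@dv_periodic _ r 1 x y h); congr (_ - _).
rewrite big_seq_cond [RHS]big_seq_cond; apply: eq_bigr => d /andP[dr ne].
by apply: IH => //; exact: dv_trans (divs_dv r0 dr) h.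
Qed.

(** Characters that are primitive modulo [r] do not factor through the units modulo a [d] that
    [r] does not divide, so their sums over the fibres vanish. Without characters this is an
    induction along the divisors of [r]. *)
Lemma kk_orth r : r != 0 -> can r = r -> forall q d c, q != 0 -> dv r q -> dv d q ->
  ~~ dv r d -> cop c q -> \sum_(u <- gres q | dv d (u - c)) kk r u = 0.
Proof.
move: r; apply: can_ind => r r0 cr IH q d c q0 rq dq nrd cq.
have d0 := dv_neq0 q0 dq.
have [g0 [g0r g0d gmax [a [b bez]]]] := gcdP S r d.
have [h1 h2] := can_assoc g0; pose g := can g0.
have gr : dv g r by exact: dv_trans g0r.
have gd : dv g d by exact: dv_trans g0d.
have gbez : exists a b, g = a * r + b * d.
  by have [z ez] := dvP _ _ h1; exists (z * a), (z * b); rewrite /g ez bez; ring.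
have g_neq0 : g != 0 := dv_neq0 r0 gr.
pose N : R := (cnt S q (fun u => dv d (u - c)))%:R.
rewrite (eq_bigr (fun u => (phi r)%:R * (dv r (u - 1))%:R - \sum_(e <- divs r | e != r) kk e u)); last first.
  by move=> u _; rewrite kkE.
rewrite sumrB exchange_big /= -mulr_sumr.
have -> : \sum_(u <- gres q | dv d (u - c)) ((dv r (u - 1))%:R : R) =
    (cnt S q (fun u => dv d (u - c) && dv r (u - 1)))%:R.
  rewrite cntE natr_sum /= [RHS]big_mkcondr /=; apply: eq_bigr => u _; by case: (dv r _).
have -> : \sum_(e <- divs r | e != r) \sum_(u <- gres q | dv d (u - c)) kk e u =
    N * \sum_(e <- divs g) kk e c.
  transitivity (\sum_(e <- divs r | (e != r) && dv e d) N * kk e c).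
    rewrite big_seq_cond [RHS]big_mkcondr /= [RHS]big_seq_cond; apply: eq_bigr => e /andP[er ne].
    have eq' := dv_trans (divs_dv r0 er) rq.
    case: ifPn => ed; last exact: IH.
    rewrite /N cntE natr_sum mulr_suml; apply: eq_bigr => u hu; rewrite mul1r.
    apply: kk_per; rewrite ?(divs_neq0 r0 er) ?(divs_can r0 er)//.
    exact: dv_trans ed hu.
  rewrite -mulr_sumr -big_filter; congr (_ * _); apply: perm_big.
  apply: uniq_perm => [||e]; [exact/filter_uniq/divs_uniq|exact: divs_uniq|].
  rewrite mem_filter !mem_divs//; apply/idP/idP.
    move=> /andP[/andP[_ ed] /andP[er ->]]; rewrite andbT.
    by apply: dv_trans h1; exact: gmax.
  move=> /andP[eg ->]; rewrite (dv_trans eg gd) (dv_trans eg gr) !andbT.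
  by apply: contraNneq nrd => <-; exact: dv_trans eg gd.
rewrite kk_sum ?can_id//.
have phd : (phi d)%:R != 0 :> R by rewrite pnatr_eq0 -lt0n phi_gt0.
apply: (mulfI phd); rewrite mulr0.
have p1 := phi_cnt2 S q0 dq rq cq gr gd gbez.
have p2 := phi_cnt S q0 dq (cop_dv dq cq).
move/(congr1 (fun n => n%:R : R)): p1; move/(congr1 (fun n => n%:R : R)): p2.
rewrite -/N !natrM -/N => p2 p1; rewrite mulrBr.
rewrite mulrCA [X in X - _]mulrA p1 -p2; ring.
Qed.

Definition inv q v : O :=
  if pselect (exists y, dv q (v * y - 1)) is left h then projT1 (cid h) else 0.

Lemma invP q v : cop v q -> dv q (v * inv q v - 1).
Proof.
move=> h; rewrite /inv; case: pselect => [h'|[]]; first exact: projT2 (cid h').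
exact: cop_inv.
Qed.

Lemma inv_coprime q v : cop v q -> cop (inv q v) q.
Proof. by move=> /invP h; apply: (@inv_cop _ _ v); rewrite mulrC. Qed.

Lemma inv_uniq q v y : cop v q -> dv q (v * y - 1) -> dv q (inv q v - y).
Proof.
move=> vq h; rewrite -(cop_mul2 _ _ vq); apply: dv_cong_trans (invP vq) _.
by rewrite dvBC.
Qed.

Lemma sum_gres_pick (V : nmodType) r y (F : O -> V) : r != 0 -> cop y r -> per_mod r F ->
  \sum_(v <- gres r | dv r (v - y)) F v = F y.
Proof.
move=> r0 yr pF; rewrite (big_rem (rep r y)) ?rep_gres//= rep_congr.
rewrite big_seq_cond big1 ?addr0; first by rewrite (periodic_rep y pF).
move=> c /andP[]; rewrite mem_rem_uniq ?gres_uniq// inE => /andP[ne cr] h.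
case/negP: ne; apply/eqP; apply: (res_inj (S := S) r0); rewrite ?rep_res ?gres_res//.
exact: dv_cong_trans h (rep_cong _ _).
Qed.

Lemma dv_inv_eq r y v : cop v r -> dv r (y * inv r v - 1) = dv r (v - y).
Proof.
move=> vr; rewrite -(cop_mul2 (y * inv r v) 1 vr) mulr1.
have h : dv r (v * (y * inv r v) - y).
  rewrite (_ : _ - y = y * (v * inv r v - 1)) ?dv_mull ?invP//; ring.
by rewrite [LHS]dvBC (dv_cong v h) .
Qed.

(** Up to [phi r], convolution by the kernel is the projection onto the span of the primitive
    characters. *)
Lemma kk_idem r x y : r != 0 -> can r = r -> cop x r -> cop y r ->
  \sum_(v <- gres r) kk r (x * v) * kk r (y * inv r v) = (phi r)%:R * kk r (x * y).
Proof.
move=> r0 cr xr yr; have pk := kk_per r0 cr.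
have pkx : per_mod r (fun v => kk r (x * v)).
  by move=> a b h; apply: pk; rewrite -mulrBr dv_mull.
under eq_bigr do rewrite [kk r (y * _)]kkE// mulrBr mulr_sumr.
rewrite sumrB [X in X - _](_ : _ = (phi r)%:R * kk r (x * y)); last first.
  rewrite -(sum_gres_pick r0 yr pkx) mulr_sumr [RHS]big_mkcond /= big_seq [RHS]big_seq.
  apply: eq_bigr => v /gres_cop vr; rewrite dv_inv_eq//.
  by case: (dv r _); rewrite ?mulr0 ?mulr1// mulrC.
rewrite exchange_big /= big_seq_cond big1 ?subr0// => e /andP[er ne].
have e0 := divs_neq0 r0 er; have ce := divs_can r0 er; have edr := divs_dv r0 er.
have nre : ~~ dv r e by apply: contra ne => h; apply/eqP; exact: can_dv_eq.
rewrite (@sum_gfib _ S _ e xpredT _ _ e0) => // [|v /gres_cop vr _]; last exact: cop_dv vr.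
rewrite big_seq big1// => c /gres_cop ce'.
rewrite big_seq_cond (eq_bigr (fun v => kk e (y * inv e c) * kk r (x * v))) /=; last first.
  move=> v /andP[/gres_cop vr hv].
  rewrite mulrC; congr (_ * _); apply: kk_per => //; rewrite -mulrBr dv_mull//.
  rewrite dvBC; apply: inv_uniq => //.
  have ve : cop v e by rewrite (cop_cong hv).
  have h1 : dv e (v * inv r v - 1) by apply: dv_trans edr (invP _).
  rewrite (_ : _ - 1 = (v * inv r v - 1) - (v - c) * inv r v); last by ring.
  by apply: dvB => //; rewrite dv_mulr.
rewrite -big_seq_cond -mulr_sumr; set T := (X in _ * X); suff -> : T = 0 by rewrite mulr0.
pose F u := if dv e (u - x * c) then kk r u else 0.
have pF : per_mod r F.
  move=> a b h; rewrite /F (pk _ _ h) (@dv_periodic _ e (x * c) a b)//.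
  exact: dv_trans h.
have xe : cop x e := cop_dv edr xr.
transitivity (\sum_(v <- gres r) F (x * v)).
  by rewrite /T big_mkcond; apply: eq_bigr => v _; rewrite /F cop_mul2.
rewrite (sum_gres_mul S r0 xr pF) /F -big_mkcond /=.
have [s hs] := unit_lift S r0 (copMl xe ce').
rewrite (eq_bigl (fun u => dv e (u - (x * c + e * s)))); last first.
  move=> u; apply: dv_cong.
  by rewrite opprD addrA subrr sub0r dvN dv_mulr ?dvxx.
by apply: kk_orth; rewrite ?dvxx.
Qed.

Lemma kk_inv r u : r != 0 -> can r = r -> cop u r -> kk r (inv r u) = kk r u.
Proof.
move=> r0 cr; move: r r0 cr u; apply: can_ind => r r0 cr IH u ur; rewrite !kkE//.
have -> : dv r (inv r u - 1) = dv r (u - 1).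
  by rewrite -[inv r u]mul1r dv_inv_eq.
congr (_ - _); rewrite big_seq_cond [RHS]big_seq_cond; apply: eq_bigr => d /andP[dr ne].
have ddr := divs_dv r0 dr.
rewrite -(IH d dr ne u) ?(cop_dv ddr ur)//; apply: kk_per; rewrite ?(divs_neq0 r0 dr) ?(divs_can r0 dr)//.
rewrite dvBC; apply: inv_uniq; first exact: cop_dv ddr ur.
exact: dv_trans ddr (invP ur).
Qed.


Lemma sum_gres_inv (V : nmodType) r (F : O -> V) : r != 0 -> per_mod r F ->
  \sum_(u <- gres r) F (inv r u) = \sum_(u <- gres r) F u.
Proof.
move=> r0 pF; rewrite -(big_map (inv r) xpredT F).
apply: (complete_sum (cop_periodic (q := r)) pF _ (complete_gres S r0)).
have inj x y : x \in gres r -> y \in gres r -> dv r (inv r x - inv r y) -> x = y.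
  move=> xr yr h; apply: (res_inj (S := S) r0); rewrite ?gres_res//.
  have h1 := invP (gres_cop xr); have h2 := invP (gres_cop yr).
  rewrite -(cop_mul2 _ _ (inv_coprime (gres_cop xr))) ![inv r x * _]mulrC.
  rewrite (_ : _ - _ = (x * inv r x - 1) - (y * inv r y - 1) - y * (inv r x - inv r y)); last by ring.
  by do !apply: dvB => //; exact: dv_mull.
split.
- rewrite map_inj_in_uniq ?map_inj_in_uniq ?gres_uniq//.
    by move=> x y xr yr e; apply: inj; rewrite // e subrr dv0.
  move=> _ _ /mapP[x xr ->] /mapP[y yr ->] /eqP; rewrite rep_eq => h.
  by rewrite (inj _ _ xr yr h).
- by apply/allP => _ /mapP[x xr ->]; exact: inv_coprime (gres_cop xr).
- move=> x xr; have ir := inv_coprime xr.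
  exists (inv r (rep r (inv r x))); first by rewrite map_f ?rep_gres.
  rewrite dvBC; apply: inv_uniq; first by rewrite (cop_cong (rep_congr _ _)).
  have h := invP xr.
  rewrite (_ : _ - 1 = (x * inv r x - 1) + x * (rep r (inv r x) - inv r x)); last by ring.
  by rewrite dvD// dv_mull// rep_congr.
Qed.

(** The kernel takes the same value at a unit and at its inverse, so up to a translation by [y]
    this is the projection property at the unit element. *)
Lemma kk_sqr_sum r y : r != 0 -> can r = r -> cop y r ->
  \sum_(v <- gres r) kk r (y * v) ^+ 2 = (phi r)%:R * kk r 1.
Proof.
move=> r0 cr yr; have pk := kk_per r0 cr.
have h1 : cop 1 r by rewrite copC cop1.
rewrite (sum_gres_mul S r0 yr (F := fun v => kk r v ^+ 2)) => [|a b /pk -> //].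
have := kk_idem r0 cr h1 h1; rewrite mul1r => <-; rewrite big_seq [RHS]big_seq; apply: eq_bigr => v /gres_cop vr.
by rewrite !mul1r kk_inv// expr2.
Qed.

Lemma kk1_ge0 r : r != 0 -> can r = r -> 0 <= kk r 1.
Proof.
move=> r0 cr; have h1 : cop 1 r by rewrite copC cop1.
have ph : 0 < (phi r)%:R :> R by rewrite ltr0n phi_gt0.
by rewrite -(pmulr_rge0 _ ph) -(kk_sqr_sum r0 cr h1) sumr_ge0// => v _; exact: sqr_ge0.
Qed.

(** The kernel is the matrix of a projection, so its entries are bounded by the diagonal one,
    the number of primitive characters. *)
Lemma kk_bound r u : r != 0 -> can r = r -> cop u r -> `|kk r u| <= (phi r)%:R.
Proof.
move=> r0 cr ur; have h1 : cop 1 r by rewrite copC cop1.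
have ph : 0 < (phi r)%:R :> R by rewrite ltr0n phi_gt0.
apply: (@le_trans _ _ (kk r 1)).
  rewrite -(ler_pM2l ph) -{1}(ger0_norm (ltW ph)) -normrM -[u]mulr1 -kk_idem//.
  apply: le_trans (cauchy_schwarz_sqrt _ _ _ _) _; rewrite kk_sqr_sum//.
  rewrite (_ : \sum_(v <- _) _ = (phi r)%:R * kk r 1); last first.
    rewrite -(kk_sqr_sum r0 cr h1) -(sum_gres_inv r0 (F := fun v => kk r (1 * v) ^+ 2))//.
    by move=> a b h; rewrite !mul1r (kk_per r0 cr h).
  by rewrite -expr2 sqr_sqrtr// mulr_ge0 ?(ltW ph) ?kk1_ge0.
have := kk_sum 1 r0 cr; rewrite subrr dv0 mulr1 => <-.
rewrite (bigD1_seq r) ?divs_self ?divs_uniq//= lerDl big_seq_cond sumr_ge0// => d /andP[dr _].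
by apply: kk1_ge0; rewrite ?(divs_neq0 r0 dr) ?(divs_can r0 dr).
Qed.

Definition ksum r (s : seq O) v : R := \sum_(n <- s | cop n r) kk r (n * v).
Definition kvar r (s : seq O) : R := \sum_(v <- gres r) ksum r s v ^+ 2.

Lemma ksumE r s v : ksum r s v = \sum_(n <- s | cop n r) kk r (n * v).
Proof. by []. Qed.

Lemma kvarE r s : kvar r s = \sum_(v <- gres r) ksum r s v ^+ 2.
Proof. by []. Qed.

Lemma kvar_ge0 r s : 0 <= kvar r s.
Proof. by apply: sumr_ge0 => v _; exact: sqr_ge0. Qed.

Lemma ksum_per r s : r != 0 -> can r = r -> per_mod r (ksum r s).
Proof.
move=> r0 cr a b h; apply: eq_bigr => n _; apply: kk_per => //.
by rewrite -mulrBr dv_mull.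
Qed.

(** The projection property separates the variables [x] and [y]; Cauchy-Schwarz in the unit [v]
    does the rest. *)
Lemma kk_bilinear r (s s' : seq O) c : r != 0 -> can r = r -> cop c r ->
  (phi r)%:R * `|\sum_(x <- s | cop x r) \sum_(y <- s' | cop y r) kk r (x * y * c)| <=
  Num.sqrt (kvar r s) * Num.sqrt (kvar r s').
Proof.
move=> r0 cr hc; have ph : 0 < (phi r)%:R :> R by rewrite ltr0n phi_gt0.
rewrite -{1}(ger0_norm (ltW ph)) -normrM.
have -> : (phi r)%:R * (\sum_(x <- s | cop x r) \sum_(y <- s' | cop y r) kk r (x * y * c)) =
   \sum_(v <- gres r) ksum r s v * ksum r s' (c * inv r v).
  rewrite mulr_sumr; under [RHS]eq_bigr do rewrite mulr_suml.
  rewrite exchange_big /=; apply: eq_bigr => x xr.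
  under [RHS]eq_bigr do rewrite mulr_sumr.
  rewrite exchange_big /= mulr_sumr; apply: eq_bigr => y yr.
  rewrite -mulrA -kk_idem ?copMl//; apply: eq_bigr => v _.
  by rewrite mulrA.
apply: le_trans (cauchy_schwarz_sqrt _ _ _ _) _.
rewrite (_ : \sum_(v <- _) ksum r s' _ ^+ 2 = kvar r s')//.
have p1 : per_mod r (fun v => ksum r s' (c * v) ^+ 2).
  by move=> a b h; rewrite (@ksum_per _ _ r0 cr (c * a) (c * b))// -mulrBr dv_mull.
have p2 : per_mod r (fun v => ksum r s' v ^+ 2).
  by move=> a b h; rewrite (@ksum_per _ _ r0 cr a b).
by rewrite (sum_gres_inv r0 p1) (sum_gres_mul S r0 hc p2).
Qed.

End Kernel.

(** * Exponential sums *)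

Section SeqSums.
Variables (R : realDomainType).

Lemma ler_sum_subset (I : eqType) (s1 s2 : seq I) (F : I -> R) :
  uniq s1 -> {subset s1 <= s2} -> (forall i, 0 <= F i) ->
  \sum_(i <- s1) F i <= \sum_(i <- s2) F i.
Proof.
elim: s1 s2 => [|x s1 IH] s2; first by rewrite big_nil => _ _ h; apply: sumr_ge0.
move=> /= /andP[xs u] sub h; rewrite big_cons.
have xs2 : x \in s2 by apply: sub; rewrite inE eqxx.
rewrite (big_rem x xs2) lerD2l/=; apply: IH => // y ys.
have ys2 : y \in s2 by apply: sub; rewrite inE ys orbT.
move: ys2; rewrite (perm_mem (perm_to_rem xs2)) inE => /orP[/eqP e|//].
by rewrite -e ys in xs.
Qed.

Lemma ler_sum_inj (I J : eqType) (s1 : seq I) (s2 : seq J) (f : I -> J) (F : I -> R) (G : J -> R) :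
  uniq s1 -> {in s1 &, injective f} -> {in s1, forall i, f i \in s2} ->
  {in s1, forall i, F i <= G (f i)} -> (forall j, 0 <= G j) ->
  \sum_(i <- s1) F i <= \sum_(j <- s2) G j.
Proof.
move=> u inj sub le h.
apply: (@le_trans _ _ (\sum_(j <- map f s1) G j)).
  by rewrite big_map [leLHS]big_seq [leRHS]big_seq; apply: ler_sum.
apply: ler_sum_subset => //; first by rewrite map_inj_in_uniq.
by move=> _ /mapP[i is1 ->]; exact: sub.
Qed.

End SeqSums.

Section Exponential.
Import numFieldNormedType.Exports.
Variable R : realType.
Implicit Types (x y t : R) (z w : R[i]).

Definition sqn z : R := complex.Re z ^+ 2 + complex.Im z ^+ 2.

Lemma sqn_ge0 z : 0 <= sqn z. Proof. by rewrite addr_ge0 ?sqr_ge0. Qed.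

Lemma sqnM z w : sqn (z * w) = sqn z * sqn w.
Proof. by case: z w => [a b] [c d]; rewrite /sqn /=; ring. Qed.

Lemma sqn_conj z : (sqn z)%:C%C = z * (z^*)%C.
Proof.
case: z => [a b]; rewrite /sqn /=; apply/eqP; rewrite eq_complex /=.
by apply/andP; split; apply/eqP; ring.
Qed.

Definition ee x : R[i] := (cos (2 * pi * x) +i* sin (2 * pi * x))%C.

Lemma ee0 : ee 0 = 1.
Proof. by rewrite /ee mulr0 cos0 sin0. Qed.

Lemma eeD x y : ee (x + y) = ee x * ee y.
Proof.
rewrite /ee mulrDr cosD sinD; apply/eqP; rewrite eq_complex /= eqxx /=.
by apply/eqP; ring.
Qed.

Lemma eeN x : ee (- x) = ((ee x)^*)%C.
Proof. by rewrite /ee mulrN cosN sinN. Qed.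

Lemma sqn_ee x : sqn (ee x) = 1.
Proof. by rewrite /sqn /= cos2Dsin2. Qed.

Lemma ee1 : ee 1 = 1.
Proof.
by rewrite /ee mulr1 (_ : 2 * pi = pi *+ 2) ?cos2pi ?sin2pi// mulr_natl.
Qed.

Lemma eeMn x n : ee (x *+ n) = ee x ^+ n.
Proof. by elim: n => [|n IH]; rewrite ?ee0// mulrS eeD IH exprS. Qed.

Lemma ee_int (k : int) : ee k%:~R = 1.
Proof.
have h n : ee n%:R = 1 by rewrite eeMn ee1 expr1n.
by case: k => n; rewrite ?NegzE ?mulrNz ?eeN -?pmulrn h ?rmorph1.
Qed.

Lemma eeDint x (k : int) : ee (x + k%:~R) = ee x.
Proof. by rewrite eeD ee_int mulr1. Qed.

Lemma sin_ge x : 0 <= x <= pi / 2 -> x / 4 <= sin x.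
Proof.
move=> /andP[x0 x1].
have pi2 := pihalf_lt2 R; have pi0 := pi_gt0 R.
have c4 : 1 / 2 <= cos (pi / 4 : R).
  have c0 : 0 <= cos (pi / 4 : R) by apply: cos_ge0_pihalf; apply/andP; split; lra.
  have h := cos_mulr2n (pi / 4 : R).
  rewrite (_ : pi / 4 *+ 2 = pi / 2 :> R) ?cos_pihalf in h; last by lra.
  rewrite mulr2n in h; rewrite leNgt; apply/negP => h'.
  have : cos (pi / 4) ^+ 2 < (1 / 2) ^+ 2 :> R by rewrite ltr_pXn2r// ?nnegrE; lra.
  by lra.
have s4 : 1 / 2 <= sin (pi / 4 : R).
  by rewrite -cosBpihalf -cosN (_ : - _ = pi / 4)//; lra.
have [x4|x4] := leP x (pi / 4); last first.
  have : sin (pi / 4) < sin x by rewrite ltr_sin// in_itv/=; apply/andP; split; lra.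
  by lra.
have cs : ({within `[0%R, x], continuous (@sin R)})%classic.
  by apply: continuous_subspaceT; exact: continuous_sin.
have [c cx e] := MVT_segment x0 (fun (z : R) _ => is_derive_sin z) cs.
move: e; rewrite sin0 !subr0 => ->.
have : cos (pi / 4) <= cos c.
  move: cx; rewrite in_itv /= => /andP[cx0 cx1].
  have [->//|ne] := eqVneq c (pi / 4).
  by apply/ltW; rewrite ltr_cos ?in_itv/=; first rewrite lt_neqAle ne; try (apply/andP; split); lra.
by nra.
Qed.

Lemma sqn_1Bee t : sqn (1 - ee t) = (2 * sin (pi * t)) ^+ 2.
Proof.
rewrite /sqn /= add0r sqrrN.
have -> : 2 * pi * t = (pi * t) *+ 2 by rewrite -mulr_natl; ring.
rewrite cos_mulr2n sin_mulr2n; have h := cos2Dsin2 (pi * t).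
rewrite !mulr2n.
have e : sin (pi * t) ^+ 2 = 1 - cos (pi * t) ^+ 2 by lra.
set c := cos _ in h e *; set s := sin _ in h e *.
transitivity (4 * (1 - c ^+ 2) ^+ 2 + 4 * c ^+ 2 * s ^+ 2); first by ring.
by rewrite -e (_ : c ^+ 2 = 1 - s ^+ 2); [ring|lra].
Qed.

Lemma sqn_1Bee_ge t : `|t| <= 1 / 2 -> t ^+ 2 <= sqn (1 - ee t).
Proof.
have pi0 := pi_gt0 R; have pi2 := pi_ge2 R.
wlog t0 : t / 0 <= t => [H ht|].
  have [t0|t0] := leP 0 t; first exact: H.
  rewrite -sqrrN -(_ : sqn (1 - ee (- t)) = sqn (1 - ee t)).
    by apply: H; rewrite ?normrN//; lra.
  by rewrite eeN /sqn /= opprK add0r add0r sqrrN.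
rewrite ger0_norm// => ht; rewrite sqn_1Bee.
have h : pi * t / 4 <= sin (pi * t).
  by apply: sin_ge; apply/andP; split; nra.
by rewrite ler_pXn2r ?nnegrE//; nra.
Qed.

Definition dir (n : nat) t : R[i] := \sum_(i < n) ee (t *+ i).


Lemma sqn_le_sum (I : Type) (s : seq I) (F : I -> R[i]) :
  sqn (\sum_(i <- s) F i) <= (size s)%:R * \sum_(i <- s) sqn (F i).
Proof.
have c (f : I -> R) : (\sum_(i <- s) f i) ^+ 2 <= (size s)%:R * \sum_(i <- s) f i ^+ 2.
  have := cauchy_schwarz s xpredT (fun=> 1 : R) f.
  rewrite (_ : \sum_(i <- s) 1 ^+ 2 = (size s)%:R :> R); last first.
    by rewrite expr1n big_const_seq count_predT iter_addr_0.
  by rewrite (_ : \sum_(i <- s) 1 * f i = \sum_(i <- s) f i)//; apply: eq_bigr => i _; rewrite mul1r.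
by rewrite /sqn !raddf_sum big_split mulrDr; apply: lerD; exact: c.
Qed.

Lemma dir_le n t : sqn (dir n t) <= n%:R ^+ 2.
Proof.
apply: le_trans (sqn_le_sum _ _) _.
under eq_bigr do rewrite sqn_ee.
have e : size (index_enum 'I_n) = n by rewrite -sum1_size sum1_card card_ord.
by rewrite big_const_seq count_predT iter_addr_0 e expr2.
Qed.

Lemma dir_int n t (k : int) : dir n (t + k%:~R) = dir n t.
Proof. by apply: eq_bigr => i _; rewrite !eeMn eeDint. Qed.

(** The geometric sum [dir n t] is [(ee (n t) - 1) / (ee t - 1)], and the denominator is at least
    [|t|] in modulus. *)
Lemma dir_small n t : `|t| <= 1 / 2 -> t != 0 -> sqn (dir n t) <= 4 / t ^+ 2.
Proof.
move=> ht t0; have t2 : 0 < t ^+ 2 by rewrite exprn_even_gt0.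
rewrite ler_pdivlMr//; apply: (@le_trans _ _ (sqn (dir n t) * sqn (1 - ee t))).
  by rewrite ler_wpM2l ?sqn_ge0 ?sqn_1Bee_ge.
rewrite -sqnM (_ : dir n t * (1 - ee t) = 1 - ee (t *+ n)).
  by rewrite sqn_1Bee exprMn; have := sin_max (pi * (t *+ n)); rewrite ler_norml => /andP[]; nra.
rewrite mulrC /dir; elim: n => [|n IH]; first by rewrite big_ord0 mulr0 mulr0n ee0 subrr.
by rewrite big_ord_recr/= mulrDr IH mulrBl mul1r mulrS eeD; ring.
Qed.

End Exponential.
Arguments ee {R} x : simpl never.

(** * The dual large sieve *)

Section LargeSieve.
Variable R : realType.
Implicit Types (t : R) (k : int).

(** Decay of the Fejer kernel at the [k]-th cell; a negative index [Negz n] is at distance [n]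
    from the origin. *)
Definition mu k : R := 16 / ((match k with Posz n => n | Negz n => n end).+1)%:R ^+ 2.

Lemma mu_ge0 k : 0 <= mu k.
Proof. by rewrite divr_ge0 ?exprn_ge0. Qed.

Lemma sum_inv_sqr (n : nat) : \sum_(i < n.+1) (i.+1)%:R ^- 2 <= 2 - (n.+1)%:R^-1 :> R.
Proof.
elim: n => [|n IH]; first by rewrite big_ord_recr big_ord0 /= add0r expr1n invr1 -[2]/(1 + 1) addrK.
rewrite big_ord_recr /=; apply: (@le_trans _ _ (2 - (n.+1)%:R^-1 + (n.+2)%:R ^- 2)).
  by rewrite lerD2r.
rewrite -[n.+2%:R]natr1; set x : R := n.+1%:R.
have x0 : 0 < x by rewrite ltr0n.
have h : (x + 1) ^- 2 <= x^-1 - (x + 1)^-1.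
  have -> : x^-1 - (x + 1)^-1 = (x * (x + 1))^-1 by field; rewrite !gt_eqF//; lra.
  by rewrite lef_pV2 ?posrE ?mulr_gt0 ?exprn_gt0//; nra.
by move: h; set u := _ ^- 2; set v := x^-1; set w := (x + 1)^-1; lra.
Qed.

Lemma sum_mu (l : seq int) : uniq l -> \sum_(k <- l) mu k <= 64.
Proof.
move=> u; pose K := (\sum_(k <- l) `|k|)%N.
pose l' := map Posz (iota 0 K.+1) ++ map Negz (iota 0 K.+1).
apply: (@le_trans _ _ (\sum_(k <- l') mu k)).
  apply: ler_sum_subset => // [k kl|k]; last exact: mu_ge0.
  have : (`|k| <= K)%N by rewrite /K (big_rem k kl)/= leq_addr.
  rewrite mem_cat; case: k {kl} => n h; apply/orP; [left|right];
    by apply/mapP; exists n => //; rewrite mem_iota; lia.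
have e (f : nat -> int) : (forall n, mu (f n) = 16 * n.+1%:R ^- 2) ->
    \sum_(k <- map f (iota 0 K.+1)) mu k <= 32.
  move=> h; rewrite big_map (eq_bigr (fun n : nat => 16 * n.+1%:R ^- 2)) => [|n _//].
  rewrite -mulr_sumr -[iota _ _]/(index_iota 0 K.+1) big_mkord.
  have := sum_inv_sqr K; have : 0 < (K.+1)%:R^-1 :> R by rewrite invr_gt0 ltr0n.
  by set w := _^-1; set v := \sum_(i < _) _; lra.
by rewrite big_cat /=; have := e Posz (fun _ => erefl); have := e Negz (fun _ => erefl); lra.
Qed.

Lemma sum_mu2 (l : seq (int * int)) : uniq l -> \sum_(k <- l) mu k.1 * mu k.2 <= 64 ^+ 2.
Proof.
move=> u; pose l1 := undup (map fst l); pose l2 := undup (map snd l).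
apply: (@le_trans _ _ (\sum_(k <- [seq (a, b) | a <- l1, b <- l2]) mu k.1 * mu k.2)).
  apply: ler_sum_subset => // [[a b] kl|k]; last by rewrite mulr_ge0 ?mu_ge0.
  by apply/allpairsP; exists (a, b); rewrite !mem_undup; split => //; apply/mapP; exists (a, b).
rewrite big_allpairs /=; under eq_bigr do rewrite -mulr_sumr.
by rewrite -mulr_suml expr2 ler_pM ?sumr_ge0 ?sum_mu ?undup_uniq// => *; exact: mu_ge0.
Qed.

Definition nint t : int := Num.floor (t + 1 / 2).

Lemma nintP t : `|t - (nint t)%:~R| <= 1 / 2.
Proof.
have /andP[h1 h2] := floor_itv (t + 1 / 2).
by rewrite ler_norml /nint; move: h1 h2; rewrite intrD; lra.
Qed.

Definition slot (delta t : R) : int := Num.floor ((t - (nint t)%:~R) / delta).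

(** The Fejer kernel of length [3 H] is at most [H ^ 2] times a summable weight of the cell of
    width [delta] containing [t]. *)
Lemma dir_cell (H : nat) (delta t : R) : 0 < delta -> 1 <= H%:R * delta ->
  sqn (dir (3 * H) t) <= H%:R ^+ 2 * mu (slot delta t).
Proof.
move=> d0 hd; set tau := t - (nint t)%:~R.
have ht := nintP t; rewrite -/tau in ht.
have -> : dir (3 * H) t = dir (3 * H) tau by rewrite /tau -mulrNz dir_int.
have /andP[h1 h2] := floor_itv (tau / delta); rewrite -/(slot delta t) in h1 h2.
rewrite ler_pdivlMr// in h1; rewrite ltr_pdivrMr// in h2.
have hH : 0 <= H%:R :> R by [].
have h0 : sqn (dir (3 * H) tau) <= H%:R ^+ 2 * 16.
  by apply: le_trans (dir_le _ _) _; rewrite natrM; nra.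
have main n : n.+1%:R * delta <= `|tau| -> sqn (dir (3 * H) tau) <= H%:R ^+ 2 * (16 / n.+2%:R ^+ 2).
  move=> hn; have n0 : 1 <= n.+1%:R :> R by rewrite ler1n.
  have t0 : 0 < `|tau| by apply: lt_le_trans hn; rewrite mulr_gt0// ltr0n.
  apply: le_trans (dir_small _ ht _) _; first by rewrite -normr_gt0.
  rewrite -[n.+2%:R]natr1; set x : R := n.+1%:R in hn n0 *.
  rewrite -(real_normK (num_real tau)); set y := `|tau| in hn t0 *.
  have y2 : 0 < y ^+ 2 by rewrite exprn_gt0.
  have x2 : 0 < (x + 1) ^+ 2 by rewrite exprn_gt0//; lra.
  rewrite ler_pdivrMr// mulrAC mulrA ler_pdivlMr//.
  have h3 : x <= H%:R * y by nra.
  have h4 : x ^+ 2 <= (H%:R * y) ^+ 2.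
    have x0 : 0 <= x by lra.
    by rewrite ler_pXn2r// nnegrE// (le_trans x0).
  by move: h4; rewrite exprMn; nra.
rewrite /mu; move: h1 h2; case: (slot delta t) => [[|n]|[|n]] h1 h2.
- by rewrite expr1n divr1.
- by apply: main; apply: le_trans (ler_norm _); move: h1.
- by rewrite expr1n divr1.
- apply: main; rewrite -normrN; apply: le_trans (ler_norm _); rewrite lerNr.
  apply: le_trans (ltW h2) _; rewrite NegzE -mulNr ler_wpM2r ?(ltW d0)//.
  by rewrite -[n.+2]addn1 PoszD opprD addrNK mulrNz.
Qed.

(** The diagonal term of the large sieve matrix dominates: for [delta]-separated
    points the cells of [x - y] are distinct, and the Fejer kernel is summable. *)
Lemma fejer_row (T : eqType) (X : seq T) (p1 p2 : T -> R) (H : nat) (delta : R) (x : T) :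
  uniq X -> 0 < delta -> 1 <= H%:R * delta ->
  (forall a b, a \in X -> b \in X -> a != b -> forall k1 k2 : int,
     `|p1 a - p1 b - k1%:~R| < delta -> `|p2 a - p2 b - k2%:~R| < delta -> False) ->
  \sum_(y <- X) sqn (dir (3 * H) (p1 x - p1 y)) * sqn (dir (3 * H) (p2 x - p2 y)) <=
  (64 * H%:R ^+ 2) ^+ 2.
Proof.
move=> uX d0 hd sep.
pose f y := (slot delta (p1 x - p1 y), slot delta (p2 x - p2 y)).
have slotP (t t' : R) : slot delta t = slot delta t' ->
    exists k : int, `|t' - t - k%:~R| < delta.
  move=> e; exists (nint t' - nint t).
  have /andP[h1 h2] := floor_itv ((t - (nint t)%:~R) / delta).
  have /andP[h3 h4] := floor_itv ((t' - (nint t')%:~R) / delta).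
  rewrite -/(slot delta t) in h1 h2; rewrite -/(slot delta t') -e in h3 h4.
  rewrite ler_pdivlMr// in h1; rewrite ler_pdivlMr// in h3.
  rewrite ltr_pdivrMr// intrD mulrDl mul1r in h2; rewrite ltr_pdivrMr// intrD mulrDl mul1r in h4.
  by rewrite ltr_norml intrB; apply/andP; split; lra.
have inj : {in X &, injective f}.
  move=> a b aX bX [/slotP[k1 h1] /slotP[k2 h2]]; apply/eqP; apply: contraT => ne.
  case: (sep a b aX bX ne k1 k2).
    by rewrite (_ : p1 a - p1 b = p1 x - p1 b - (p1 x - p1 a))//; ring.
  by rewrite (_ : p2 a - p2 b = p2 x - p2 b - (p2 x - p2 a))//; ring.
have H2 : 0 <= H%:R ^+ 2 :> R by exact: sqr_ge0.
apply: (@le_trans _ _ (\sum_(k <- map f X) (H%:R ^+ 2 * mu k.1) * (H%:R ^+ 2 * mu k.2))).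
  by rewrite big_map; apply: ler_sum => y _; rewrite ler_pM ?sqn_ge0 ?dir_cell.
under eq_bigr do rewrite mulrACA.
rewrite -mulr_sumr exprMn mulrC -expr2.
by apply: ler_wpM2r; rewrite ?sqr_ge0 ?sum_mu2 ?map_inj_in_uniq.
Qed.

Local Notation cc z := ((z^*)%C).

Definition pairs (N : nat) : seq (nat * nat) := [seq (i, j) | i <- iota 0 N, j <- iota 0 N].
Definition dif (p : nat * nat) : R := p.1%:R - p.2%:R.

Lemma sqn_dir N (t : R) : (sqn (dir N t))%:C%C = \sum_(p <- pairs N) ee (dif p * t).
Proof.
rewrite sqn_conj big_allpairs rmorph_sum /dir -!(big_mkord xpredT (fun i => ee (t *+ i))) /=.
rewrite -(big_mkord xpredT (fun i => cc (ee (t *+ i)))) big_distrlr /=.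
rewrite /index_iota subn0; apply: eq_bigr => i _; apply: eq_bigr => j _.
rewrite [X in _ * X](_ : _ = ee (- (t *+ j))); last by rewrite eeN.
by rewrite -eeD /dif mulrBl !mulr_natl.
Qed.

Section Dual.
Variables (T : eqType) (X : seq T) (p1 p2 : T -> R) (c : T -> R[i]).

Definition expsum (a b : R) : R[i] := \sum_(x <- X) c x * ee (a * p1 x + b * p2 x).

Lemma expsum_sqn N :
  \sum_(p <- pairs N) \sum_(q <- pairs N) sqn (expsum (dif p) (dif q)) =
  \sum_(x <- X) \sum_(y <- X) complex.Re (c x * cc (c y)) *
    (sqn (dir N (p1 x - p1 y)) * sqn (dir N (p2 x - p2 y))).
Proof.
have ReC (z : R[i]) (r : R) : complex.Re (z * r%:C%C) = complex.Re z * r.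
  by case: z => a b /=; rewrite mulr0 subr0.
have sqnRe (z : R[i]) : sqn z = complex.Re (z * cc z) by rewrite -sqn_conj.
under [RHS]eq_bigr do under eq_bigr do rewrite -ReC rmorphM /= !sqn_dir.
under [RHS]eq_bigr do rewrite -raddf_sum; rewrite -raddf_sum.
under eq_bigr do under eq_bigr do rewrite sqnRe.
under eq_bigr do rewrite -raddf_sum; rewrite -raddf_sum; congr (complex.Re _).
transitivity (\sum_(p <- pairs N) \sum_(q <- pairs N) \sum_(x <- X) \sum_(y <- X)
   c x * cc (c y) * (ee (dif p * (p1 x - p1 y)) * ee (dif q * (p2 x - p2 y)))).
  apply: eq_bigr => p _; apply: eq_bigr => q _.
  rewrite /expsum rmorph_sum big_distrlr /=; apply: eq_bigr => x _; apply: eq_bigr => y _.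
  rewrite [cc (_ * _)](_ : _ = cc (c y) * ee (- (dif p * p1 y + dif q * p2 y))); last by rewrite eeN rmorphM.
  rewrite mulrACA -eeD -eeD; congr (_ * ee _); ring.
under eq_bigr do rewrite exchange_big; rewrite exchange_big /=; apply: eq_bigr => x _.
under eq_bigr do rewrite exchange_big; rewrite exchange_big /=; apply: eq_bigr => y _.
rewrite big_distrlr mulr_sumr /=; apply: eq_bigr => p _.
by rewrite mulr_sumr.
Qed.

Variables (H : nat) (delta : R).
Hypotheses (uX : uniq X) (d0 : 0 < delta) (hd : 1 <= H%:R * delta).
Hypothesis sep : forall a b, a \in X -> b \in X -> a != b -> forall k1 k2 : int,
     `|p1 a - p1 b - k1%:~R| < delta -> `|p2 a - p2 b - k2%:~R| < delta -> False.

Lemma expsum_total :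
  \sum_(p <- pairs (3 * H)) \sum_(q <- pairs (3 * H)) sqn (expsum (dif p) (dif q)) <=
  (64 * H%:R ^+ 2) ^+ 2 * \sum_(x <- X) sqn (c x).
Proof.
pose K x y := sqn (dir (3 * H) (p1 x - p1 y)) * sqn (dir (3 * H) (p2 x - p2 y)).
have K0 x y : 0 <= K x y by rewrite mulr_ge0 ?sqn_ge0.
have sqnN z : sqn (dir (3 * H) (- z)) = sqn (dir (3 * H) z).
  rewrite (_ : dir _ (- z) = cc (dir (3 * H) z)) ?/sqn /=.
    by case: (dir _ _) => a b /=; rewrite sqrrN.
  by rewrite rmorph_sum; apply: eq_bigr => i _; rewrite mulNrn eeN.
have Ks x y : K x y = K y x.
  by rewrite /K -[p1 x - _]opprB -[p2 x - _]opprB !sqnN.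
rewrite expsum_sqn.
apply: (@le_trans _ _ (\sum_(x <- X) \sum_(y <- X) (sqn (c x) * K x y / 2 + sqn (c y) * K x y / 2))).
  apply: ler_sum => x _; apply: ler_sum => y _; rewrite -/(K x y) -mulrDl -mulrDl mulrAC.
  apply: ler_wpM2r => //; case: (c x) (c y) => [a b] [a' b'].
  by rewrite /sqn /=; have := sqr_ge0 (a - a'); have := sqr_ge0 (b - b'); lra.
under eq_bigr do rewrite big_split /=.
rewrite big_split /= [X in _ + X]exchange_big /=.
have -> : \sum_(j <- X) \sum_(i <- X) sqn (c j) * K i j / 2 =
          \sum_(j <- X) \sum_(i <- X) sqn (c j) * K j i / 2.
  by apply: eq_bigr => j _; apply: eq_bigr => i _; rewrite Ks.
rewrite -big_split /= mulr_sumr; apply: ler_sum => x _.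
rewrite -big_split /= (eq_bigr (fun y => sqn (c x) * K x y)) => [|y _]; last by lra.
rewrite -mulr_sumr mulrC ler_wpM2r ?sqn_ge0//.
exact: (fejer_row x uX d0 hd sep).
Qed.

(** Every frequency [(a n, b n)] is in [H ^ 2] ways a pair of differences of indices below [3 *
    H], so the left-hand side is part of the double sum of [expsum_total], a quadratic form
    in [c] whose matrix of Fejer kernels is dominated by its diagonal. *)
Lemma dual_sieve (I : eqType) (s : seq I) (a b : I -> int) : (0 < H)%N -> uniq s ->
  {in s &, injective (fun n => (a n, b n))} ->
  {in s, forall n, (`|a n| < H)%N /\ (`|b n| < H)%N} ->
  \sum_(n <- s) sqn (expsum (a n)%:~R (b n)%:~R) <= 64 ^+ 2 * H%:R ^+ 2 * \sum_(x <- X) sqn (c x).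
Proof.
move=> H0 us inj hs.
have HR : 0 < H%:R ^+ 2 :> R by rewrite exprn_gt0 ?ltr0n.
rewrite -(ler_pM2l HR).
apply: le_trans (_ : _ <= (64 * H%:R ^+ 2) ^+ 2 * \sum_(x <- X) sqn (c x)) _; last first.
  by rewrite le_eqVlt; apply/orP; left; apply/eqP; ring.
apply: le_trans expsum_total.
pose J := pairs H; pose s' := [seq (n, j) | n <- s, j <- J].
have uJ m : uniq (pairs m) by apply: allpairs_uniq; rewrite ?iota_uniq// => -[? ?] [? ?].
have memJ m i j : ((i, j) \in pairs m) = (i < m)%N && (j < m)%N.
  apply/allpairsP/andP => [[[i' j']]/=|[hi hj]].
    by rewrite !mem_iota /= => -[hi hj [-> ->]].
  by exists (i, j); rewrite /= !mem_iota.
have -> : H%:R ^+ 2 * \sum_(n <- s) sqn (expsum (a n)%:~R (b n)%:~R) =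
   \sum_(u <- s') sqn (expsum (a u.1)%:~R (b u.1)%:~R).
  rewrite mulr_sumr big_allpairs /=; apply: eq_bigr => n _.
  rewrite big_const_seq count_predT iter_addr_0 /J size_allpairs size_iota.
  by rewrite -[RHS]mulr_natl natrM expr2.
have -> : \sum_(p <- pairs (3 * H)) \sum_(q <- pairs (3 * H)) sqn (expsum (dif p) (dif q)) =
    \sum_(u <- [seq (p, q) | p <- pairs (3 * H), q <- pairs (3 * H)])
      sqn (expsum (dif u.1) (dif u.2)) by rewrite [RHS]big_allpairs.
pose h (m : int) (j : nat) := (absz (m + (H + j)%N%:Z), (H + j)%N).
have key (m : int) (j : nat) : (`|m| < H)%N -> (j < H)%N ->
    (`|(m + (H + j)%N%:Z)%R| < 3 * H)%N && (H + j < 3 * H)%N.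
  by clear; move=> hm hj; apply/andP; split; lia.
have hdif m j : (`|m| < H)%N -> dif (h m j) = m%:~R.
  move=> hm; rewrite /dif /h /=.
  have e : (`|(m + (H + j)%N%:Z)%R|%N : int) = m + (H + j)%N by rewrite gez0_abs//; lia.
  by rewrite [X in X - _]pmulrn e intrD -[X in _ + X - _]pmulrn addrK.
apply: (ler_sum_inj (f := fun u : I * (nat * nat) => (h (a u.1) u.2.1, h (b u.1) u.2.2))).
- by apply: allpairs_uniq; rewrite ?uJ// => -[? ?] [? ?].
- move=> [n [j1 j2]] [n' [j1' j2']] /allpairsP[[? [? ?]] [/= ns _ [-> -> ->]]].
  move=> /allpairsP[[? [? ?]] [/= ns' _ [-> -> ->]]] [] h1 h2 h3 h4.
  have [ha hb] := hs _ ns; have [ha' hb'] := hs _ ns'.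
  congr (_, (_, _)); [|lia|lia].
  by apply: inj => //; congr (_, _); lia.
- move=> _ /allpairsP[[n [j1 j2]] [/= ns hJ ->]].
  have [ha hb] := hs _ ns; move: hJ; rewrite memJ => /andP[hj1 hj2].
  apply/allpairsP; exists (h (a n) j1, h (b n) j2); split=> //.
    by change (h (a n) j1 \in pairs (3 * H)); rewrite /h memJ; exact: key.
  by change (h (b n) j2 \in pairs (3 * H)); rewrite /h memJ; exact: key.
- move=> _ /allpairsP[[n [j1 j2]] [/= ns _ ->]] /=.
  by have [ha hb] := hs _ ns; rewrite !hdif.
- by move=> j; exact: sqn_ge0.
Qed.
End Dual.

End LargeSieve.

(** * From kernels to exponential sums *)

Section Primal.
Variable R : realType.

(** Duality: a matrix and its transpose have the same norm.  Concretely the dual inequality is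
    applied to the conjugates of the sums that are to be bounded. *)
Lemma primal_sieve (T : eqType) (X : seq T) (p1 p2 : T -> R) (H : nat) (delta : R)
    (I : eqType) (s : seq I) (a b : I -> int) :
  uniq X -> 0 < delta -> 1 <= H%:R * delta ->
  (forall x y, x \in X -> y \in X -> x != y -> forall k1 k2 : int,
     `|p1 x - p1 y - k1%:~R| < delta -> `|p2 x - p2 y - k2%:~R| < delta -> False) ->
  (0 < H)%N -> uniq s -> {in s &, injective (fun n => (a n, b n))} ->
  {in s, forall n, (`|a n| < H)%N /\ (`|b n| < H)%N} ->
  \sum_(x <- X) sqn (\sum_(n <- s) ee ((a n)%:~R * p1 x + (b n)%:~R * p2 x)) <=
  64 ^+ 2 * H%:R ^+ 2 * (size s)%:R.
Proof.
move=> uX d0 hd sep H0 us inj hs.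
pose A x := \sum_(n <- s) ee ((a n)%:~R * p1 x + (b n)%:~R * p2 x).
pose c x := ((A x)^*)%C.
have sc x : sqn (c x) = sqn (A x) by rewrite /c; case: (A x) => u v; rewrite /sqn /= sqrrN.
set T0 := \sum_(x <- X) _.
have T0E : T0 = \sum_(x <- X) sqn (c x) by apply: eq_bigr => x _; rewrite sc.
have T00 : 0 <= T0 by apply: sumr_ge0 => x _; exact: sqn_ge0.
have D := dual_sieve c uX d0 hd sep H0 us inj hs.
rewrite -T0E in D.
pose F n := expsum X p1 p2 c (a n)%:~R (b n)%:~R.
have e : T0 = \sum_(n <- s) complex.Re (F n) * 1.
  have -> : T0 = complex.Re (\sum_(x <- X) c x * A x).
    rewrite raddf_sum; apply: eq_bigr => x _.
    by rewrite mulrC -sqn_conj.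
  under [RHS]eq_bigr do rewrite mulr1.
  rewrite -raddf_sum; congr (complex.Re _); rewrite /F /expsum exchange_big /=.
  by apply: eq_bigr => x _; rewrite mulr_sumr.
have h : T0 ^+ 2 <= (64 ^+ 2 * H%:R ^+ 2 * T0) * (size s)%:R.
  rewrite {1}e; apply: le_trans (cauchy_schwarz _ _ _ _) _.
  rewrite [X in _ * X](_ : _ = (size s)%:R); last first.
    by rewrite expr1n big_const_seq count_predT iter_addr_0.
  apply: ler_wpM2r => //; apply: le_trans D.
  by apply: ler_sum => n _; rewrite lerDl sqr_ge0.
have [T1|T1] := ltP 0 T0; first by rewrite -(ler_pM2l T1) -expr2 (le_trans h)// mulrAC mulrC.
by apply: le_trans T1 _; apply: mulr_ge0 => //; apply: mulr_ge0; exact: sqr_ge0.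
Qed.

Lemma ReM_le (x y : R[i]) : complex.Re (x * y) <= Num.sqrt (sqn x) * Num.sqrt (sqn y).
Proof.
rewrite -sqrtrM ?sqn_ge0// -sqnM; apply: le_trans (ler_norm _) _.
by rewrite -sqrtr_sqr ler_wsqrtr// lerDl sqr_ge0.
Qed.

Lemma Re_sum_le (I : Type) (s : seq I) (x y : I -> R[i]) :
  0 <= complex.Re (\sum_(i <- s) x i * y i) ->
  complex.Re (\sum_(i <- s) x i * y i) ^+ 2 <= (\sum_(i <- s) sqn (x i)) * \sum_(i <- s) sqn (y i).
Proof.
move=> h0.
have := cauchy_schwarz s xpredT (fun i => Num.sqrt (sqn (x i))) (fun i => Num.sqrt (sqn (y i))).
have e (f : I -> R[i]) : \sum_(i <- s) Num.sqrt (sqn (f i)) ^+ 2 = \sum_(i <- s) sqn (f i).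
  by apply: eq_bigr => i _; rewrite sqr_sqrtr ?sqn_ge0.
rewrite !e.
apply: le_trans; rewrite ler_pXn2r ?nnegrE//.
  by rewrite raddf_sum; apply: ler_sum => i _; exact: ReM_le.
by apply: sumr_ge0 => i _; rewrite mulr_ge0 ?sqrtr_ge0.
Qed.

Lemma conj_realM (a : R) (z : R[i]) : conjc (a%:C%C * z) = a%:C%C * conjc z.
Proof.
case: z => b c; apply/eqP; rewrite eq_complex /=.
by apply/andP; split; apply/eqP; ring.
Qed.

Lemma ee_eq1 (t : R) : ee t = 1 -> t = (nint t)%:~R.
Proof.
move=> h; have h1 := sqn_1Bee_ge (nintP t).
rewrite -mulrNz eeDint h subrr /sqn /= expr0n addr0 in h1.
by apply/eqP; rewrite -subr_eq0 -mulrNz -sqrf_eq0 eq_le h1 sqr_ge0.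
Qed.

End Primal.

Section Fourier.
Variables (O : comNzRingType) (S : quad_pid O) (R : realType).
Implicit Types (x y z d e q r u v w c m : O).
Local Notation nrm := (nrm S).
Local Notation gres := (gres S).
Local Notation res := (res S).
Local Notation phi := (phi S).
Local Notation kk := (kk S R).
Local Notation kvar := (kvar S R).
Local Notation ksum := (ksum S R).

(** The additive character [x |-> e(lambda(x / r))] of [O / r], where [lambda] is
    the second coordinate functional, for which [O] is its own dual lattice. *)
Definition psi r x : R[i] := ee ((c1 S (x * conj S r))%:~R / (nrm r)%:R).

Lemma psi_ee r x : psi r x = ee ((c1 S (x * conj S r))%:~R / (nrm r)%:R).
Proof. by []. Qed.

Lemma psiD r x y : psi r (x + y) = psi r x * psi r y.
Proof. by rewrite /psi mulrDl c1D intrD mulrDl eeD. Qed.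


Lemma psiN r x : psi r (- x) = ((psi r x)^*)%C.
Proof. by rewrite /psi mulNr c1N mulrNz mulNr eeN. Qed.

Lemma psi_dv r x : r != 0 -> dv r x -> psi r x = 1.
Proof.
move=> r0 /dvP[z ->]; rewrite /psi -mulrA mul_conj -(qc_nat S) c1M c0_qc c1_qc.
have n0 : (nrm r)%:R != 0 :> R by rewrite pnatr_eq0 -lt0n nrm_gt0.
by rewrite mulr0 mulr0 !(add0r, addr0) intrM -pmulrn mulfK// ee_int.
Qed.

Lemma psi_per r : r != 0 -> per_mod r (psi r).
Proof.
by move=> r0 x y h; rewrite -[x](subrK y) psiD psi_dv// mul1r.
Qed.

(** [psi r (b x) = 1] says that a coordinate of [b x (conj r)] is divisible by [nrm r]; taking
    [b = 1] and [b = w] gives both coordinates. *)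
Lemma psi_nondeg r x : r != 0 -> (forall b, psi r (b * x) = 1) -> dv r x.
Proof.
move=> r0 h; have n0 : (nrm r)%:R != 0 :> R by rewrite pnatr_eq0 -lt0n nrm_gt0.
have key y : psi r y = 1 -> (nrm r %| c1 S (y * conj S r))%Z.
  move=> /ee_eq1; set k := nint _ => e; apply/dvdzP; exists k.
  by apply/eqP; rewrite -(eqr_int R) intrM -pmulrn -e mulfVK.
have h1 := key _ (h 1); have h2 := key _ (h (qc S 0 1)).
set z := x * conj S r; rewrite mul1r -/z in h1.
rewrite -mulrA -/z c1M c0_qc c1_qc mul0r add0r mul1r mulr1 in h2.
have h3 : (nrm r %| c0 S z)%Z.
  by have := rpredB h2 (dvdz_mull (qt S) h1); rewrite addrK.
have : dv (nrm r)%:R z by apply/(dv_nat_coord S).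
rewrite -(mul_conj S r) /z [r * _]mulrC [x * _]mulrC (dv_mul2l S)//.
by rewrite -(nrm_eq0 S) nrm_conj nrm_eq0.
Qed.

Lemma psi_ortho r x : r != 0 ->
  \sum_(b <- res r) psi r (b * x) = if dv r x then (nrm r)%:R else 0.
Proof.
move=> r0; case: ifPn => [h|h].
  rewrite (eq_bigr (fun=> 1)) => [|b _]; last by rewrite psi_dv// dv_mull.
  by rewrite big_const_seq count_predT iter_addr_0 res_size.
have [b0 hb0] : exists b, psi r (b * x) != 1.
  have [//|h'] := pselect (exists b, psi r (b * x) != 1).
  case/negP: h; apply: psi_nondeg => // b; apply/eqP; apply: contraT => hb.
  by case: h'; exists b.
have pp : per_mod r (fun b => psi r (b * x)).
  by move=> b b' e; apply: psi_per; rewrite -?mulrBl ?dv_mulr.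
have e := sum_res_add S b0 r0 pp.
rewrite (eq_bigr (fun b => psi r (b * x) * psi r (b0 * x))) in e => [|b _]; last by rewrite mulrDl psiD.
rewrite -mulr_suml in e.
move/eqP: e; rewrite -subr_eq0 -{2}[\sum_(u <- _) _]mulr1 -mulrBr mulf_eq0 subr_eq0.
by rewrite (negbTE hb0) orbF => /eqP.
Qed.

Section Bound.
Variables (r : O) (s : seq O).
Hypotheses (r0 : r != 0) (cr : can r = r).

(* the function whose Fourier transform is supported on primitive frequencies *)
Let A v : R := if cop v r then \sum_(n <- s | cop n r) kk r (v * inv r n) else 0.

Let A_per : per_mod r A.
Proof.
move=> x y h; rewrite /A (cop_cong h); case: ifP => // _; apply: eq_bigr => n _.
by apply: kk_per; rewrite // -mulrBl dv_mulr.
Qed.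

Let T0 := kvar r s.

Let T0E : T0 = \sum_(v <- res r) A v ^+ 2.
Proof.
have p : per_mod r (fun v => ksum r s v ^+ 2).
  by move=> a b h; rewrite (@ksum_per _ S R r s r0 cr a b).
rewrite /T0 kvarE -(sum_gres_inv S r0 p) big_filter [LHS]big_mkcond /=.
apply: eq_bigr => v _; rewrite /A; case: ifP => [vr|]; last by rewrite expr0n.
congr (_ ^+ 2); apply: eq_bigr => n nr.
rewrite -(@kk_inv _ S R r (v * inv r n))// ?copMl ?inv_coprime//; apply: kk_per => //.
rewrite dvBC; apply: inv_uniq; first by rewrite copMl ?inv_coprime.
have h1 := invP vr; have h2 := invP nr.
rewrite (_ : _ - 1 = (v * inv r v - 1) * (n * inv r n) + (n * inv r n - 1)); last by ring.
by apply: dvD => //; exact: dv_mulr.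
Qed.

Let sumA : (phi r)%:R * \sum_(n <- s) A n = T0.
Proof.
rewrite /T0 kvarE /A -big_mkcond /= mulr_sumr.
under [RHS]eq_bigr do rewrite expr2 {1}ksumE mulr_suml.
rewrite [RHS]exchange_big /=; apply: eq_bigr => n nr; rewrite mulr_sumr.
under [RHS]eq_bigr do rewrite ksumE mulr_sumr.
rewrite exchange_big /=; apply: eq_bigr => n' nr'.
rewrite -kk_idem ?inv_coprime// big_seq [RHS]big_seq; apply: eq_bigr => v /gres_cop vr.
congr (_ * _); rewrite -(@kk_inv _ S R r (n' * v))// ?copMl//; apply: kk_per => //.
rewrite dvBC; apply: inv_uniq; first by rewrite copMl.
have h1 := invP vr; have h2 := invP nr'.
rewrite (_ : _ - 1 = (v * inv r v - 1) * (n' * inv r n') + (n' * inv r n' - 1)); last by ring.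
by apply: dvD => //; exact: dv_mulr.
Qed.

Let Ah b : R[i] := \sum_(v <- res r) (A v)%:C%C * psi r (- (b * v)).

Let inversion n : \sum_(b <- res r) Ah b * psi r (b * n) = ((nrm r)%:R * A n)%:C%C.
Proof.
under eq_bigr do rewrite /Ah mulr_suml.
rewrite exchange_big /=.
transitivity (\sum_(v <- res r) if dv r (v - n) then (A v)%:C%C * (nrm r)%:R else 0 : R[i]).
  apply: eq_bigr => v _.
  transitivity ((A v)%:C%C * \sum_(b <- res r) psi r (b * (n - v))).
    rewrite mulr_sumr; apply: eq_bigr => b _; rewrite -mulrA -psiD; congr (_ * psi r _); ring.
  by rewrite psi_ortho// dvBC; case: ifP => _; rewrite ?mulr0.
rewrite -big_mkcond /= (big_rem (rep r n)) ?rep_res//= rep_congr.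
rewrite big_seq_cond big1 ?addr0 => [|c /andP[]].
  by rewrite (periodic_rep n A_per) mulrC rmorphM /= rmorph_nat.
rewrite mem_rem_uniq ?res_uniq// inE => /andP[ne cr'] h.
case/negP: ne; apply/eqP; apply: (res_inj (S:=S) r0); rewrite ?rep_res//.
exact: dv_cong_trans h (rep_cong _ _).
Qed.

Let parseval : \sum_(b <- res r) sqn (Ah b) = (nrm r)%:R * T0.
Proof.
apply: complexI; rewrite rmorph_sum /=.
transitivity (\sum_(b <- res r) \sum_(v <- res r) Ah b * psi r (b * v) * (A v)%:C%C).
  apply: eq_bigr => b _; rewrite sqn_conj {2}/Ah rmorph_sum mulr_sumr.
  apply: eq_bigr => v _.
  rewrite [X in Ah b * X](_ : _ = (A v)%:C%C * psi r (b * v)); last first.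
    by apply: etrans (conj_realM _ _) _; rewrite -psiN opprK.
  by rewrite mulrA mulrAC.
rewrite exchange_big /= T0E mulr_sumr rmorph_sum /=; apply: eq_bigr => v _.
by rewrite -mulr_suml inversion -rmorphM /= expr2 mulrA.
Qed.

Let Ah_prim b : ~~ cop b r -> Ah b = 0.
Proof.
move=> /(noncop S)[g gu /andP[/dvP[b' eb] /dvP[d er]]].
have g0 : g != 0 by apply: contraNneq r0 => h; rewrite er h mulr0.
have d0 : d != 0 by apply: contraNneq r0 => h; rewrite er h mul0r.
have dr : dv d r by rewrite er dv_mulr ?dvxx.
have nrd : ~~ dv r d.
  apply: contra gu; rewrite {1}er => h; rewrite -(dv_mul2l S _ _ d0) mulr1.
  by [].
rewrite /Ah (@sum_fib _ S _ d xpredT _ _ d0) //= big1 // => c _.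
rewrite (eq_bigr (fun v => psi r (- (b * c)) * (A v)%:C%C)) => [|v hv]; last first.
  rewrite mulrC; congr (_ * _); apply: psi_per => //.
  rewrite (_ : _ - _ = b' * (g * (c - v))); last by rewrite eb; ring.
  by apply: dv_mull; rewrite er mulrC (dv_mul2l S)// dvBC.
rewrite -mulr_sumr -rmorph_sum /=; suff -> : \sum_(v <- res r | dv d (v - c)) A v = 0 by rewrite rmorph0 mulr0.
rewrite /A -big_mkcondr /=.
rewrite (eq_bigl (fun v => cop v r && dv d (v - c))) => [|v]; last by rewrite andbC.
rewrite -big_filter_cond -/(gres r) exchange_big /= big1// => n nr.
have [cd|ncd] := boolP (cop c d); last first.
  rewrite big_seq_cond big1// => v /andP[/gres_cop vr h].
  by case/negP: ncd; rewrite -(cop_cong h) (cop_dv dr vr).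
have [k hk] := unit_lift S r0 cd; have nri := inv_coprime nr.
pose c' := c + d * k; have c'c : dv d (c' - c) by rewrite /c' addrAC subrr add0r dv_mulr ?dvxx.
pose F u := if dv d (u - inv r n * c') then kk r u else 0.
have pF : per_mod r F.
  move=> x y h; rewrite /F (@kk_per _ S R r r0 cr _ _ h) (@dv_periodic _ d (inv r n * c') x y)//.
  exact: dv_trans h.
transitivity (\sum_(v <- gres r) F (inv r n * v)).
  rewrite big_mkcond; apply: eq_bigr => v _; rewrite /F [v * _]mulrC.
  by rewrite cop_mul2 ?(cop_dv dr nri)// (dv_cong v c'c).
rewrite (sum_gres_mul S r0 nri pF) /F -big_mkcond /=.
by apply: kk_orth; rewrite ?dvxx// copMl.
Qed.

(** The function [A] above reproduces the sums [ksum r s] and, [kk r] being a sum of primitive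
    characters, its Fourier transform vanishes at the [b] that are not prime to [r].
    Parseval and Cauchy-Schwarz over the reduced [b] give the bound. *)
Lemma kvar_le : (nrm r)%:R * kvar r s <=
  (phi r)%:R ^+ 2 * \sum_(b <- gres r) sqn (\sum_(n <- s) psi r (b * n)).
Proof.
pose Sb b := \sum_(n <- s) psi r (b * n).
have ph : 0 < (phi r)%:R :> R by rewrite ltr0n phi_gt0.
have n0 : 0 < (nrm r)%:R :> R by rewrite ltr0n nrm_gt0.
have e : complex.Re (\sum_(b <- gres r) Ah b * Sb b) = (nrm r)%:R * (T0 / (phi r)%:R).
  have -> : \sum_(b <- gres r) Ah b * Sb b = \sum_(b <- res r) Ah b * Sb b.
    rewrite big_filter [RHS](bigID (fun x => cop x r)) /= [X in _ + X]big1 ?addr0// => b hb.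
    by rewrite Ah_prim// mul0r.
  have -> : \sum_(b <- res r) Ah b * Sb b = ((nrm r)%:R * \sum_(n <- s) A n)%:C%C.
    rewrite mulr_sumr rmorph_sum /=.
    under eq_bigr do rewrite /Sb mulr_sumr.
    by rewrite exchange_big /=; apply: eq_bigr => n _; rewrite inversion.
  by rewrite -sumA /= [(phi r)%:R * _]mulrC mulfK// gt_eqF.
have T00 : 0 <= T0 by exact: kvar_ge0.
have := @Re_sum_le R O (gres r) Ah Sb.
rewrite e => /(_ (mulr_ge0 (ltW n0) (divr_ge0 T00 (ltW ph)))).
have le1 : \sum_(b <- gres r) sqn (Ah b) <= (nrm r)%:R * T0.
  rewrite -parseval; apply: ler_sum_subset; [exact: gres_uniq|by move=> b /gres_res|].
  by move=> b; exact: sqn_ge0.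
set Sig := \sum_(b <- _) sqn (Sb b) => h.
have Sig0 : 0 <= Sig by apply: sumr_ge0 => b _; exact: sqn_ge0.
have {le1}h2 : ((nrm r)%:R * (T0 / (phi r)%:R)) ^+ 2 <= (nrm r)%:R * T0 * Sig.
  by apply: le_trans h _; rewrite ler_wpM2r.
have [T1|T1] := ltP 0 T0; last first.
  have -> : kvar r s = 0 by apply/eqP; rewrite eq_le kvar_ge0 andbT.
  by rewrite mulr0 mulr_ge0 ?sqr_ge0.
have nT : 0 < (nrm r)%:R * T0 by rewrite mulr_gt0.
rewrite -(ler_pM2l nT) -/T0 -/Sig.
rewrite [leRHS]mulrCA -ler_pdivrMl ?exprn_gt0//.
apply: le_trans h2; rewrite le_eqVlt; apply/orP; left; apply/eqP.
by field; rewrite gt_eqF.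
Qed.

End Bound.
End Fourier.

(** * The large sieve over the ring *)

Section SieveO.
Variables (O : comNzRingType) (S : quad_pid O) (R : realType).
Implicit Types (x y z d e q r u v w c m : O).
Local Notation nrm := (nrm S).
Local Notation gres := (gres S).
Local Notation res := (res S).
Local Notation psi := (psi S R).
Local Notation t := (`|qt S|%N).
Local Notation m := (`|qm S|%N).

Let kap : nat := ((1 + t) ^ 2 + t * (1 + t) + m).+1.

(** The second coordinates of [z] and [w z] determine [z], and the norm is a quadratic form in
    them. *)
Lemma nrm_le_coord (B : R) z : 0 <= B -> `|(c1 S z)%:~R| <= B ->
  `|(c1 S (qc S 0 1 * z))%:~R| <= B -> (nrm z)%:R <= kap.-1%:R * B ^+ 2.
Proof.
move=> B0 h1; rewrite c1M c0_qc c1_qc mul0r add0r mul1r mulr1 => h2.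
have tE : (t%:R : R) = `|(qt S)%:~R|.
  by rewrite natr_absz intr_norm.
have mE : (m%:R : R) = `|(qm S)%:~R|.
  by rewrite natr_absz intr_norm.
set z0 : R := (c0 S z)%:~R; set z1 : R := (c1 S z)%:~R in h1 *.
set T : R := (qt S)%:~R in tE *; set M : R := (qm S)%:~R in mE *.
have e : (nrm z)%:R = z0 ^+ 2 + T * z0 * z1 + M * z1 ^+ 2.
  by rewrite (pmulrn 1 (nrm z)) nrmzE /nrmz !(intrD, intrM, rmorphXn).
have h3 : `|z0| <= (1 + `|T|) * B.
  have -> : z0 = (c0 S z + qt S * c1 S z)%:~R - T * z1 by rewrite intrD intrM addrK.
  apply: le_trans (ler_normB _ _) _; rewrite normrM mulrDl mul1r lerD// ler_wpM2l//.
rewrite e /kap -pred_Sn !natrD natrX natrM natrD -/m tE mE.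
apply: le_trans (ler_norm _) _; apply: le_trans (ler_normD _ _) _.
rewrite mulrDl lerD//; last first.
  by rewrite normrM ler_wpM2l// normrX lerXn2r.
apply: le_trans (ler_normD _ _) _; rewrite mulrDl lerD//.
  by rewrite normrX -exprMn lerXn2r// nnegrE mulr_ge0// addr_ge0.
rewrite normrM normrM -mulrA -[leRHS]mulrA ler_wpM2l// expr2 mulrA ler_pM//.
Qed.

Definition cball (Z : nat) : seq O := [seq r <- ball S Z | (r != 0) && (can r == r)].

Lemma cball_uniq Z : uniq (cball Z). Proof. by rewrite filter_uniq ?ball_uniq. Qed.

Lemma mem_cball Z r : (r \in cball Z) = [&& r != 0, can r == r & (nrm r <= Z)%N].
Proof. by rewrite mem_filter mem_ball -andbA. Qed.

Let p1 (x : O * O) : R := (c1 S (x.2 * conj S x.1))%:~R / (nrm x.1)%:R.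
Let p2 (x : O * O) : R := (c1 S (qc S 0 1 * (x.2 * conj S x.1)))%:~R / (nrm x.1)%:R.

Let psiE r b n : psi r (b * n) = ee ((c0 S n)%:~R * p1 (r, b) + (c1 S n)%:~R * p2 (r, b)).
Proof.
rewrite psi_ee /p1 /p2 /= !mulrA -mulrDl -!intrM -intrD; congr (ee (_%:~R / _)).
rewrite (_ : b * n * conj S r = n * (b * conj S r)); last by ring.
by rewrite !(c1M, c0M, c0_qc, c1_qc); ring.
Qed.

Let sep (Z : nat) r b r' b' (k1 k2 : int) : (0 < Z)%N ->
  r \in cball Z -> r' \in cball Z -> b \in gres r -> b' \in gres r' -> (r, b) != (r', b') ->
  `|p1 (r, b) - p1 (r', b') - k1%:~R| < (kap * Z)%:R^-1 ->
  `|p2 (r, b) - p2 (r', b') - k2%:~R| < (kap * Z)%:R^-1 -> False.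
Proof.
move=> Z0; rewrite !mem_cball => /and3P[r0 /eqP cr rZ] /and3P[r0' /eqP cr' rZ'] hb hb' ne.
set delta : R := _^-1.
have n0 : 0 < (nrm r)%:R :> R by rewrite ltr0n nrm_gt0.
have n0' : 0 < (nrm r')%:R :> R by rewrite ltr0n nrm_gt0.
have [ka [ka1 ka2]] : exists ka, c1 S ka = k1 /\ c1 S (qc S 0 1 * ka) = k2.
  exists (qc S (k2 - qt S * k1) k1); split; first by rewrite c1_qc.
  by rewrite c1M !(c0_qc, c1_qc); ring.
pose w := b * r' - b' * r - ka * r * r'.
have w0 : w != 0.
  apply: contraNneq ne => w0.
  have h1 : dv r r'.
    apply: (@cop_gauss _ _ b); first by rewrite copC (gres_cop hb).
    apply/dvP; exists (b' + ka * r').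
    by apply/eqP; rewrite -subr_eq0 -w0 /w; apply/eqP; ring.
  have h2 : dv r' r.
    apply: (@cop_gauss _ _ b'); first by rewrite copC (gres_cop hb').
    apply/dvP; exists (b - ka * r).
    by apply/eqP; rewrite eq_sym -subr_eq0 -w0 /w; apply/eqP; ring.
  have e : r = r' by apply: can_dv_eq.
  subst r'; rewrite (_ : b = b')//; apply: (res_inj r0 (gres_res hb) (gres_res hb')).
  apply/dvP; exists ka; apply: (mulIO S r0); apply/eqP; rewrite -subr_eq0 -w0 /w.
  by apply/eqP; ring.
pose z := conj S r * conj S r' * w.
have zE : z = b * conj S r * (nrm r')%:R - b' * conj S r' * (nrm r)%:R - ka * (nrm r)%:R * (nrm r')%:R.
  by rewrite -!(mul_conj S) /z /w; ring.
have nz : ((nrm r)%:R * (nrm r')%:R <= (nrm z)%:R :> R).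
  by rewrite -natrM ler_nat /z !nrmM !nrm_conj leq_pmulr// nrm_gt0.
pose N : R := (nrm r)%:R * (nrm r')%:R.
have N0 : 0 < N by rewrite mulr_gt0.
have lin x (a : nat) : c1 S (x * a%:R) = c1 S x * a.
  by rewrite c1M c0_nat c1_nat; ring.
have e1 : (c1 S z)%:~R = N * (p1 (r, b) - p1 (r', b') - k1%:~R).
  rewrite zE !(c1D, c1N, lin) ka1 !(intrD, intrN, intrM) -!pmulrn /p1 /N /=.
  by field; rewrite ?gt_eqF.
have e2 : (c1 S (qc S 0 1 * z))%:~R = N * (p2 (r, b) - p2 (r', b') - k2%:~R).
  rewrite zE !mulrBr !mulrA !(c1D, c1N, lin).
  rewrite ka2 !(intrD, intrN, intrM) -!pmulrn /p2 /N /=.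
  by field; rewrite ?gt_eqF.
move=> h1 h2.
have d0 : 0 < delta by rewrite invr_gt0 ltr0n muln_gt0 Z0.
have := @nrm_le_coord (N * delta) z.
have nM (y : R) : `|N * y| = N * `|y| by rewrite normrM (gtr0_norm N0).
rewrite e1 e2 !nM => /(_ (mulr_ge0 (ltW N0) (ltW d0))).
rewrite !ler_pM2l// => /(_ (ltW h1) (ltW h2)) h3.
have h4 : N <= kap.-1%:R * (N * delta) ^+ 2 by apply: le_trans nz h3.
have NZ : N <= Z%:R ^+ 2 by rewrite /N expr2 ler_pM// ler_nat.
have ZR : 0 < Z%:R :> R by rewrite ltr0n.
have dZ : Z%:R * delta = kap%:R^-1.
  by rewrite /delta natrM; field; rewrite ?gt_eqF// ltr0n.
have k1' : kap.-1%:R < kap%:R :> R by rewrite ltr_nat.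
have kp : 0 < kap%:R :> R by rewrite ltr0n.
have h5 : 1 <= kap.-1%:R * (N * delta ^+ 2).
  by rewrite -(ler_pM2l N0) mulr1; apply: le_trans h4 _; rewrite le_eqVlt; apply/orP; left; apply/eqP; ring.
have h6 : N * delta ^+ 2 <= kap%:R^-1 ^+ 2 by rewrite -dZ exprMn ler_wpM2r// sqr_ge0.
have : kap.-1%:R * (N * delta ^+ 2) < 1.
  apply: le_lt_trans (ler_wpM2l (ler0n _ _) h6) _.
  rewrite expr2 mulrA; apply: (@lt_le_trans _ _ (1 * kap%:R^-1)).
    by rewrite ltr_pM2r ?invr_gt0// ltr_pdivrMr// mul1r.
  by rewrite mul1r invf_le1// ler1n.
by rewrite ltNge h5.
Qed.

Definition sieve_const : nat := (kap + t + 4)%N.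

(** The large sieve for primitive additive characters; the fractions [b / r] are
    [1 / Z]-separated modulo [O] because a nonzero element has norm at least one. *)
Lemma sieve_ball (Z P : nat) (s : seq O) : (0 < Z)%N -> uniq s ->
  {in s, forall x, (nrm x <= P ^ 2)%N} ->
  \sum_(r <- cball Z) \sum_(b <- gres r) sqn (\sum_(n <- s) psi r (b * n)) <=
  64 ^+ 2 * (sieve_const * (Z + P))%:R ^+ 2 * (size s)%:R.
Proof.
move=> Z0 us sP; set H := (sieve_const * (Z + P))%N.
pose X : seq (O * O) := [seq (r, b) | r <- cball Z, b <- gres r].
have H0 : (0 < H)%N by rewrite /H /sieve_const muln_gt0; lia.
have -> : \sum_(r <- cball Z) \sum_(b <- gres r) sqn (\sum_(n <- s) psi r (b * n)) =
   \sum_(x <- X) sqn (\sum_(n <- s) ee ((c0 S n)%:~R * p1 x + (c1 S n)%:~R * p2 x)).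
  rewrite big_allpairs_dep /=; apply: eq_bigr => r _; apply: eq_bigr => b _.
  by congr sqn; apply: eq_bigr => n _; rewrite psiE.
apply: (@primal_sieve R _ X p1 p2 H ((kap * Z)%:R^-1)) => //.
- apply: allpairs_uniq_dep; rewrite ?cball_uniq//.
    by move=> r _; exact: gres_uniq.
  by move=> [r b] [r' b'] _ _ [-> ->].
- by rewrite invr_gt0 ltr0n muln_gt0 Z0.
- rewrite ler_pdivlMr ?ltr0n ?muln_gt0 ?Z0// mul1r ler_nat /H /sieve_const.
  by apply: leq_mul; lia.
- move=> _ _ /allpairsPdep[r [b [hr hb ->]]] /allpairsPdep[r' [b' [hr' hb' ->]]] ne k1 k2.
  exact: (sep Z0 hr hr' hb hb' ne).
- by move=> x y _ _ [e0 e1]; apply: coord_eq e0 e1.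
- move=> x xs; have := nrm_disc S x; have := sP x xs => h hd.
  have P2 : (nrm x)%:Z <= P%:Z ^+ 2 by rewrite -rmorphXn /= -natz; lia.
  have q1 : c1 S x ^+ 2 <= (2 * P%:Z) ^+ 2.
    by have := sqr_ge0 (2 * c0 S x + qt S * c1 S x); clear -hd P2; nia.
  have q0 : (2 * c0 S x + qt S * c1 S x) ^+ 2 <= (2 * P%:Z) ^+ 2.
    by have := sqr_ge0 (c1 S x); clear -hd P2; nia.
  have le (a b : int) : 0 <= b -> a ^+ 2 <= b ^+ 2 -> `|a| <= b.
    by move=> b0; rewrite -[a ^+ 2]ger0_norm ?sqr_ge0// normrX ler_pXn2r// nnegrE.
  have {}q1 := le _ _ (_ : 0 <= 2 * P%:Z) q1.
  have {}q0 := le _ _ (_ : 0 <= 2 * P%:Z) q0.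
  have q2 : `|qt S * c1 S x| <= `|qt S| * (2 * P%:Z) by rewrite normrM ler_wpM2l// q1.
  have q3 : `|c0 S x| <= P%:Z + `|qt S| * P%:Z.
    have : `|2 * c0 S x| <= 2 * P%:Z + `|qt S| * (2 * P%:Z).
      rewrite -[2 * c0 S x](addrK (qt S * c1 S x)); apply: le_trans (ler_normB _ _) _.
      by apply: lerD; [exact: q0 | exact: q2].
    by rewrite normrM (mulrCA `|qt S|); move: (`|c0 S x|) (`|qt S| * P%:Z) => u v; clear; lia.
  have Hge : (P + t * P + 2 * P < H)%N.
    apply: (@leq_trans ((t + 4) * (1 + P))); first (clear; rewrite !mulnDl !mulnDr; lia).
    by apply: leq_mul; [rewrite /sieve_const -addnA leq_addl|clear -Z0; lia].
  have q1' := q1 isT; clear -q1' q3 Hge.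
  have e : (t * P)%N%:Z = `|qt S| * P%:Z by rewrite PoszM abszE.
  by split; lia.
Qed.

End SieveO.

(** * Lattice points and divisor sums *)

Section Fibres.

Lemma count_split (I : Type) (P Q : pred I) (s : seq I) :
  count P s = (count (fun x => P x && Q x) s + count (fun x => P x && ~~ Q x) s)%N.
Proof. by elim: s => //= x s ->; case: (P x); case: (Q x) => /=; lia. Qed.

Lemma size_fibres (I J : eqType) (f : I -> J) (s : seq I) :
  size s = (\sum_(a <- undup (map f s)) count (fun x => f x == a) s)%N.
Proof.
rewrite -sum1_size; under [RHS]eq_bigr do rewrite -sum1_count.
rewrite (exchange_big_dep predT) //= big_seq [RHS]big_seq; apply: eq_bigr => x xs.
rewrite (big_rem (f x)) ?mem_undup ?map_f//= eqxx big_seq_cond big1 ?addn0// => a.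
by rewrite mem_rem_uniq ?undup_uniq// inE => /andP[/andP[ne _]] /eqP e; rewrite e eqxx in ne.
Qed.

Lemma size_fibres_le (I J : eqType) (f : I -> J) (s : seq I) (l : seq J) (k : nat) :
  {in s, forall x, f x \in l} -> {in l, forall a, count (fun x => f x == a) s <= k}%N ->
  (size s <= size l * k)%N.
Proof.
move=> fl hk; rewrite (size_fibres f).
apply: (@leq_trans (\sum_(a <- undup (map f s)) k)); last first.
  rewrite big_const_seq count_predT iter_addn_0 mulnC leq_mul2r; apply/orP; right.
  apply: uniq_leq_size (undup_uniq _) _ => a; rewrite mem_undup => /mapP[x xs ->].
  exact: fl.
rewrite big_seq [leqRHS]big_seq; apply: leq_sum => a; rewrite mem_undup => /mapP[x xs ->].
by apply: hk; exact: fl.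
Qed.

Variable R : realType.

Lemma seq_min (l : seq int) : l != [::] -> exists2 a, a \in l & {in l, forall b, a <= b}.
Proof.
elim: l => // x l IH _; have [->|/IH[a al hm]] := eqVneq l [::].
  by exists x; rewrite ?inE// => b; rewrite inE => /eqP ->.
have [xa|ax] := leP x a.
  exists x; rewrite ?inE ?eqxx// => b; rewrite inE => /orP[/eqP -> //|/hm].
  exact: le_trans.
exists a; first by rewrite inE al orbT.
by move=> b; rewrite inE => /orP[/eqP ->|/hm //]; exact: ltW.
Qed.

(** Integers at mutual distance at most [ell] lie in an interval of length [ell]. *)
Lemma int_count (l : seq int) (ell : R) : uniq l -> 0 <= ell ->
  {in l &, forall a b, `|a%:~R - b%:~R| <= ell} -> (size l)%:R <= ell + 1.
Proof.
move=> u e0 h; have [->|/seq_min[a0 a0l min]] := eqVneq l [::]; first by rewrite addr_ge0.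
have tr := truncn_itv e0.
rewrite -lerBlDr; case/andP: tr => tr _; apply: le_trans tr.
rewrite lerBlDr natr1 ler_nat.
rewrite -(size_iota 0 (Num.truncn ell).+1) -(size_map (fun a => absz (a - a0))).
apply: uniq_leq_size.
  rewrite map_inj_in_uniq// => a b al bl e.
  by have := min _ al; have := min _ bl; lia.
move=> _ /mapP[a al ->]; rewrite mem_iota /= add0n ltnS truncn_ge_nat//.
apply: le_trans (h _ _ al a0l); rewrite natr_absz -intrB intr_norm.
by rewrite le_eqVlt eqxx.
Qed.

End Fibres.

Section Counts.
Variables (O : comNzRingType) (S : quad_pid O) (R : realType).
Implicit Types (x y z d e q r u v w c : O).
Local Notation nrm := (nrm S).
Local Notation gres := (gres S).
Local Notation phi := (phi S).
Local Notation divs := (divs S).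
Local Notation ball := (ball S).

(** Lattice points of a coset in an annulus, row by row: in a row the points
    with a given sign of the abscissa have pairwise distance at most
    [sqrt (W / n)], by factoring a difference of squares. *)
Lemma annulus_count (rho gamma : O) (U W : R) (s : seq O) :
  rho != 0 -> 0 <= U -> 0 <= W -> uniq s ->
  {in s, forall b, U - W < (nrm (gamma + rho * b))%:R <= U} ->
  (size s)%:R <= 2 * (4 * Num.sqrt (U / (nrm rho)%:R) + 1) * (Num.sqrt (W / (nrm rho)%:R) + 1).
Proof.
move=> r0 U0 W0 us hs; set n : R := (nrm rho)%:R.
have n0 : 0 < n by rewrite ltr0n nrm_gt0.
have n_ge0 := ltW n0.
set sU := Num.sqrt (U / n); set sW := Num.sqrt (W / n).
have sU0 : 0 <= sU by exact: sqrtr_ge0.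
have sW0 : 0 <= sW by exact: sqrtr_ge0.
have sU2 : sU ^+ 2 * n = U.
  have q0 : 0 <= U / n by rewrite divr_ge0 // ltW.
  by rewrite /sU sqr_sqrtr// -mulrA mulVf ?mulr1// gt_eqF.
have sW2 : sW ^+ 2 * n = W.
  have q0 : 0 <= W / n by rewrite divr_ge0 // ltW.
  by rewrite /sW sqr_sqrtr// -mulrA mulVf ?mulr1// gt_eqF.
have [e eE] : exists e, conj S rho * gamma = e by exists (conj S rho * gamma).
pose Y b : int := c1 S e + (nrm rho)%:Z * c1 S b.
pose X b : int := 2 * (c0 S e + (nrm rho)%:Z * c0 S b) + qt S * Y b.
have key b : 4 * n * (nrm (gamma + rho * b))%:R =
    (X b)%:~R ^+ 2 + (4 * qm S - qt S ^+ 2)%:~R * (Y b)%:~R ^+ 2 :> R.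
  have e1 : conj S rho * (gamma + rho * b) = e + (nrm rho)%:R * b.
    by rewrite -(mul_conj S) -eE; ring.
  have e2 : (nrm rho)%:Z * (nrm (gamma + rho * b))%:Z = nrmz S (e + (nrm rho)%:R * b).
    by rewrite -nrmzE -e1 nrmM nrm_conj PoszM.
  have cast (n1 n2 : nat) (D x y : int) : 4 * (n1%:Z * n2%:Z) = x ^+ 2 + D * y ^+ 2 ->
      4 * n1%:R * n2%:R = x%:~R ^+ 2 + D%:~R * y%:~R ^+ 2 :> R.
    move/(congr1 (fun z : int => z%:~R : R)); rewrite !(intrD, intrM) => h.
    by rewrite !expr2 -h -!pmulrn; ring.
  apply: cast; rewrite e2 nrmz4 !c0D !c1D !c0M !c1M !c0_nat !c1_nat.
  by rewrite /X /Y; ring.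
have disc1 : 1 <= (4 * qm S - qt S ^+ 2)%:~R :> R by rewrite ler1z; have := q_disc S; lia.
have hY b : b \in s -> (Y b)%:~R ^+ 2 <= 4 * n * U :> R.
  move=> /hs /andP[_ h]; apply: (@le_trans _ _ (4 * n * (nrm (gamma + rho * b))%:R)).
    by rewrite key; have := sqr_ge0 ((X b)%:~R : R); have := sqr_ge0 ((Y b)%:~R : R); nra.
  by rewrite ler_wpM2l// mulr_ge0.
have absY b : b \in s -> `|(Y b)%:~R| <= 2 * n * sU :> R.
  move=> /hY h; rewrite -(ler_pXn2r (n := 2))// ?nnegrE ?mulr_ge0//.
  rewrite -normrX ger0_norm ?sqr_ge0//; apply: le_trans h _.
  by rewrite -sU2 le_eqVlt; apply/orP; left; apply/eqP; ring.
pose rows := undup (map (c1 S) s).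
have rows_le : (size rows)%:R <= 4 * sU + 1.
  apply: int_count; rewrite ?undup_uniq ?mulr_ge0// => a a'.
  rewrite !mem_undup => /mapP[b bs ->] /mapP[b' bs' ->].
  have -> : (c1 S b)%:~R - (c1 S b')%:~R = ((Y b)%:~R - (Y b')%:~R) / n :> R.
    by rewrite /Y !intrD !intrM -!pmulrn -/n; field; rewrite gt_eqF.
  rewrite normrM normfV (gtr0_norm n0) ler_pdivrMr//.
  apply: le_trans (ler_normB _ _) _.
  by have := absY _ bs; have := absY _ bs'; lra.
have half (P : pred int) : (forall a b : int, P a -> P b -> `|a - b| <= `|a + b|) ->
    forall a, (count (fun b => (c1 S b == a) && P (X b)) s)%:R <= sW + 1.
  move=> hP a; rewrite -size_filter -(size_map (c0 S)); apply: int_count => //.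
    rewrite map_inj_in_uniq ?filter_uniq// => b b'.
    rewrite !mem_filter => /andP[/andP[/eqP h1 _] _] /andP[/andP[/eqP h2 _] _] h0.
    by apply: coord_eq h0 _; rewrite h1 h2.
  move=> z z' /mapP[b hb ->] /mapP[b' hb' ->].
  move: hb hb'; rewrite !mem_filter => /andP[/andP[/eqP h1 P1] bs] /andP[/andP[/eqP h2 P2] bs'].
  have eY : Y b = Y b' by rewrite /Y h1 h2.
  have eX : (X b)%:~R - (X b')%:~R = 2 * n * ((c0 S b)%:~R - (c0 S b')%:~R) :> R.
    by rewrite /X eY !(intrD, intrM) -!pmulrn -/n; ring.
  have dif : `|(X b)%:~R ^+ 2 - (X b')%:~R ^+ 2| <= 4 * n * W :> R.
    have := hs _ bs; have := hs _ bs'; have := key b; have := key b'; rewrite eY.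
    set u1 := (nrm _)%:R; set u2 := (nrm _)%:R; set T := _ * _ ^+ 2 => k1 k2 /andP[l1 l2] /andP[l3 l4].
    have -> : (X b)%:~R ^+ 2 - (X b')%:~R ^+ 2 = 4 * n * (u2 - u1) :> R by rewrite mulrBr k1 k2; ring.
    rewrite normrM ger0_norm ?mulr_ge0// ler_wpM2l ?mulr_ge0// ler_norml.
    by apply/andP; split; lra.
  rewrite -(ler_pXn2r (n := 2))// ?nnegrE//.
  have n4 : 0 < 4 * n ^+ 2 by rewrite mulr_gt0 ?exprn_gt0.
  rewrite -(ler_pM2l n4) (_ : 4 * n ^+ 2 * sW ^+ 2 = 4 * n * W); last by rewrite -sW2; ring.
  apply: le_trans dif; rewrite subr_sqr normrM.
  have -> : 4 * n ^+ 2 * `|(c0 S b)%:~R - (c0 S b')%:~R| ^+ 2 = `|(X b)%:~R - (X b')%:~R| * `|(X b)%:~R - (X b')%:~R| :> R.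
    by rewrite eX !normrM (gtr0_norm n0) normr_nat; ring.
  rewrite ler_wpM2l// -intrB -intrD -!intr_norm ler_int.
  exact: hP.
have fib a : (count (fun b => c1 S b == a) s)%:R <= 2 * (sW + 1).
  rewrite (count_split _ (fun b => 0 <= X b)) natrD.
  apply: (@le_trans _ _ ((sW + 1) + (sW + 1))); last by lra.
  apply: lerD.
    have hh : forall z z' : int, 0 <= z -> 0 <= z' -> `|z - z'| <= `|z + z'| by move=> z z' h h'; lia.
    exact: (half (fun k : int => 0 <= k) hh a).
  have hh : forall z z' : int, ~~ (0 <= z) -> ~~ (0 <= z') -> `|z - z'| <= `|z + z'| by move=> z z' h h'; lia.
  exact: (half (fun k : int => ~~ (0 <= k)) hh a).
rewrite (size_fibres (c1 S)) natr_sum -/rows.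
apply: (@le_trans _ _ (\sum_(a <- rows) 2 * (sW + 1))); first by apply: ler_sum => a _; exact: fib.
rewrite big_const_seq count_predT iter_addr_0 -[leLHS]mulr_natl [leRHS](_ : _ = (4 * sU + 1) * (2 * (sW + 1))); last by ring.
by rewrite ler_wpM2r// mulr_ge0// addr_ge0.
Qed.

Lemma ball_size n : (size (ball n))%:R <= 20 * (n.+1)%:R :> R.
Proof.
have := @annulus_count 1 0 n%:R n.+1%:R (ball n).
rewrite -(nrm_eq0 S) nrm1 => /(_ isT (ler0n _ _) (ler0n _ _) (ball_uniq S n)).
move=> h; apply: le_trans (h _) _.
  move=> b; rewrite mem_ball add0r mul1r -natr1 opprD addrA subrr add0r => hb.
  by rewrite ler_nat hb andbT (lt_le_trans (ltrN10 _)).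
rewrite !divr1; have h1 : Num.sqrt n%:R <= Num.sqrt n.+1%:R :> R by rewrite ler_wsqrtr ?ler_nat.
have h2 : 1 <= Num.sqrt n.+1%:R :> R by rewrite -{1}sqrtr1 ler_wsqrtr ?ler1n.
have h3 : (n.+1)%:R = Num.sqrt n.+1%:R ^+ 2 :> R by rewrite sqr_sqrtr.
rewrite [X in 20 * X]h3; have := sqrtr_ge0 (n%:R : R).
by move: h1 h2; set x := Num.sqrt n%:R; set y := Num.sqrt _; nra.
Qed.

(** On the block [2 ^ i <= nrm r < 2 ^ i.+1] the weight [1 / nrm r] is at most [2 ^ - i]. *)
Lemma dyadic_sum (F : O -> R) (G : nat -> R) (i0 I : nat) (s : seq O) : (i0 <= I)%N ->
  (forall r, 0 <= F r) ->
  (forall i, (i0 <= i < I)%N -> \sum_(r <- s | (nrm r < 2 ^ i.+1)%N) F r <= G i) ->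
  \sum_(r <- s | (2 ^ i0 <= nrm r < 2 ^ I)%N) (nrm r)%:R^-1 * F r <= \sum_(i0 <= i < I) (2 ^ i)%:R^-1 * G i.
Proof.
elim: I => [|I IH].
  rewrite leqn0 => /eqP -> F0 hG; rewrite big_geq// big_pred0// => r.
  by case: leqP.
rewrite leq_eqVlt => /orP[/eqP <- F0 hG|]; last first.
  rewrite ltnS => lI F0 hG; rewrite big_nat_recr//=.
  rewrite (bigID (fun r => (nrm r < 2 ^ I)%N)) /=; apply: lerD.
    rewrite (eq_bigl (fun r => (2 ^ i0 <= nrm r < 2 ^ I)%N)).
      apply: IH => // i /andP[h1 h2]; apply: hG; rewrite h1 (leq_trans h2)//.
    move=> r; have : (2 ^ I <= 2 ^ I.+1)%N by rewrite leq_exp2l.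
    by move: (2 ^ I)%N (2 ^ I.+1)%N (2 ^ i0)%N (nrm r) => a b c e; lia.
  apply: (@le_trans _ _ (\sum_(r <- s | (nrm r < 2 ^ I.+1)%N) (2 ^ I)%:R^-1 * F r)).
    rewrite [leLHS]big_mkcond [leRHS]big_mkcond /=; apply: ler_sum => r _.
    have p0 : 0 < (2 ^ I)%:R :> R by rewrite ltr0n expn_gt0.
    case: ifP => [/andP[/andP[_ ->]]|_]; last first.
      by case: ifP => // _; rewrite mulr_ge0 ?invr_ge0 ?(ltW p0).
    rewrite -leqNgt => h; rewrite ler_wpM2r// lef_pV2 ?posrE ?ler_nat//.
    by rewrite ltr0n (leq_trans _ h)// expn_gt0.
  rewrite -mulr_sumr ler_wpM2l ?invr_ge0//; apply: hG.
  by rewrite lI ltnSn.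
rewrite big_geq// big_pred0// => r.
by case: leqP.
Qed.

Definition nzball n : seq O := [seq x <- ball n | x != 0].

Lemma nzball_uniq n : uniq (nzball n). Proof. by rewrite filter_uniq ?ball_uniq. Qed.
Lemma mem_nzball n x : (x \in nzball n) = (x != 0) && (nrm x <= n)%N.
Proof. by rewrite mem_filter mem_ball. Qed.

Lemma harmonic n I : (n < 2 ^ I)%N -> \sum_(x <- nzball n) (nrm x)%:R^-1 <= 40 * I%:R :> R.
Proof.
move=> nI.
have := @dyadic_sum (fun=> 1) (fun i => 40 * (2 ^ i)%:R) 0 I (nzball n) (leq0n _) (fun=> ler01).
rewrite (eq_bigr (fun x => (nrm x)%:R^-1)) => [|x _]; last by rewrite mulr1.
rewrite big_seq_cond (eq_bigl (fun x => x \in nzball n)); last first.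
  move=> x; rewrite andb_idr// mem_nzball => /andP[x0 h].
  by rewrite expn0 nrm_gt0//= (leq_ltn_trans h nI).
rewrite -big_seq; move=> h; apply: le_trans (h _) _.
  move=> i _; apply: (@le_trans _ _ (size (ball (2 ^ i.+1).-1))%:R).
    rewrite big_const_seq iter_addr_0 ler_nat -size_filter; apply: uniq_leq_size.
      by rewrite !filter_uniq ?ball_uniq.
    move=> x; rewrite mem_filter mem_ball => /andP[h1 _].
    by rewrite -ltnS prednK ?expn_gt0.
  apply: le_trans (ball_size _) _; rewrite prednK ?expn_gt0// expnS natrM; lra.
rewrite big_mkord (eq_bigr (fun=> 40)) => [|i _]; last first.
  by rewrite mulrC mulfK// pnatr_eq0 -lt0n expn_gt0.
by rewrite big_const_ord iter_addr_0 -[leLHS]mulr_natr.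
Qed.

(** Each pair of a modulus and a divisor is a product [c r]; the map to [(r, c)] is injective. *)
Lemma sum_divs_le n (l : seq O) (F : O -> O -> R) : uniq l ->
  {in l, forall rho, rho != 0 /\ (nrm rho <= n)%N} -> (forall r c, 0 <= F r c) ->
  \sum_(rho <- l) \sum_(r <- divs rho) F r (quo rho r) <=
  \sum_(r <- cball S n) \sum_(c <- nzball n) F r c.
Proof.
move=> ul hl F0.
pose L1 : seq (O * O) := [seq (rho, r) | rho <- l, r <- divs rho].
have -> : \sum_(rho <- l) \sum_(r <- divs rho) F r (quo rho r) = \sum_(p <- L1) F p.2 (quo p.1 p.2).
  by rewrite big_allpairs_dep.
have -> : \sum_(r <- cball S n) \sum_(c <- nzball n) F r c =
    \sum_(p <- [seq (r, c) | r <- cball S n, c <- nzball n]) F p.1 p.2 by rewrite big_allpairs.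
apply: (ler_sum_inj (f := fun p => (p.2, quo p.1 p.2))) => [||||p]; last exact: F0.
- apply: allpairs_uniq_dep => //; first by move=> *; exact: divs_uniq.
  by move=> [a b] [a' b'] _ _ [-> ->].
- move=> p p' /allpairsPdep[rho [r [h1 h2 ->]]] /allpairsPdep[rho' [r' [h1' h2' ->]]] /= [e1 e2].
  have [z1 _] := hl _ h1; have [z1' _] := hl _ h1'.
  by congr (_, _) => //; rewrite (quoP (divs_dv z1 h2)) (quoP (divs_dv z1' h2')) e2 e1.
- move=> p /allpairsPdep[rho [r [h1 h2 ->]]] /=; have [z1 hn] := hl _ h1.
  have dr := divs_dv z1 h2; have er := quoP dr.
  apply/allpairsPdep; exists r, (quo rho r); split => //.
    by rewrite mem_cball (divs_neq0 z1 h2) (divs_can z1 h2) eqxx (leq_trans (dv_nrm_le S z1 dr)).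
  have dq : dv (quo rho r) rho by rewrite {2}er dv_mulr ?dvxx.
  by rewrite mem_nzball (dv_neq0 z1 dq) (leq_trans (dv_nrm_le S z1 dq)).
- by move=> p _.
Qed.

(** The norm of [c] is at most [phi c] times the number of divisors of [c], so [1 / phi c] is at
    most the sum over the factorizations [c = r c'] of [1 / (nrm r * nrm c')], and two
    harmonic sums appear. *)
Lemma sum_inv_phi n I : (n < 2 ^ I)%N ->
  \sum_(c <- nzball n) (phi c)%:R^-1 <= (40 * I%:R) ^+ 2 :> R.
Proof.
move=> nI; have hn := harmonic nI.
apply: (@le_trans _ _ (\sum_(c <- nzball n) \sum_(r <- divs c) (nrm r)%:R^-1 * (nrm (quo c r))%:R^-1)).
  rewrite big_seq [leRHS]big_seq; apply: ler_sum => c; rewrite mem_nzball => /andP[c0 _].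
  have p0 : 0 < (phi c)%:R :> R by rewrite ltr0n phi_gt0.
  have n0 : 0 < (nrm c)%:R :> R by rewrite ltr0n nrm_gt0.
  rewrite big_seq (eq_bigr (fun=> (nrm c)%:R^-1)) => [|r hr]; last first.
    by rewrite -invfM -natrM -nrmM mulrC -(quoP (divs_dv c0 hr)).
  rewrite -big_seq big_const_seq count_predT iter_addr_0 -[leRHS]mulr_natl.
  rewrite ler_pdivlMr// mulrC ler_pdivrMr// -natrM ler_nat.
  exact: nrm_le_phi.
apply: le_trans (sum_divs_le (n := n) (F := fun r c => (nrm r)%:R^-1 * (nrm c)%:R^-1) (nzball_uniq n) _ _) _.
- by move=> c; rewrite mem_nzball => /andP[].
- by move=> r c; rewrite mulr_ge0 ?invr_ge0.
under eq_bigr do rewrite -mulr_sumr.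
rewrite -mulr_suml expr2; apply: ler_pM => //; try by apply: sumr_ge0 => i _; rewrite invr_ge0.
apply: le_trans hn; apply: ler_sum_subset; rewrite ?cball_uniq// => x.
by rewrite mem_cball mem_nzball => /and3P[-> _ ->].
Qed.

(** With [g] the common divisor, multiplicativity holds up to a factor [g / phi g], which is at
    least one. *)
Lemma phi_mul_ge r c : r != 0 -> c != 0 -> (phi r * phi c <= phi (r * c))%N.
Proof.
move=> r0 c0; have rc0 := mulO_neq0 S r0 c0.
have [g [gr gc _ bez]] := gcdP S r c.
have g0 := dv_neq0 r0 gr.
have rq : dv r (r * c) by rewrite dv_mulr ?dvxx.
have cq : dv c (r * c) by rewrite dv_mull ?dvxx.
have := @phi_cnt2 _ S (r * c) c r g 1 rc0 cq rq.
rewrite copC cop1 subrr dv0 muln1 => /(_ isT gr gc bez) h.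
rewrite -(leq_pmul2r (phi_gt0 S g0)) -h leq_mul2l; apply/orP; right.
apply: leq_trans (phi_le S g0) _; rewrite -(res_size S g0).
have [r' er] := dvP _ _ gr.
have r'0 : r' != 0 by apply: contraNneq r0 => e; rewrite er e mul0r.
pose l := r' * c.
have rl : dv r (l * g) by rewrite /l er mulrAC dv_mulr ?dvxx.
have dl : dv r l.
  have [c' ec] := dvP _ _ gc; by rewrite /l ec mulrCA -er dv_mull ?dvxx.
pose f v := rep (r * c) (1 + l * v).
have rcE : r * c = l * g by rewrite /l er; ring.
have l0 : l != 0 by rewrite mulO_neq0.
rewrite -(size_map f) /cnt -size_filter; apply: uniq_leq_size.
  rewrite map_inj_in_uniq ?res_uniq// => x y xr yr /eqP.
  rewrite rep_eq opprD addrACA subrr add0r -mulrBr rcE (dv_mul2l S)//.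
  exact: (res_inj g0 xr yr).
move=> _ /mapP[v vr ->]; rewrite mem_filter.
have h1 := rep_congr (r * c) (1 + l * v).
have hl d : dv d l -> dv d (r * c) -> dv d (f v - 1).
  move=> dl' dq; rewrite /f (_ : _ - 1 = rep (r * c) (1 + l * v) - (1 + l * v) + l * v); last by ring.
  by apply: dvD; [exact: dv_trans dq h1|exact: dv_mulr].
have fc : dv c (f v - 1) by apply: hl; rewrite // /l dv_mull ?dvxx.
have fr : dv r (f v - 1) by exact: hl.
rewrite fc fr /= rep_gres// (cop_cong (y := f v)) /f; last by rewrite rep_cong.
by rewrite copC copM ![cop _ (f v)]copC (cop_cong fr) (cop_cong fc) ![cop 1 _]copC !cop1.
Qed.

End Counts.

(** * Bilinear sums in arithmetic progressions *)

Lemma ler_sum_const (R : realType) (I : eqType) (s : seq I) (F : I -> R) (B : R) :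
  {in s, forall x, F x <= B} -> \sum_(x <- s) F x <= (size s)%:R * B.
Proof.
move=> h; apply: (@le_trans _ _ (\sum_(x <- s) B)).
  by rewrite big_seq [leRHS]big_seq; apply: ler_sum.
by rewrite big_const_seq count_predT iter_addr_0 -[leLHS]mulr_natl.
Qed.

Section Primes.
Variables (O : comNzRingType) (S : quad_pid O) (R : realType).
Implicit Types (x y z d e q r u v w c g t : O) (s : seq O).
Local Notation nrm := (nrm S).
Local Notation gres := (gres S).
Local Notation phi := (phi S).
Local Notation divs := (divs S).
Local Notation ball := (ball S).
Local Notation kk := (kk S R).
Local Notation kvar := (kvar S R).
Local Notation psi := (psi S R).

Definition prm w : bool := `[< prime_element w >].

Lemma principalE w x : principal w x <-> dv w x.
Proof.
split=> [[a _ <-]|/dvP[a ->]]; last by exists a.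
by apply/dvP; exists a.
Qed.

Lemma prmP w : prm w -> [/\ w != 0, ~~ dv w 1 & forall x y, dv w (x * y) -> dv w x || dv w y].
Proof.
have memE x : (x \in mem (principal w)) = dv w x.
  by apply/idP/idP => [/set_mem h|h]; [exact: (principalE w x).1 h|apply: mem_set; exact: (principalE w x).2 h].
move=> /asboolP[[[h0 h1 _] hp] hn]; split.
- apply/eqP => w0; apply: hn; apply/seteqP; split=> x /=.
    by move=> /(principalE w x).1; rewrite w0 => /dvP[a ->]; rewrite mulr0.
  by move=> ->; apply: (principalE w 0).2; exact: dv0.
- by rewrite -memE.
- by move=> x y; rewrite -!memE; exact: hp.
Qed.

Lemma prm_dv_assoc x y : prm x -> prm y -> dv x y -> dv y x.
Proof.
move=> /prmP[x0 xu _] /prmP[y0 _ py] /dvP[a e].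
have := py a x; rewrite -e dvxx => /(_ isT) /orP[/dvP[b eb]|//].
case/negP: xu; apply/dvP; exists b; apply: (mulOI S y0).
by rewrite mulr1 {1}e eb; ring.
Qed.

Lemma prm_noncop x t : prm x -> ~~ cop x t -> dv x t.
Proof.
move=> px /(noncop S)[g gu /andP[/dvP[a e] gt]]; have [x0 xu hx] := prmP px.
have := hx a g; rewrite -e dvxx => /(_ isT) /orP[/dvP[b eb]|xg]; last exact: dv_trans gt.
case/negP: gu; apply/dvP; exists b; apply: (mulOI S x0).
by rewrite mulr1 {1}e eb; ring.
Qed.

(** Associates differ by a unit, and the units are the elements of norm one. *)
Lemma count_assoc x0 s : x0 != 0 -> uniq s ->
  (count (fun x => dv x0 x && dv x x0) s <= size (ball 1))%N.
Proof.
move=> x00 us; rewrite -size_filter -(size_map (fun x => quo x x0)).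
apply: uniq_leq_size.
  rewrite map_inj_in_uniq ?filter_uniq// => x y.
  rewrite !mem_filter => /andP[/andP[/quoP ex _] _] /andP[/andP[/quoP ey _] _] e.
  by rewrite ex e -ey.
move=> _ /mapP[x hx ->]; move: hx; rewrite mem_filter => /andP[/andP[h1 h2] _].
have e := quoP h1; have n0 := nrm_gt0 S x00.
have : (nrm (quo x x0) * nrm x0 <= 1 * nrm x0)%N.
  by rewrite -nrmM -e mul1n (nrm_assoc S h2 h1).
by rewrite leq_pmul2r// mem_ball.
Qed.

(** Dividing by a prime at least halves the norm. *)
Lemma count_prime_dvd k t s : t != 0 -> (nrm t < 2 ^ k)%N -> uniq s ->
  (count (fun x => prm x && dv x t) s <= size (ball 1) * k)%N.
Proof.
elim: k t => [|k IH] t t0 tk us.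
  by move: tk; rewrite expn0 ltnS leqn0 nrm_eq0 (negbTE t0).
have [/hasP[x0 x0s /andP[p0 d0]]|] := boolP (has (fun x => prm x && dv x t) s); last first.
  by rewrite has_count -eqn0Ngt => /eqP ->.
have [x00 x0u _] := prmP p0; have [t' et] := dvP _ _ d0.
have t'0 : t' != 0 by apply: contraNneq t0 => h; rewrite et h mul0r.
have x02 : (2 <= nrm x0)%N by rewrite ltn_neqAle eq_sym -unit_nrm1 x0u nrm_gt0.
have tk' : (nrm t' < 2 ^ k)%N.
  move: tk; rewrite et nrmM expnS => h; rewrite -(ltn_pmul2l (isT : 0 < 2)%N).
  by apply: leq_ltn_trans h; rewrite mulnC leq_mul2l x02 orbT.
rewrite mulnS; apply: leq_trans (leq_add (count_assoc x00 us) (IH t' t'0 tk' us)).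
rewrite -count_predUI; apply: leq_trans (leq_addr _ _); apply: sub_count => x /= /andP[px].
rewrite et => xt; have [_ _ hx] := prmP px.
case/orP: (hx _ _ xt) => [->|h]; first by rewrite px orbT.
by rewrite h (prm_dv_assoc px p0 h).
Qed.

(** The discrepancy of the elements of [s] in the class of [g] modulo [q]; [Dp] is its analogue
    for products of pairs. *)
Definition D1 q g s : R := \sum_(x <- s) ((dv q (x - g))%:R - (cop x q)%:R / (phi q)%:R).
Definition Dp q g (l : seq (O * O)) : R :=
  \sum_(p <- l) ((dv q (p.1 * p.2 - g))%:R - (cop (p.1 * p.2) q)%:R / (phi q)%:R).
Lemma D1E q g s : D1 q g s = \sum_(x <- s) ((dv q (x - g))%:R - (cop x q)%:R / (phi q)%:R).
Proof. by []. Qed.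
Lemma DpE q g l :
  Dp q g l = \sum_(p <- l) ((dv q (p.1 * p.2 - g))%:R - (cop (p.1 * p.2) q)%:R / (phi q)%:R).
Proof. by []. Qed.
Definition prodl (s s' : seq O) : seq (O * O) := [seq (x, y) | x <- s, y <- s'].

Lemma Dp_prodl q g s s' : Dp q g (prodl s s') =
  \sum_(x <- s) \sum_(y <- s') ((dv q (x * y - g))%:R - (cop (x * y) q)%:R / (phi q)%:R).
Proof. by rewrite /Dp big_allpairs. Qed.

Lemma Dp_sym q g s s' : Dp q g (prodl s s') = Dp q g (prodl s' s).
Proof.
rewrite !Dp_prodl exchange_big /=; apply: eq_bigr => y _; apply: eq_bigr => x _.
by rewrite mulrC.
Qed.

Lemma dv_mul_inv q x y g : cop x q -> dv q (x * y - g) = dv q (y - g * inv q x).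
Proof.
move=> xq; rewrite -(cop_mul2 y (g * inv q x) xq); apply/esym/dv_cong.
rewrite (_ : _ - g = g * (x * inv q x - 1)); last by ring.
by rewrite dv_mull ?invP.
Qed.

(** For [x] fixed, [x y] lies in the class of [g] exactly when [y] lies in the class of [g / x]. *)
Lemma Dp_fix q g s s' (B : R) : cop g q -> 0 <= B ->
  (forall c, cop c q -> `|D1 q c s'| <= B) ->
  `|Dp q g (prodl s s')| <= (size s)%:R * B.
Proof.
move=> gq B0 hB; rewrite Dp_prodl; apply: le_trans (ler_norm_sum _ _ _) _.
apply: ler_sum_const => x _; have [xq|xq] := boolP (cop x q); last first.
  rewrite big1 ?normr0// => y _; rewrite copM (negbTE xq) /= mul0r subr0.
  case: (boolP (dv q (x * y - g))) => // h; move: xq; rewrite -(negbK (cop x q)) => /negP[].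
  by apply/negPn; apply: (@copM_l _ x y); rewrite (cop_cong h).
rewrite (_ : \sum_(y <- s') _ = D1 q (g * inv q x) s'); first by rewrite hB// copMl// inv_coprime.
by apply: eq_bigr => y _; rewrite dv_mul_inv// copM xq.
Qed.

Lemma D1_trivial q g s : q != 0 -> `|D1 q g s| <= 2 * (size s)%:R.
Proof.
move=> q0; apply: le_trans (ler_norm_sum _ _ _) _.
rewrite mulrC; apply: ler_sum_const => x _; apply: le_trans (ler_normB _ _) _.
rewrite -[2]/(1 + 1) lerD//; first by case: (dv _ _); rewrite ?normr1 ?normr0.
have p0 : 0 < (phi q)%:R :> R by rewrite ltr0n phi_gt0.
rewrite ger0_norm ?divr_ge0// ler_pdivrMr// mul1r ler_nat.
by apply: leq_trans (leq_b1 _) _; rewrite phi_gt0.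
Qed.

(** Detecting [x y = g mod q] by the kernels of the divisors of [q]; the trivial
    divisor contributes the expected main term. *)
Lemma Dp_kernel q g s s' : q != 0 -> can q = q -> cop g q ->
  (phi q)%:R * Dp q g (prodl s s') =
  \sum_(r <- divs q | r != can 1) \sum_(x <- s | cop x q) \sum_(y <- s' | cop y q) kk r (x * y * inv q g).
Proof.
move=> q0 cq gq; have p0 : (phi q)%:R != 0 :> R by rewrite pnatr_eq0 -lt0n phi_gt0.
have c10 : can 1 != 0 :> O by apply: can_neq0; exact: oner_neq0.
have c1u : dv (can 1) (1 : O) by exact: (can_assoc 1).2.
have c1d : can 1 \in divs q by rewrite mem_divs// can_id eqxx andbT (dv_trans c1u) ?dv1.
have k1 u : kk (can 1) u = 1.
  have all1 d v : dv d 1 -> dv d v by move=> h; apply: dv_trans h (dv1 _).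
  have divs1 : perm_eq (divs (can 1)) [:: can 1].
    apply: uniq_perm; rewrite ?divs_uniq// => d; rewrite mem_divs// inE.
    apply/andP/eqP => [[h /eqP cd]|->]; last by rewrite dvxx can_id.
    rewrite -cd; apply: assoc_can; last exact: dv1.
    exact: dv_trans h c1u.
  have := @kk_sum _ S R (can 1) u c10 (can_id 1).
  rewrite (perm_big _ divs1) big_seq1 => ->; rewrite (all1 (can 1) (u - 1) c1u) mulr1.
  suff -> : phi (can 1) = 1%N by [].
  apply/eqP; rewrite eqn_leq phi_gt0// andbT; apply: leq_trans (phi_le S c10) _.
  by rewrite nrm_can nrm1.
rewrite Dp_prodl mulr_sumr exchange_big /= [RHS]big_mkcond.
apply: eq_bigr => x _; case: ifPn => [xq|xq]; last first.
  rewrite big1 ?mulr0// => y _; rewrite copM (negbTE xq) /= mul0r subr0.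
  case: (boolP (dv q (x * y - g))) => // h; case/negP: xq.
  by apply: (@copM_l _ x y); rewrite (cop_cong h).
rewrite mulr_sumr exchange_big /= [RHS]big_mkcond; apply: eq_bigr => y _.
case: ifPn => [yq|yq]; last first.
  rewrite copM (negbTE yq) andbF /= mul0r subr0.
  case: (boolP (dv q (x * y - g))) => [h|]; last by rewrite mulr0.
  by case/negP: yq; apply: (@copM_r _ x y); rewrite (cop_cong h).
rewrite copM xq yq /= mulrBr mul1r mulfV//.
have -> : dv q (x * y - g) = dv q (x * y * inv q g - 1) by rewrite dv_inv_eq// dvBC.
by rewrite -(@kk_sum _ S R q)// (bigD1_seq (can 1)) ?divs_uniq//= k1 addrAC subrr add0r.
Qed.

Definition sig r s : R := \sum_(b <- gres r) sqn (\sum_(n <- s) psi r (b * n)).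
Definition part c s : seq O := [seq x <- s | cop x c].

Lemma sig_ge0 r s : 0 <= sig r s. Proof. by apply: sumr_ge0 => b _; exact: sqn_ge0. Qed.

Lemma kernel_big r s s' c : r != 0 -> can r = r -> cop c r ->
  `|\sum_(x <- s | cop x r) \sum_(y <- s' | cop y r) kk r (x * y * c)| <=
  (phi r)%:R * ((nrm r)%:R^-1 * (Num.sqrt (sig r s) * Num.sqrt (sig r s'))).
Proof.
move=> r0 cr hc; have p0 : 0 < (phi r)%:R :> R by rewrite ltr0n phi_gt0.
have n0 : 0 < (nrm r)%:R :> R by rewrite ltr0n nrm_gt0.
rewrite -(ler_pM2l p0); apply: le_trans (@kk_bilinear _ S R r s s' c r0 cr hc) _.
have h l : Num.sqrt (kvar r l) <= (phi r)%:R * Num.sqrt ((nrm r)%:R^-1) * Num.sqrt (sig r l).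
  rewrite [X in X * _ * _](_ : (phi r)%:R = Num.sqrt ((phi r)%:R ^+ 2)); last by rewrite sqrtr_sqr gtr0_norm.
  rewrite -!sqrtrM ?sqr_ge0 ?mulr_ge0 ?invr_ge0 ?sqr_ge0//.
  apply: ler_wsqrtr; have := @kvar_le _ S R r l r0 cr; rewrite -/(sig r l) => h.
  by rewrite mulrAC ler_pdivlMr// mulrC.
apply: le_trans (ler_pM _ _ (h s) (h s')) _; rewrite ?sqrtr_ge0//.
rewrite le_eqVlt; apply/orP; left; apply/eqP.
have : Num.sqrt (nrm r)%:R^-1 ^+ 2 = (nrm r)%:R^-1 :> R by rewrite sqr_sqrtr ?invr_ge0.
by move=> e; rewrite -[in RHS]e; ring.
Qed.

(** A kernel is a combination of indicators of reduced classes with coefficients at most [phi r] and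
    total sum zero, so only the discrepancy of [s] in these classes remains. *)
Lemma kernel_small r s c (B : R) : r != 0 -> can r = r -> r != can 1 -> cop c r -> 0 <= B ->
  (forall u, cop u r -> `|D1 r u s| <= B) ->
  `|\sum_(y <- s | cop y r) kk r (y * c)| <= (phi r)%:R * ((phi r)%:R * B).
Proof.
move=> r0 cr r1 hc B0 hB.
have nr1 : ~~ dv r 1.
  by apply: contra r1 => h; apply/eqP; rewrite -cr; apply: assoc_can => //; exact: dv1.
have pk : per_mod r (fun u => kk r (u * c)).
  by move=> a b h; apply: kk_per; rewrite // -mulrBl dv_mulr.
have z0 : \sum_(u <- gres r) kk r (u * c) = 0.
  under eq_bigr do rewrite mulrC.
  rewrite (sum_gres_mul S r0 hc (@kk_per _ S R r r0 cr)).
  have := @kk_orth _ S R r r0 cr r 1 1 r0 (dvxx r) (dv1 r) nr1.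
  rewrite copC cop1 => /(_ isT) h; rewrite -[RHS]h [RHS]big_mkcond /=.
  by apply: eq_bigr => u _; rewrite dv1.
have -> : \sum_(y <- s | cop y r) kk r (y * c) = \sum_(u <- gres r) kk r (u * c) * D1 r u s.
  rewrite (@sum_gfib _ S _ r (fun y => cop y r) s _ r0) => [|//].
  transitivity (\sum_(u <- gres r) kk r (u * c) * \sum_(y <- s) ((dv r (y - u))%:R : R)).
    rewrite big_seq [RHS]big_seq; apply: eq_bigr => u /gres_cop ur.
    rewrite mulr_sumr big_mkcond; apply: eq_bigr => y _.
    case: (boolP (dv r (y - u))) => h; last by rewrite andbF mulr0.
    by rewrite andbT (cop_cong h) ur mulr1 (pk y u).
  rewrite (eq_bigr (fun u => kk r (u * c) * D1 r u s +
      kk r (u * c) * \sum_(y <- s) (cop y r)%:R / (phi r)%:R)) => [|u _].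
    by rewrite big_split /= -mulr_suml z0 mul0r addr0.
  by rewrite -mulrDr /D1 -big_split /=; congr (_ * _); apply: eq_bigr => y _; rewrite subrK.
apply: le_trans (ler_norm_sum _ _ _) _.
apply: ler_sum_const => u ur; have uc := gres_cop ur.
by rewrite normrM ler_pM ?hB// kk_bound// copMl.
Qed.

Lemma part_sum (V : nmodType) q r c s (F : O -> V) : q = c * r ->
  \sum_(x <- s | cop x q) F x = \sum_(x <- part c s | cop x r) F x.
Proof.
move=> ->; rewrite big_filter_cond; apply: eq_bigl => x.
by rewrite copC copM ![cop _ x]copC.
Qed.

Lemma part_size c s : (size (part c s) <= size s)%N.
Proof. by rewrite size_filter count_size. Qed.

(** The mean value estimate behind the bilinear terms.  Write a modulus as
    [q = c r] with [r] the conductor: conductors below [2 ^ i0] are controlled by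
    the equidistribution of [s'] alone, larger ones by the large sieve. *)
Lemma large_pairs (s s' : seq O) (P P' n I i0 : nat) (Delta : R) :
  uniq s -> uniq s' -> {in s', forall x, prm x} ->
  {in s, forall x, nrm x <= P ^ 2}%N -> {in s', forall x, nrm x <= P' ^ 2}%N ->
  (n < 2 ^ I)%N -> (i0 <= I)%N -> 0 <= Delta ->
  (forall r, r != 0 -> can r = r -> (nrm r < 2 ^ i0)%N -> forall u, cop u r -> `|D1 r u s'| <= Delta) ->
  exists E : O -> R, [/\ forall q, 0 <= E q,
    forall q, q \in cball S n -> forall g, cop g q -> `|Dp q g (prodl s s')| <= E q &
    \sum_(q <- cball S n) E q <= (40 * I%:R) ^+ 2 *
      (20 * (2 ^ i0)%:R * ((size s)%:R * ((2 ^ i0)%:R * Delta + (size (ball 1) * I)%:R)) +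
       \sum_(i0 <= i < I) (2 ^ i)%:R^-1 *
         (64 * (sieve_const S * (2 ^ i.+1 + P))%:R * Num.sqrt (size s)%:R *
         (64 * (sieve_const S * (2 ^ i.+1 + P'))%:R * Num.sqrt (size s')%:R)))].
Proof.
move=> us us' ps' sP sP' nI i0I D0 hD.
pose B1 : R := (size s)%:R * ((2 ^ i0)%:R * Delta + (size (ball 1) * I)%:R).
have B10 : 0 <= B1 by rewrite mulr_ge0 ?addr_ge0 ?mulr_ge0.
pose B2 r c : R := Num.sqrt (sig r (part c s)) * Num.sqrt (sig r (part c s')).
have B20 r c : 0 <= B2 r c by rewrite mulr_ge0 ?sqrtr_ge0.
pose F r c : R := if r == can 1 then 0 else (phi c)%:R^-1 *
  (if (nrm r < 2 ^ i0)%N then B1 else (nrm r)%:R^-1 * B2 r c).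
have F0 r c : 0 <= F r c.
  rewrite /F; case: ifP => // _; rewrite mulr_ge0 ?invr_ge0//.
  by case: ifP => // _; rewrite mulr_ge0 ?invr_ge0.
exists (fun q => \sum_(r <- divs q) F r (quo q r)); split.
- by move=> q; apply: sumr_ge0.
- move=> q; rewrite mem_cball => /and3P[q0 /eqP cq qn] g gq.
  have p0 : 0 < (phi q)%:R :> R by rewrite ltr0n phi_gt0.
  rewrite -(ler_pM2l p0) -{1}(ger0_norm (ltW p0)) -normrM Dp_kernel//.
  apply: le_trans (ler_norm_sum _ _ _) _.
  rewrite mulr_sumr big_mkcond /= big_seq [leRHS]big_seq; apply: ler_sum => r rq.
  have r0 := divs_neq0 q0 rq; have cr := divs_can q0 rq; have rdq := divs_dv q0 rq.
  have eq := quoP rdq; set c := quo q r in eq *.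
  have c0 : c != 0 by apply: contraNneq q0 => h; rewrite eq h mul0r.
  have cn : (nrm c < 2 ^ I)%N.
    apply: leq_ltn_trans nI; apply: leq_trans qn; apply: (dv_nrm_le S q0).
    by rewrite eq dv_mulr ?dvxx.
  have pr : 0 < (phi r)%:R :> R by rewrite ltr0n phi_gt0.
  have pc : 0 < (phi c)%:R :> R by rewrite ltr0n phi_gt0.
  have pq : (phi r)%:R <= (phi q)%:R / (phi c)%:R :> R.
    by rewrite ler_pdivlMr// -natrM ler_nat eq mulrC; exact: phi_mul_ge.
  rewrite /F; case: ifPn => [r1|/negPn ->]; last by rewrite mulr0.
  rewrite ifN// mulrA; have ig : cop (inv q g) r by exact: cop_dv rdq (inv_coprime gq).
  rewrite (part_sum _ _ eq).
  under eq_bigr do rewrite (part_sum _ _ eq).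
  case: ifPn => rs.
    apply: (@le_trans _ _ ((phi r)%:R * B1)); last by rewrite ler_wpM2r.
    apply: le_trans (ler_norm_sum _ _ _) _.
    apply: (@le_trans _ _ (\sum_(x <- part c s) (phi r)%:R * ((2 ^ i0)%:R * Delta + (size (ball 1) * I)%:R))); last first.
      apply: le_trans (ler_sum_const (fun _ _ => lexx _)) _.
      rewrite /B1 mulrCA ler_wpM2l ?(ltW pr)// ler_wpM2r ?ler_nat ?part_size//.
      by rewrite addr_ge0 ?mulr_ge0.
    rewrite big_mkcond /=; apply: ler_sum => x _; case: ifP => xr; last first.
      by rewrite mulr_ge0 ?(ltW pr)// addr_ge0 ?mulr_ge0.
    have xg : cop (x * inv q g) r by rewrite copMl.
    have hk y : kk r (x * y * inv q g) = kk r (y * (x * inv q g)) by congr (kk r _); ring.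
    under eq_bigr do rewrite hk.
    have -> : \sum_(y <- part c s' | cop y r) kk r (y * (x * inv q g)) =
      \sum_(y <- s' | cop y r) kk r (y * (x * inv q g)) -
      \sum_(y <- s' | cop y r && ~~ cop y c) kk r (y * (x * inv q g)).
      rewrite [X in X - _](bigID (fun y => cop y c)) /= addrK big_filter_cond.
      by apply: eq_bigl => y; rewrite andbC.
    apply: le_trans (ler_normB _ _) _; rewrite mulrDr; apply: lerD.
      apply: le_trans (kernel_small r0 cr r1 xg D0 (hD r r0 cr rs)) _.
      rewrite ler_wpM2l ?(ltW pr)// ler_wpM2r// ler_nat.
      by apply: leq_trans (phi_le S r0) (ltnW rs).
    rewrite -big_filter; apply: le_trans (ler_norm_sum _ _ _) _.
    apply: le_trans (ler_sum_const (B := (phi r)%:R) _) _.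
      move=> y; rewrite mem_filter => /andP[/andP[yr _] _].
      by apply: kk_bound => //; rewrite copMl.
    rewrite mulrC ler_wpM2l ?(ltW pr)// ler_nat size_filter.
    apply: leq_trans (count_prime_dvd c0 cn us').
    rewrite -!size_filter; apply: uniq_leq_size; first by rewrite filter_uniq.
    move=> y; rewrite !mem_filter => /andP[/andP[_ yc] ys]; rewrite ys andbT.
    by rewrite (ps' y ys) prm_noncop// ps'.
  apply: le_trans (kernel_big _ _ r0 cr ig) _.
  by rewrite ler_wpM2r// mulr_ge0 ?invr_ge0.
apply: le_trans (sum_divs_le (n := n) (cball_uniq S n) _ F0) _.
  by move=> q; rewrite mem_cball => /and3P[].
rewrite exchange_big /=.
set T1 := 20 * _ * _; set T2 := \sum_(i0 <= i < I) _.
have T10 : 0 <= T1 by rewrite mulr_ge0.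
have T20 : 0 <= T2.
  by apply: sumr_ge0 => i _; rewrite mulr_ge0 ?invr_ge0// !mulr_ge0 ?sqrtr_ge0.
pose T := T1 + T2; have T0 : 0 <= T by exact: addr_ge0.
apply: (@le_trans _ _ (\sum_(c <- nzball S n) (phi c)%:R^-1 * T)); last first.
  by rewrite -mulr_suml ler_wpM2r// sum_inv_phi.
apply: ler_sum => c _.
apply: (@le_trans _ _ (\sum_(r <- cball S n) (phi c)%:R^-1 *
    (if (nrm r < 2 ^ i0)%N then B1 else (nrm r)%:R^-1 * B2 r c))).
  apply: ler_sum => r _; rewrite /F; case: ifP => // _; rewrite mulr_ge0 ?invr_ge0//.
  by case: ifP => // _; rewrite mulr_ge0 ?invr_ge0.
rewrite -mulr_sumr ler_wpM2l ?invr_ge0//.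
rewrite (bigID (fun r => (nrm r < 2 ^ i0)%N)) /=; apply: lerD.
  rewrite (eq_bigr (fun=> B1)) => [|r -> //].
  rewrite -big_filter; apply: le_trans (ler_sum_const (fun _ _ => lexx _)) _.
  rewrite ler_wpM2r//; apply: (@le_trans _ _ (size (ball (2 ^ i0).-1))%:R).
    rewrite ler_nat; apply: uniq_leq_size; first exact: filter_uniq (cball_uniq S n).
    move=> r; rewrite mem_filter mem_ball => /andP[h _].
    by rewrite -ltnS prednK ?expn_gt0.
  by apply: le_trans (ball_size _ _ _) _; rewrite prednK ?expn_gt0.
have := @dyadic_sum _ S R (B2^~ c) (fun i => 64 * (sieve_const S * (2 ^ i.+1 + P))%:R * Num.sqrt (size s)%:R *
         (64 * (sieve_const S * (2 ^ i.+1 + P'))%:R * Num.sqrt (size s')%:R)) i0 I (cball S n) i0I.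
move=> /(_ (fun r => B20 r c)) h.
rewrite big_seq_cond (eq_bigl (fun r => (r \in cball S n) && (2 ^ i0 <= nrm r < 2 ^ I)%N)); last first.
  move=> r; rewrite mem_cball; case: (r != 0) => //=; case: (can r == r) => //=.
  by move: nI; clear; move: (2 ^ I)%N (2 ^ i0)%N (nrm r) => a b e; lia.
rewrite -big_seq_cond (eq_bigr (fun r => (nrm r)%:R^-1 * B2 r c)) => [|r /andP[h1 _]]; last first.
  by rewrite ltnNge h1.
apply: h => i _; apply: le_trans (ler_norm _) _; apply: le_trans (cauchy_schwarz_sqrt _ _ _ _) _.
have bnd l (Q : nat) : uniq l -> {in l, forall x, nrm x <= Q ^ 2}%N ->
   Num.sqrt (\sum_(r <- cball S n | (nrm r < 2 ^ i.+1)%N) Num.sqrt (sig r (part c l)) ^+ 2) <=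
   64 * (sieve_const S * (2 ^ i.+1 + Q))%:R * Num.sqrt (size l)%:R.
  move=> ul lQ; set K := (_ * _)%N.
  rewrite (eq_bigr (fun r => sig r (part c l))) => [|r _]; last by rewrite sqr_sqrtr ?sig_ge0.
  have -> : 64 * K%:R * Num.sqrt (size l)%:R = Num.sqrt (64 ^+ 2 * K%:R ^+ 2 * (size l)%:R) :> R.
    by rewrite -exprMn sqrtrM ?sqr_ge0// sqrtr_sqr ger0_norm ?mulr_ge0.
  apply: ler_wsqrtr; rewrite -big_filter.
  apply: (@le_trans _ _ (\sum_(r <- cball S (2 ^ i.+1)) sig r (part c l))).
    apply: ler_sum_subset => [|r|r]; [exact: filter_uniq (cball_uniq S n)| |exact: sig_ge0].
    by rewrite mem_filter !mem_cball => /andP[/ltnW -> /and3P[-> -> _]].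
  have e0 : (0 < 2 ^ i.+1)%N by rewrite expn_gt0.
  have upl : uniq (part c l) by rewrite filter_uniq.
  have hpl : {in part c l, forall x, nrm x <= Q ^ 2}%N.
    by move=> x; rewrite mem_filter => /andP[_ /lQ].
  apply: le_trans (sieve_ball R e0 upl hpl) _.
  by rewrite ler_wpM2l ?mulr_ge0 ?sqr_ge0// ler_nat part_size.
by apply: ler_pM; rewrite ?sqrtr_ge0 ?bnd.
Qed.

End Primes.

(** * Cutting pairs of primes into cells *)

Section Cells.
Variables (O : comNzRingType) (S : quad_pid O) (R : realType).
Implicit Types (x y z e q r u v w c t : O) (s : seq O) (p : O * O).
Local Notation nrm := (nrm S).
Local Notation gres := (gres S).
Local Notation phi := (phi S).
Local Notation ball := (ball S).
Local Notation D1 := (D1 S R).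
Local Notation Dp := (Dp S R).

Definition pr (a : R) : seq O := [seq x <- ball (Num.truncn a) | prm x].

Lemma pr_uniq a : uniq (pr a). Proof. by rewrite filter_uniq ?ball_uniq. Qed.

Lemma prm_gt1 x : prm x -> (1 < nrm x)%N.
Proof. by move=> /(prmP)[x0 xu _]; rewrite ltn_neqAle eq_sym -unit_nrm1 xu nrm_gt0. Qed.

Lemma mem_pr a x : (x \in pr a) = prm x && ((nrm x)%:R <= a).
Proof.
rewrite mem_filter mem_ball; case: (boolP (prm x)) => //= px.
by have := prm_gt1 px; case: (nrm x) => // n _; rewrite truncn_gt_nat.
Qed.


Definition pp (a : R) : seq (O * O) := [seq p <- prodl (pr a) (pr a) | (nrm (p.1 * p.2))%:R <= a].

Lemma prodl_uniq s s' : uniq s -> uniq s' -> uniq (prodl s s').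
Proof. by move=> u u'; apply: allpairs_uniq => // -[? ?] [? ?]. Qed.

Lemma mem_prodl s s' p : (p \in prodl s s') = (p.1 \in s) && (p.2 \in s').
Proof.
case: p => x y; apply/allpairsP/andP => [[[a b]]/=|[h1 h2]]; last by exists (x, y).
by move=> [h1 h2 [-> ->]].
Qed.

Lemma pp_uniq a : uniq (pp a). Proof. by rewrite filter_uniq ?prodl_uniq ?pr_uniq. Qed.

Lemma mem_pp a p : (p \in pp a) = [&& prm p.1, prm p.2 & (nrm (p.1 * p.2))%:R <= a].
Proof.
rewrite mem_filter mem_prodl !mem_pr; case: (boolP (prm p.1)) => /= [p1|]; last by rewrite andbF.
case: (boolP (prm p.2)) => /= [p2|]; last by rewrite !andbF.
rewrite andb_idr// => h; have := prm_gt1 p1; have := prm_gt1 p2.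
rewrite nrmM in h => h2 h1.
by apply/andP; split; apply: le_trans h; rewrite ler_nat; nia.
Qed.

Variable g : R.
Hypothesis g1 : 1 < g.

Definition cell (j : nat) : seq O := [seq x <- pr (g ^+ (2 * j.+1)) | g ^+ (2 * j) < (nrm x)%:R].

Lemma cell_uniq j : uniq (cell j). Proof. by rewrite filter_uniq ?pr_uniq. Qed.

Lemma mem_cell j x : (x \in cell j) = [&& prm x, g ^+ (2 * j) < (nrm x)%:R & (nrm x)%:R <= g ^+ (2 * j.+1)].
Proof. by rewrite mem_filter mem_pr andbCA. Qed.

Lemma D1_cell q c j : D1 q c (cell j) = D1 q c (pr (g ^+ (2 * j.+1))) - D1 q c (pr (g ^+ (2 * j))).
Proof.
rewrite [in X in _ = X - _]D1E (bigID (fun x => g ^+ (2 * j) < (nrm x)%:R)) /= -big_filter -/(cell j) -/(D1 q c _).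
rewrite -[X in _ + X - _]big_filter [X in _ + X - _](_ : _ = D1 q c (pr (g ^+ (2 * j)))) ?addrK//.
apply: perm_big; apply: uniq_perm; rewrite ?filter_uniq ?pr_uniq ?ball_uniq// => x.
rewrite mem_filter !mem_pr -leNgt andbCA; congr andb; apply: andb_idr => h.
by apply: le_trans h _; rewrite ler_eXn2l//; lia.
Qed.

Variable J : nat.

(** The cell of [x]; the bound [J] makes it computable. *)
Definition idx x : nat := find (fun j => (nrm x)%:R <= g ^+ (2 * j.+1)) (iota 0 J).

Lemma idx_cell x : prm x -> (nrm x)%:R <= g ^+ (2 * J) -> (idx x < J)%N /\ x \in cell (idx x).
Proof.
move=> px hx; pose P j := (nrm x)%:R <= g ^+ (2 * j.+1).
have J0 : (0 < J)%N.
  rewrite lt0n; apply: contraTneq hx => ->; rewrite muln0 expr0 -ltNge.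
  by rewrite ltr1n prm_gt1.
have hs : has P (iota 0 J).
  by apply/hasP; exists J.-1; rewrite ?mem_iota /P ?prednK//; lia.
have lt : (idx x < J)%N by rewrite -[X in (_ < X)%N](size_iota 0 J) -has_find.
split=> //; rewrite mem_cell px /=; apply/andP; split; last first.
  by have := nth_find 0%N hs; rewrite nth_iota// add0n.
case e : (idx x) => [|i]; first by rewrite muln0 expr0 ltr1n prm_gt1.
have hlt : (i < find P (iota 0 J))%N by rewrite -/(idx x) e.
have := before_find 0%N hlt; rewrite nth_iota; last by lia.
by rewrite add0n => /negbT; rewrite -ltNge.
Qed.

Lemma cell_idx x j : (nrm x)%:R <= g ^+ (2 * J) -> x \in cell j -> idx x = j.
Proof.
move=> hJ hx; have /and3P[px h1 h2] : [&& prm x, g ^+ (2 * j) < (nrm x)%:R & (nrm x)%:R <= g ^+ (2 * j.+1)] by rewrite -mem_cell.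
have [_] := idx_cell px hJ; rewrite mem_cell => /and3P[_ h3 h4].
have a : (2 * j < 2 * (idx x).+1)%N by rewrite -(ltr_eXn2l g1) (lt_le_trans h1).
have b : (2 * idx x < 2 * j.+1)%N by rewrite -(ltr_eXn2l g1) (lt_le_trans h3).
by lia.
Qed.

(** The pairs of cells all of whose products have absolute value at most [M]. *)
Definition good (M : R) (i j : nat) : bool := g ^+ i.+1 * g ^+ j.+1 <= M.
Definition rest (M : R) : seq (O * O) := [seq p <- pp (M ^+ 2) | ~~ good M (idx p.1) (idx p.2)].

Lemma sum_by (l : seq (O * O)) (P : pred (O * O)) (h : O * O -> nat) (f : O * O -> R) :
  {in l, forall p, h p < J}%N ->
  \sum_(p <- l | P p) f p = \sum_(i <- iota 0 J) \sum_(p <- l | P p && (h p == i)) f p.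
Proof.
move=> hl; rewrite (exchange_big_dep P) => [/=|i p _ /andP[]//].
rewrite big_seq_cond [RHS]big_seq_cond; apply: eq_bigr => p /andP[pl Pp].
have hi : h p \in iota 0 J by rewrite mem_iota hl.
rewrite (big_rem (h p) hi) /= Pp eqxx /= big_seq_cond big1 ?addr0// => i /andP[].
by rewrite mem_rem_uniq ?iota_uniq// inE => /andP[ne _] /eqP e; rewrite /= e eqxx in ne.
Qed.

Lemma pp_le M p : 0 <= M -> M ^+ 2 <= g ^+ (2 * J) -> p \in pp (M ^+ 2) ->
  (nrm p.1)%:R <= g ^+ (2 * J) /\ (nrm p.2)%:R <= g ^+ (2 * J).
Proof.
move=> M0 MJ; rewrite mem_filter mem_prodl !mem_pr => /and3P[_ /andP[_ h1] /andP[_ h2]].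
by split; [exact: le_trans h1 MJ|exact: le_trans h2 MJ].
Qed.

(** Every prime lies in exactly one cell, and a good product of cells lies inside the range
    [|x y| <= M]. *)
Lemma cells_sum (M : R) (f : O * O -> R) : 0 <= M -> M ^+ 2 <= g ^+ (2 * J) ->
  \sum_(p <- pp (M ^+ 2)) f p =
  \sum_(i <- iota 0 J) \sum_(j <- iota 0 J | good M i j) \sum_(p <- prodl (cell i) (cell j)) f p +
  \sum_(p <- rest M) f p.
Proof.
move=> M0 MJ; rewrite (bigID (fun p => good M (idx p.1) (idx p.2))) /=; congr (_ + _); last by rewrite -big_filter.
have hidx p : p \in pp (M ^+ 2) -> (idx p.1 < J)%N /\ (idx p.2 < J)%N.
  move=> hp; have [h1 h2] := pp_le M0 MJ hp; move: hp; rewrite mem_pp => /and3P[p1 p2 _].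
  by have [? _] := idx_cell p1 h1; have [? _] := idx_cell p2 h2.
rewrite (sum_by _ (h := fun p => idx p.1)) => [|p /hidx[]//].
apply: eq_bigr => i _; rewrite (sum_by _ (h := fun p => idx p.2)) => [|p /hidx[]//].
rewrite [RHS]big_mkcond /=; apply: eq_bigr => j _; case: ifPn => hg; last first.
  by rewrite big1// => p /andP[/andP[hgp /eqP e1] /eqP e2]; rewrite e1 e2 (negbTE hg) in hgp.
rewrite -big_filter; apply: perm_big; apply: uniq_perm.
- by rewrite filter_uniq ?pp_uniq.
- by rewrite prodl_uniq ?cell_uniq.
move=> p; rewrite mem_filter mem_prodl; apply/idP/idP.
  move=> /andP[/andP[/andP[_ /eqP e1] /eqP e2] hp]; have [h1 h2] := pp_le M0 MJ hp.
  move: hp; rewrite mem_pp => /and3P[p1 p2 _].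
  by rewrite -{1}e1 -{1}e2 (idx_cell p1 h1).2 (idx_cell p2 h2).2.
move=> /andP[c1 c2]; have gp n : 0 < g ^+ n by rewrite exprn_gt0// (lt_trans _ g1).
have hp : p \in pp (M ^+ 2).
  move: c1 c2; rewrite !mem_cell mem_pp => /and3P[-> _ h1] /and3P[-> _ h2] /=.
  rewrite nrmM natrM; apply: le_trans (ler_pM _ _ h1 h2) _ => //.
  have -> : g ^+ (2 * i.+1) * g ^+ (2 * j.+1) = (g ^+ i.+1 * g ^+ j.+1) ^+ 2.
    by rewrite exprMn -!exprM ![(_ * 2)%N]mulnC.
  by rewrite ler_pXn2r ?nnegrE// mulr_ge0 ?ltW.
have [h1 h2] := pp_le M0 MJ hp.
by rewrite hp (cell_idx h1 c1) (cell_idx h2 c2) hg !eqxx.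
Qed.

End Cells.

Section Boundary.
Variables (O : comNzRingType) (S : quad_pid O) (R : realType).
Implicit Types (x y z e q r u v w c t : O) (p : O * O).
Local Notation nrm := (nrm S).
Local Notation phi := (phi S).

(** The main term is an average of counts over the reduced classes, so it obeys the same bound as
    each count. *)
Lemma Dp_count q c (l : seq (O * O)) (B : R) : q != 0 ->
  (forall a, (count (fun p => dv q (p.1 * p.2 - a)) l)%:R <= B) -> `|Dp S R q c l| <= 2 * B.
Proof.
move=> q0 hB; have p0 : 0 < (phi q)%:R :> R by rewrite ltr0n phi_gt0.
have cE (P : pred (O * O)) : \sum_(p <- l) (P p)%:R = (count P l)%:R :> R.
  by rewrite -sum1_count natr_sum [RHS]big_mkcond; apply: eq_bigr => p _; case: (P p).
rewrite /Dp sumrB -mulr_suml !cE; apply: le_trans (ler_normB _ _) _.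
rewrite mulr2n mulrDl mul1r; apply: lerD; first by rewrite ger0_norm.
rewrite ger0_norm ?divr_ge0// ler_pdivrMr//.
have -> : count (fun p => cop (p.1 * p.2) q) l =
    (\sum_(a <- gres S q) count (fun p => dv q (p.1 * p.2 - a)) l)%N.
  pose f p := p.1 * p.2; transitivity (count (fun x => cop x q) (map f l)); first by rewrite count_map.
  rewrite -sum1_count (@sum_gfib _ S _ q (fun x => cop x q) (map f l) _ q0) => [|//].
  rewrite big_seq [RHS]big_seq; apply: eq_bigr => a /gres_cop aq.
  rewrite sum1_count count_map; apply: eq_count => p /=; rewrite andb_idl// => h.
  by rewrite (cop_cong h).
rewrite natr_sum mulrC; apply: ler_sum_const => a _; exact: hB.
Qed.

(** The pairs not covered by the cells have product in a thin annulus. *)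
Lemma rest_bound (d J I : nat) (M : R) (q c : O) : q != 0 -> (0 < d)%N -> 0 <= M ->
  M ^+ 2 <= (1 + d%:R^-1) ^+ (2 * J) -> M ^+ 2 < (2 ^ I)%:R ->
  `|Dp S R q c (rest S (1 + d%:R^-1) J M)| <=
  2 * ((size (ball S 1) * I)%:R * (2 * (4 * Num.sqrt (M ^+ 2 / (nrm q)%:R) + 1) *
     (Num.sqrt (4 * M ^+ 2 / d%:R / (nrm q)%:R) + 1))).
Proof.
move=> q0 d0 M0 MJ MI; set g := 1 + _; have dR : 0 < d%:R^-1 :> R by rewrite invr_gt0 ltr0n.
have g1 : 1 < g by rewrite ltrDl.
apply: Dp_count => // a; set l := rest S g J M.
pose P p := dv q (p.1 * p.2 - a).
pose prods := undup (map (fun p => p.1 * p.2) [seq p <- l | P p]).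
have inl p : p \in l -> [/\ prm p.1, prm p.2 & M ^+ 2 - 4 * M ^+ 2 / d%:R < (nrm (p.1 * p.2))%:R <= M ^+ 2].
  rewrite mem_filter => /andP[ng hp]; have [h1 h2] := pp_le M0 MJ hp.
  move: hp; rewrite mem_pp => /and3P[p1 p2 hM]; split=> //; rewrite hM andbT.
  have [_] := idx_cell g1 p1 h1; rewrite mem_cell => /and3P[_ l1 _].
  have [_] := idx_cell g1 p2 h2; rewrite mem_cell => /and3P[_ l2 _].
  move: ng l1 l2; rewrite /good -ltNge !exprM; set i := idx _ _ _ p.1; set j := idx _ _ _ p.2 => ng l1 l2.
  set G := g ^+ i * g ^+ j; have G0 : 0 < G by rewrite mulr_gt0 ?exprn_gt0// (lt_trans _ g1).
  have lG : G ^+ 2 < (nrm (p.1 * p.2))%:R.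
    rewrite nrmM natrM /G exprMn -!exprM ![(_ * 2)%N]mulnC !exprM.
    by apply: ltr_pM => //; rewrite exprn_ge0// sqr_ge0.
  have ng' : M < G * g ^+ 2 by move: ng; rewrite /G !exprS; congr (_ < _); ring.
  apply: le_lt_trans lG.
  have M2 : M ^+ 2 <= G ^+ 2 * g ^+ 4.
    have -> : G ^+ 2 * g ^+ 4 = (G * g ^+ 2) ^+ 2 by ring.
    by rewrite ler_pXn2r ?nnegrE ?(ltW ng')// mulr_ge0 ?sqr_ge0 ?ltW.
  have -> : M ^+ 2 - 4 * M ^+ 2 / d%:R = M ^+ 2 * (1 - 4 * d%:R^-1) by ring.
  have key : g ^+ 4 * (1 - 4 * d%:R^-1) <= 1.
    rewrite /g; move: dR; set x := d%:R^-1 => x0.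
    have -> : (1 + x) ^+ 4 * (1 - 4 * x) = 1 - x ^+ 2 * (10 + 20 * x + 15 * x ^+ 2 + 4 * x ^+ 3) by ring.
    by rewrite gerBl mulr_ge0 ?sqr_ge0// !addr_ge0 ?mulr_ge0 ?exprn_ge0 ?(ltW x0).
  have [neg|pos] := leP (1 - 4 * d%:R^-1 : R) 0.
    have h0 : M ^+ 2 * (1 - 4 * d%:R^-1) <= 0 by rewrite mulr_ge0_le0 ?sqr_ge0.
    exact: le_trans h0 (sqr_ge0 G).
  apply: (@le_trans _ _ (G ^+ 2 * g ^+ 4 * (1 - 4 * d%:R^-1))); first by rewrite ler_wpM2r ?(ltW pos).
  by rewrite -mulrA ler_piMr ?sqr_ge0.
have ul : uniq l by exact: filter_uniq (pp_uniq S _).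
clearbody l; have fib x : x \in prods -> (count (fun p => (p.1 * p.2)%R == x) [seq p <- l | P p] <= size (ball S 1) * I)%N.
  rewrite mem_undup => /mapP[p0]; rewrite mem_filter => /andP[_ p0l] ex.
  have [pr1 pr2 /andP[_ hM]] := inl p0 p0l.
  have x0 : x != 0 by rewrite ex mulO_neq0//; [case: (prmP pr1)|case: (prmP pr2)].
  have xI : (nrm x < 2 ^ I)%N by rewrite -(ltr_nat R) ex (le_lt_trans hM).
  rewrite -size_filter -(size_map fst).
  set lx := map fst _; have ulx : uniq lx.
    rewrite map_inj_in_uniq; first exact: filter_uniq (filter_uniq _ ul).
    move=> [u1 u2] [v1 v2].
    rewrite !mem_filter => /and3P[/eqP e1 _ hu] /and3P[/eqP e2 _ _] /= e; subst v1.
    congr (_, _); have [/= pu _ _] := inl _ hu.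
    have [u0 _ _] := prmP pu; apply: (mulOI S u0).
    by rewrite -[u1 * u2]/((u1, u2).1 * (u1, u2).2) e1 -e2.
  apply: leq_trans (count_prime_dvd x0 xI ulx).
  rewrite -size_filter; apply: uniq_leq_size => // z zl; rewrite mem_filter zl andbT.
  move: zl => /mapP[p]; rewrite !mem_filter => /and3P[/eqP e _ pl] ->.
  have [-> _ _] : [/\ prm p.1, prm p.2 & M ^+ 2 - 4 * M ^+ 2 / d%:R < (nrm (p.1 * p.2))%:R <= M ^+ 2].
    exact: inl pl.
  by rewrite -e dv_mulr ?dvxx.
have sz := size_fibres_le (f := fun p => p.1 * p.2) (s := [seq p <- l | P p]) (l := prods) _ fib.
rewrite -size_filter; apply: (@le_trans _ _ ((size prods * (size (ball S 1) * I))%N%:R)).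
  by rewrite ler_nat; apply: sz => p hp; rewrite mem_undup; apply/mapP; exists p.
rewrite natrM mulrC ler_wpM2l//.
rewrite -(size_map (fun x => quo (x - a) q)).
have prE x : x \in prods -> dv q (x - a) /\ M ^+ 2 - 4 * M ^+ 2 / d%:R < (nrm x)%:R <= M ^+ 2.
  rewrite mem_undup => /mapP[p]; rewrite mem_filter => /andP[hP pl] ->.
  by have [_ _ h] := inl p pl.
have qE x : x \in prods -> x = a + q * quo (x - a) q.
  by move=> /prE[h _]; rewrite mulrC -(quoP h); ring.
apply: (@annulus_count _ S R q a (M ^+ 2) (4 * M ^+ 2 / d%:R)) => //.
- exact: sqr_ge0.
- by rewrite divr_ge0// mulr_ge0 ?sqr_ge0.
- rewrite map_inj_in_uniq ?undup_uniq// => x y hx hy e.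
  by rewrite (qE x hx) (qE y hy) e.
- by move=> _ /mapP[x hx ->]; rewrite -(qE x hx); case: (prE x hx).
Qed.

End Boundary.

(** * Numerical form of the bilinear estimate *)

Section Numeric.
Variable R : realType.

Lemma expR_half : expR (1 / 2 : R) <= 2.
Proof.
have h := expR_ge1Dx (- (1 / 2) : R); rewrite expRN in h.
have e0 := expR_gt0 (1 / 2 : R).
have h2 : 1 / 2 <= (expR (1 / 2))^-1 :> R by lra.
by rewrite -(ler_pM2r e0) mulVf ?gt_eqF// in h2; lra.
Qed.

(** [exp (1/2) <= 2] is enough to compare powers of two with [N], and avoids numerical bounds on
    [e]. *)
Lemma expR_nat_half (n : nat) : expR (n%:R / 2 : R) <= (2 ^ n)%:R.
Proof.
rewrite (_ : n%:R / 2 = n%:R * (1 / 2)); last by rewrite mul1r.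
rewrite expRM_natl natrX; apply: lerXn2r; rewrite ?nnegrE ?expR_ge0//.
exact: expR_half.
Qed.

(** Powers of [L = log N] are negligible against [N ^ (1/4)]. *)
Lemma polylog_le (A : R) (a : nat) : exists L0, forall L, L0 <= L -> 1 <= L /\ A * L ^+ a <= expR (L / 4).
Proof.
pose c : R := (4 * a.+1%:R) ^+ a.+1.
have c0 : 0 < c by rewrite exprn_gt0// mulr_gt0 ?ltr0n.
exists (1 + `|A| * c) => L hL.
have A0 : 0 <= `|A| * c by rewrite mulr_ge0 ?(ltW c0).
have L1 : 1 <= L by lra.
split=> //; have L0 : 0 < L by lra.
have aR : 0 < a.+1%:R :> R by rewrite ltr0n.
apply: (@le_trans _ _ (`|A| * L ^+ a)).
  by rewrite ler_wpM2r ?exprn_ge0 ?ler_norm// ltW.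
apply: (@le_trans _ _ ((L / (4 * a.+1%:R)) ^+ a.+1)); last first.
  rewrite (_ : L / 4 = a.+1%:R * (L / (4 * a.+1%:R))); last by field; rewrite gt_eqF.
  rewrite expRM_natl; apply: lerXn2r; rewrite ?nnegrE ?expR_ge0//.
    by rewrite divr_ge0 ?mulr_ge0// ltW.
  by apply: le_trans (expR_ge1Dx _); rewrite lerDr.
rewrite expr_div_n -/c ler_pdivlMr// exprS mulrAC ler_wpM2r//.
  by rewrite exprn_ge0// ltW.
by lra.
Qed.

Lemma pow2_log (x : R) : 1 <= x -> exists i : nat, x <= (2 ^ i)%:R <= 2 * x.
Proof.
move=> x1; have x0 : 0 <= x by lra.
exists (trunc_log 2 (Num.truncn x)).+1.
have t0 : (0 < Num.truncn x)%N by rewrite truncn_gt0.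
have /andP[h1 h2] := trunc_log_bounds (isT : (1 < 2)%N) t0.
have /andP[h3 h4] := truncn_itv x0.
apply/andP; split.
  by apply: le_trans (ltW h4) _; rewrite ler_nat.
by rewrite expnS natrM ler_wpM2l//; apply: le_trans h3; rewrite ler_nat.
Qed.

End Numeric.

Section PairBig.
Variables (O : comNzRingType) (S : quad_pid O) (R : realType).
Implicit Types (q r u c : O).
Local Notation nrm := (nrm S).
Local Notation w := ((size (ball S 1))%:R : R).

Lemma cell_size (g : R) j : 1 <= g -> (size (cell S g j))%:R <= 160 * (g ^+ j.+1) ^+ 2.
Proof.
move=> g1; have x1 : 1 <= g ^+ j.+1 by apply: exprn_ege1.
set x := g ^+ j.+1 in x1 *; have x0 : 0 <= x by lra.
have hx : x ^+ 2 = g ^+ (2 * j.+1) by rewrite -exprM mulnC.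
apply: (@le_trans _ _ (size (ball S (Num.truncn (x ^+ 2))))%:R).
  rewrite ler_nat; apply: uniq_leq_size; first exact: filter_uniq (pr_uniq S _).
  by move=> y; rewrite mem_filter hx => /andP[_]; rewrite mem_filter => /andP[].
apply: le_trans (ball_size S R _) _; rewrite -natr1.
have /andP[h _] := truncn_itv (sqr_ge0 x).
by move: h; set t := _%:R; nra.
Qed.

Definition bigconst : R :=
  (200 ^+ 2) * ((128 * 100) + (320 * 100) * w + 35 * (64 ^+ 2 * (sieve_const S)%:R ^+ 2 * 169 * 4)).

(** The estimate for two long cells in terms of [L = log N]. Conductors up to [L ^ E] use
    [Delta], the discrepancy of the primes of the longer cell; above, each of the terms of
    the large sieve saves a factor [L ^ E], against the powers of [L] lost in the sums over
    dyadic blocks and over [1 / phi c]. *)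
Lemma pair_big (ka n i0 IQ i j : nat) (g N L C3 Delta : R) (E := (ka + 3)%N) :
  1 < g -> 1 <= L -> 0 <= N ->
  L ^+ E <= g ^+ i.+1 -> L ^+ E <= g ^+ j.+1 -> g ^+ i.+1 * g ^+ j.+1 <= N -> (i <= j)%N ->
  (n < 2 ^ IQ)%N -> (i0 <= IQ)%N -> IQ%:R <= 5 * L -> (2 ^ IQ)%:R * L ^+ E <= 4 * N ->
  L ^+ E <= (2 ^ i0)%:R <= 2 * L ^+ E ->
  0 <= Delta -> (g ^+ i.+1) ^+ 2 * Delta * L ^+ (ka + 2 * E + 2) <= C3 * N ^+ 2 -> 1 <= C3 ->
  L ^+ (ka + E + 3) <= N ->
  (forall r, r != 0 -> can r = r -> (nrm r < 2 ^ i0)%N -> forall u, cop u r -> `|D1 S R r u (cell S g j)| <= Delta) ->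
  exists F : O -> R, [/\ forall q, 0 <= F q,
    forall q, q \in cball S n -> forall c, cop c q -> `|Dp S R q c (prodl (cell S g i) (cell S g j))| <= F q &
    (\sum_(q <- cball S n) F q) * L ^+ ka <= bigconst * C3 * N ^+ 2].
Proof.
move=> g1 L1 N0 hx hy hxy ij nI i0I IQL IQN /andP[i0a i0b] D0 hD C31 LN hDelta.
set x := g ^+ i.+1 in hx hxy hD *; set y := g ^+ j.+1 in hy hxy *.
have g0 : 0 < g by lra.
have x1 : 1 <= x by apply: exprn_ege1; lra.
have y1 : 1 <= y by apply: exprn_ege1; lra.
have xy : x <= y by rewrite /x /y ler_eXn2l.
have Lp m : 1 <= L ^+ m by apply: exprn_ege1.
pose P z := (Num.truncn (z : R)).+1.
have PE z : 1 <= z -> z <= (P z)%:R <= 2 * z.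
  move=> z1; have z0 : 0 <= z by lra.
  have /andP[h1 h2] := truncn_itv z0; rewrite (ltW h2) /P -natr1 /=; lra.
have cellP (l : nat) : {in cell S g l, forall v, nrm v <= P (g ^+ l.+1) ^ 2}%N.
  move=> v; rewrite mem_cell => /and3P[_ _ h].
  have z1 : 1 <= g ^+ l.+1 by apply: exprn_ege1; lra.
  have /andP[p1 _] := PE _ z1; rewrite -(ler_nat R) natrX; apply: le_trans h _.
  by rewrite mulnC exprM lerXn2r// nnegrE; lra.
have cprm l : {in cell S g l, forall v, prm v} by move=> v; rewrite mem_cell => /and3P[].
have [F [F0 hF sF]] := large_pairs (cell_uniq S g i) (cell_uniq S g j) (@cprm j) (@cellP i) (@cellP j)
  nI i0I D0 hDelta.
exists F; split=> //.
apply: le_trans (ler_wpM2r _ sF) _; first by rewrite exprn_ge0//; lra.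
have /andP[_ Px] := PE _ x1; have /andP[_ Py] := PE _ y1.
have sx := @cell_size g i (ltW g1); have sy := @cell_size g j (ltW g1).
rewrite -/x in sx; rewrite -/y in sy.
set A := (size (cell S g i))%:R in sx *; set B := (size (cell S g j))%:R in sy *.
have A0 : 0 <= A by []. have B0 : 0 <= B by [].
have sqx (z s : R) : 0 <= z -> s <= 160 * z ^+ 2 -> Num.sqrt s <= 13 * z.
  move=> z0 hs; rewrite -[13 * z]ger0_norm ?mulr_ge0// -sqrtr_sqr ler_wsqrtr//.
  by apply: le_trans hs _; rewrite exprMn; have := sqr_ge0 z; lra.
have rx h := sqx x A h sx; have ry h := sqx y B h sy.
set K : R := (sieve_const S)%:R.
have K0 : 0 <= K by [].
have w0 : 0 <= w by [].
set LE := L ^+ E in hx hy IQN i0a i0b *.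
have LE1 : 1 <= LE by exact: Lp.
set Q2 : R := (2 ^ i0)%:R in i0a i0b *.
have x2N : x ^+ 2 <= N by apply: le_trans hxy; rewrite expr2 ler_wpM2l//; lra.
(* conductors below [2 ^ i0] *)
have S1 : 20 * Q2 * (A * (Q2 * Delta + (size (ball S 1) * IQ)%:R)) <=
    (128 * 100) * (LE ^+ 2 * (x ^+ 2 * Delta)) + (320 * 100) * w * (LE * L * N).
  have h1 : Q2 * Delta + (size (ball S 1) * IQ)%:R <= 2 * LE * Delta + w * (5 * L).
    by rewrite natrM lerD// ?ler_wpM2r// ler_wpM2l.
  have h2 : 0 <= Q2 * Delta + (size (ball S 1) * IQ)%:R by rewrite addr_ge0 ?mulr_ge0.
  have h3 : A * (Q2 * Delta + (size (ball S 1) * IQ)%:R) <= 160 * x ^+ 2 * (2 * LE * Delta + w * (5 * L)).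
    exact: ler_pM.
  apply: (@le_trans _ _ (20 * (2 * LE) * (160 * x ^+ 2 * (2 * LE * Delta + w * (5 * L))))).
    by apply: ler_pM => //; rewrite ?mulr_ge0// ler_wpM2l.
  rewrite [leLHS](_ : _ = (128 * 100) * (LE ^+ 2 * (x ^+ 2 * Delta)) + (320 * 100) * w * (LE * L * x ^+ 2)); last by ring.
  by rewrite lerD2l ler_wpM2l ?mulr_ge0// ler_wpM2l// mulr_ge0//; lra.
(* the dyadic blocks of larger conductors *)
have S2 : \sum_(i0 <= l < IQ) (2 ^ l)%:R^-1 *
         (64 * (sieve_const S * (2 ^ l.+1 + P x))%:R * Num.sqrt A *
         (64 * (sieve_const S * (2 ^ l.+1 + P y))%:R * Num.sqrt B)) * LE <=
    5 * L * (64 ^+ 2 * K ^+ 2 * 169 * 4 * (7 * N ^+ 2)).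
  apply: (@le_trans _ _ (\sum_(i0 <= l < IQ) 64 ^+ 2 * K ^+ 2 * 169 * 4 * (7 * N ^+ 2))); last first.
    rewrite sumr_const_nat -[leLHS]mulr_natl ler_wpM2r ?mulr_ge0 ?sqr_ge0//.
    by apply: le_trans IQL; rewrite ler_nat leq_subr.
  rewrite big_nat_cond [leRHS]big_nat_cond; apply: ler_sum => l /andP[/andP[l1 l2] _].
  set z : R := (2 ^ l)%:R; have z0 : 0 < z by rewrite ltr0n expn_gt0.
  have zQ : Q2 <= z by rewrite ler_nat leq_exp2l.
  have zI : 2 * z <= (2 ^ IQ)%:R by rewrite -natrM -expnS ler_nat leq_exp2l.
  have pz (v : R) (p : nat) (s : R) : 0 <= v -> p%:R <= 2 * v -> Num.sqrt s <= 13 * v ->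
      64 * (sieve_const S * (2 ^ l.+1 + p))%:R * Num.sqrt s <= 64 * (K * (2 * z + 2 * v)) * (13 * v).
    move=> v0 hp hs; apply: ler_pM => //; rewrite ?mulr_ge0 ?sqrtr_ge0//.
    by rewrite ler_wpM2l// natrM ler_wpM2l// natrD expnS natrM lerD2l.
  have x0 : 0 <= x by lra. have y0 : 0 <= y by lra.
  have h1 := pz x (P x) A x0 Px (rx x0); have h2 := pz y (P y) B y0 Py (ry y0).
  have N1 : 0 <= x * y by rewrite mulr_ge0.
  apply: (@le_trans _ _ (z^-1 * (64 * (K * (2 * z + 2 * x)) * (13 * x) * (64 * (K * (2 * z + 2 * y)) * (13 * y))) * LE)).
    rewrite ler_wpM2r//; first by lra.
    by rewrite ler_wpM2l ?invr_ge0 ?(ltW z0)// ler_pM// mulr_ge0 ?sqrtr_ge0 ?mulr_ge0.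
  rewrite [leLHS](_ : _ = 64 ^+ 2 * K ^+ 2 * 169 * 4 * (x * y * ((z + x + y + x * y / z) * LE))); last first.
    by field; rewrite gt_eqF.
  rewrite ler_wpM2l ?mulr_ge0 ?sqr_ge0//.
  have b1 : z * LE <= 2 * N.
    by rewrite -(ler_pM2l (ltr0n R 2)) mulrA (le_trans (ler_wpM2r _ zI))//; lra.
  have b2 : x * LE <= N by apply: le_trans hxy; rewrite ler_wpM2l.
  have b3 : y * LE <= N by apply: le_trans hxy; rewrite mulrC ler_wpM2r.
  have b4 : x * y / z * LE <= N.
    rewrite mulrAC ler_pdivrMr// ler_pM//; first by lra.
    exact: le_trans i0a zQ.
  have b5 : (z + x + y + x * y / z) * LE <= 7 * N by lra.
  rewrite [7 * _ ^+ 2](_ : _ = N * (7 * N)); last by ring.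
  apply: ler_pM => //; rewrite mulr_ge0//; last by lra.
  by rewrite addr_ge0 ?divr_ge0 ?addr_ge0// ltW.
have L0 : 0 < L by lra.
have eE : L ^+ ka * L ^+ 3 = LE by rewrite -exprD.
have IQ2 : (40 * IQ%:R) ^+ 2 <= (200 ^+ 2) * L ^+ 2 :> R.
  have -> : (200 ^+ 2) * L ^+ 2 = (40 * (5 * L)) ^+ 2 by ring.
  by rewrite lerXn2r// ?nnegrE ?mulr_ge0 ?ler_wpM2l//; lra.
have S10 : 0 <= 20 * Q2 * (A * (Q2 * Delta + (size (ball S 1) * IQ)%:R)) by rewrite !mulr_ge0 ?addr_ge0 ?mulr_ge0.
set T1 := 20 * Q2 * _ in S1 S10 *; set T2 := \sum_(i0 <= l < IQ) _.
have T20 : 0 <= T2.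
  by apply: sumr_ge0 => l _; rewrite mulr_ge0 ?invr_ge0// !mulr_ge0 ?sqrtr_ge0.
have T2b : T2 * LE <= 5 * L * (64 ^+ 2 * K ^+ 2 * 169 * 4 * (7 * N ^+ 2)) by rewrite mulr_suml.
have Lk0 : 0 <= L ^+ ka by rewrite exprn_ge0// ltW.
apply: (@le_trans _ _ ((200 ^+ 2) * L ^+ 2 * (T1 + T2) * L ^+ ka)).
  by rewrite ler_wpM2r// ler_wpM2r// addr_ge0.
have a1 : L ^+ 2 * L ^+ ka * T1 <= (128 * 100) * (C3 * N ^+ 2) + (320 * 100) * w * N ^+ 2.
  apply: le_trans (ler_wpM2l _ S1) _; first by rewrite mulr_ge0// exprn_ge0// ltW.
  rewrite mulrDr; apply: lerD.
    rewrite mulrCA ler_wpM2l//; apply: le_trans hD; rewrite le_eqVlt; apply/orP; left; apply/eqP.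
    rewrite mul2n -addnn /LE !exprD; ring.
  rewrite mulrCA ler_wpM2l ?mulr_ge0//.
  have -> : L ^+ 2 * L ^+ ka * (LE * L * N) = L ^+ (ka + E + 3) * N.
    by rewrite /LE !exprD; ring.
  by rewrite expr2 ler_wpM2r.
have a2 : L ^+ 2 * L ^+ ka * T2 <= 35 * (64 ^+ 2 * K ^+ 2 * 169 * 4) * N ^+ 2.
  rewrite -(ler_pM2r L0); apply: (@le_trans _ _ (T2 * LE)).
    by rewrite -eE le_eqVlt; apply/orP; left; apply/eqP; ring.
  apply: le_trans T2b _; rewrite le_eqVlt; apply/orP; left; apply/eqP; ring.
have c0 : 0 <= (320 * 100) * w * N ^+ 2 by rewrite !mulr_ge0 ?sqr_ge0.
have c1 : 0 <= 35 * (64 ^+ 2 * K ^+ 2 * 169 * 4) * N ^+ 2.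
  by rewrite mulr_ge0 ?sqr_ge0// mulr_ge0// mulr_ge0// mulr_ge0// mulr_ge0 ?sqr_ge0.
have c2 : (320 * 100) * w * N ^+ 2 <= C3 * ((320 * 100) * w * N ^+ 2) by rewrite ler_peMl.
have c3 : 35 * (64 ^+ 2 * K ^+ 2 * 169 * 4) * N ^+ 2 <= C3 * (35 * (64 ^+ 2 * K ^+ 2 * 169 * 4) * N ^+ 2) by rewrite ler_peMl.
rewrite [leLHS](_ : _ = (200 ^+ 2) * (L ^+ 2 * L ^+ ka * T1 + L ^+ 2 * L ^+ ka * T2)); last by ring.
rewrite /bigconst -/K [leRHS](_ : _ = (200 ^+ 2) * ((128 * 100) * (C3 * N ^+ 2) + C3 * ((320 * 100) * w * N ^+ 2) + C3 * (35 * (64 ^+ 2 * K ^+ 2 * 169 * 4) * N ^+ 2))); last by ring.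
by rewrite ler_wpM2l//; lra.
Qed.

End PairBig.

(** * Boundary terms and single cell pairs *)

Section Level.
Variables (O : comNzRingType) (S : quad_pid O) (R : realType).
Implicit Types (q r u c : O) (N M L : R).
Local Notation nrm := (nrm S).
Local Notation D1 := (D1 S R).
Local Notation Dp := (Dp S R).

(** Level of distribution one half up to logarithms, for a family of errors:
    the maxima are replaced by a common bound [e q]. *)
Definition level (err : R -> O -> O -> R) : Prop :=
  forall k : nat, exists (b : nat) (N0 C : R), 0 < C /\
    forall N, N0 <= N -> exists e : O -> R, [/\ forall q, 0 <= e q,
      forall q, q \in cball S (Num.truncn (N / ln N ^+ b)) ->
        forall M, 1 <= M <= N -> forall c, cop c q -> `|err M q c| <= e q &
      (\sum_(q <- cball S (Num.truncn (N / ln N ^+ b))) e q) * ln N ^+ k <= C * N ^+ 2].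

Definition err1 M q c : R := D1 q c (pr S (M ^+ 2)).
Definition err2 M q c : R := Dp q c (pp S (M ^+ 2)).

Lemma D1_cell_le (g : R) j q c (e N : R) : 1 < g -> g ^+ j.+1 <= N ->
  (forall M, 1 <= M <= N -> `|err1 M q c| <= e) -> `|D1 q c (cell S g j)| <= 2 * e.
Proof.
move=> g1 gN he; rewrite D1_cell//; apply: le_trans (ler_normB _ _) _.
have ge1 m : 1 <= g ^+ m by apply: exprn_ege1; exact: ltW.
rewrite mulr2n mulrDl mul1r; apply: lerD.
  by have := he (g ^+ j.+1); rewrite /err1 -exprM mulnC; apply; rewrite ge1.
have := he (g ^+ j); rewrite /err1 -exprM mulnC; apply; rewrite ge1/=.
by apply: le_trans gN; rewrite ler_eXn2l.
Qed.

Lemma cball_le (m n : nat) q : (m <= n)%N -> q \in cball S m -> q \in cball S n.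
Proof. by move=> mn; rewrite !mem_cball => /and3P[-> -> h]; exact: leq_trans h mn. Qed.

Lemma sum_cball_le (m n : nat) (e : O -> R) : (m <= n)%N -> (forall q, 0 <= e q) ->
  \sum_(q <- cball S m) e q <= \sum_(q <- cball S n) e q.
Proof.
by move=> mn e0; apply: ler_sum_subset; rewrite ?cball_uniq// => q; exact: cball_le.
Qed.

Definition bdconst : R := 400 * (size (ball S 1))%:R * (20 * 200 + 10 * 200).

(** Each modulus contributes about [N ^ 2 / (nrm q * sqrt d)] with [sqrt d >= L ^ (k + 2)]; the
    harmonic sum over [q] and the number of prime factors cost one power of [L] each. *)
Lemma boundary_sum (k d I n : nat) N L : 1 <= L -> 1 <= N -> L ^+ (2 * k + 4) <= d%:R ->
  (n < 2 ^ I)%N -> n%:R <= N -> I%:R <= 5 * L -> L ^+ (2 * k + 4) <= N ->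
  (\sum_(q <- cball S n) 2 * ((size (ball S 1) * I)%:R *
    (2 * (4 * Num.sqrt (N ^+ 2 / (nrm q)%:R) + 1) *
     (Num.sqrt (4 * N ^+ 2 / d%:R / (nrm q)%:R) + 1)))) * L ^+ k <= bdconst * N ^+ 2.
Proof.
move=> L1 N1 Ld nI nN IL LN.
have L0 : 0 <= L by lra. have N0 : 0 <= N by lra.
set w : R := (size (ball S 1))%:R; have w0 : 0 <= w by [].
have Lk m : 1 <= L ^+ m by apply: exprn_ege1.
have e4 : L ^+ (2 * k + 4) = (L ^+ (k + 2)) ^+ 2 by rewrite -exprM; congr (_ ^+ _); lia.
rewrite e4 in Ld LN; set X := L ^+ (k + 2) in Ld LN.
have X1 : 1 <= X by exact: Lk.
have d0 : 0 < d%:R :> R by apply: lt_le_trans Ld; rewrite exprn_gt0//; lra.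
pose B (q : O) : R := 2 * (w * (5 * L)) * ((20 * N ^+ 2 / X + 10 * N ^+ 2 / X) * (nrm q)%:R^-1).
apply: (@le_trans _ _ ((\sum_(q <- cball S n) B q) * L ^+ k)).
  rewrite ler_wpM2r//; first by have := Lk k; lra.
  rewrite big_seq [leRHS]big_seq; apply: ler_sum => q; rewrite mem_cball => /and3P[q0 _ qn].
  set v : R := (nrm q)%:R; have v0 : 0 < v by rewrite ltr0n nrm_gt0.
  have vN : v <= N by apply: le_trans nN; rewrite ler_nat.
  set u := Num.sqrt (N ^+ 2 / v).
  have u0 : 0 <= u by exact: sqrtr_ge0.
  have u2 : u ^+ 2 = N ^+ 2 / v by rewrite sqr_sqrtr// divr_ge0 ?sqr_ge0// ltW.
  have Xd : X <= Num.sqrt d%:R by rewrite -[X]ger0_norm ?(le_trans _ X1)// -sqrtr_sqr ler_wsqrtr.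
  have XN : X <= Num.sqrt N by rewrite -[X]ger0_norm ?(le_trans _ X1)// -sqrtr_sqr ler_wsqrtr.
  have sN : Num.sqrt N <= u.
    rewrite /u ler_wsqrtr// ler_pdivlMr// expr2; exact: ler_wpM2l.
  have Xu : X <= u by apply: le_trans sN.
  have s2 : Num.sqrt (4 * N ^+ 2 / d%:R / v) <= 2 * u / X.
    have -> : 4 * N ^+ 2 / d%:R / v = (2 * u) ^+ 2 / d%:R by rewrite exprMn u2; field; rewrite !gt_eqF.
    rewrite sqrtrM ?sqr_ge0// sqrtr_sqr ger0_norm ?mulr_ge0// sqrtrV ?ler0n//.
    apply: ler_wpM2l; first by rewrite mulr_ge0.
    by rewrite lef_pV2 ?posrE ?sqrtr_gt0//; lra.
  have X0 : 0 < X by lra.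
  rewrite natrM -/w /B mulrA.
  apply: ler_pM; rewrite ?mulr_ge0 ?addr_ge0 ?mulr_ge0 ?sqrtr_ge0//; first by do 2 (apply: ler_wpM2l => //).
  apply: (@le_trans _ _ (10 * u * (2 * u / X + u / X))).
    apply: ler_pM; rewrite ?mulr_ge0 ?addr_ge0 ?mulr_ge0 ?sqrtr_ge0//; first by lra.
    by apply: lerD => //; rewrite ler_pdivlMr// mul1r.
  rewrite [leLHS](_ : _ = 30 * (u ^+ 2) / X); last by ring.
  rewrite u2 le_eqVlt; apply/orP; left; apply/eqP; field; rewrite !gt_eqF//.
rewrite -mulr_sumr -mulr_sumr.
have hs : \sum_(q <- cball S n) (nrm q)%:R^-1 <= 40 * (5 * L).
  apply: (@le_trans _ _ (\sum_(q <- nzball S n) (nrm q)%:R^-1)).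
    apply: ler_sum_subset; rewrite ?cball_uniq ?nzball_uniq// => q.
    by rewrite mem_cball mem_nzball => /and3P[-> _ ->].
  by apply: le_trans (harmonic S R nI) _; rewrite ler_wpM2l.
have X0 : 0 < X by lra.
apply: (@le_trans _ _ (2 * (w * (5 * L)) * ((20 * N ^+ 2 / X + 10 * N ^+ 2 / X) * (40 * (5 * L))) * L ^+ k)).
  rewrite ler_wpM2r//; first by have := Lk k; lra.
  by rewrite ler_wpM2l ?mulr_ge0// ler_wpM2l// addr_ge0// divr_ge0 ?mulr_ge0 ?sqr_ge0// ltW.
have eX : X = L ^+ k * L ^+ 2 by rewrite /X exprD.
rewrite [leLHS](_ : _ = 10 * w * (30 * 200) * N ^+ 2 * (L ^+ k * L ^+ 2 / X)); last by ring.
rewrite -eX divff ?gt_eqF// mulr1 /bdconst -/w ler_wpM2r ?sqr_ge0//.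
by rewrite [leRHS](_ : _ = 10 * w * (30 * 200) * 40); last ring; rewrite ler_peMr ?mulr_ge0//; lra.
Qed.

Lemma good_le_cells (g : R) (J : nat) M N q c (E : nat -> nat -> R) (B : R) :
  1 < g -> 0 <= M -> M <= N -> M ^+ 2 <= g ^+ (2 * J) ->
  (forall i j, 0 <= E i j) ->
  (forall i j, good g N i j -> `|Dp q c (prodl (cell S g i) (cell S g j))| <= E i j) ->
  `|Dp q c (rest S g J M)| <= B ->
  `|err2 M q c| <= \sum_(i <- iota 0 J) \sum_(j <- iota 0 J | good g N i j) E i j + B.
Proof.
move=> g1 M0 MN MJ E0 hE hB; rewrite /err2 DpE (cells_sum _ g1 _ M0 MJ) -!DpE.
apply: le_trans (ler_normD _ _) _; apply: lerD; last exact: hB.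
apply: le_trans (ler_norm_sum _ _ _) _; apply: ler_sum => i _.
apply: le_trans (ler_norm_sum _ _ _) _.
rewrite big_mkcond [leRHS]big_mkcond; apply: ler_sum => j _.
case: (boolP (good g M i j)) => hg; last by case: ifP.
have hgN : good g N i j by exact: le_trans hg MN.
by rewrite hgN; exact: hE.
Qed.

(** Every prime of the short cell is fixed in turn; there are at most a power of [L] of them. *)
Lemma small_pair (ka i j n : nat) (g N L C1 : R) (e : O -> R) : 1 < g -> 0 <= L ->
  g ^+ i.+1 <= L ^+ (ka + 3) -> g ^+ j.+1 <= N -> (forall q, 0 <= e q) ->
  (forall q, q \in cball S n -> forall M, 1 <= M <= N -> forall c, cop c q -> `|err1 M q c| <= e q) ->
  (\sum_(q <- cball S n) e q) * L ^+ (ka + 2 * (ka + 3)) <= C1 * N ^+ 2 ->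
  exists F : O -> R, [/\ forall q, 0 <= F q,
    forall q, q \in cball S n -> forall c, cop c q -> `|Dp q c (prodl (cell S g i) (cell S g j))| <= F q &
    (\sum_(q <- cball S n) F q) * L ^+ ka <= 320 * C1 * N ^+ 2].
Proof.
move=> g1 L0 hx hy e0 he hS; set E := (ka + 3)%N in hx hS.
exists (fun q => 160 * (L ^+ E) ^+ 2 * (2 * e q)); split=> [q|q hq c cq|].
- by do ?[exact: sqr_ge0 | exact: e0 | exact: ler0n | apply: mulr_ge0].
- have hf : `|Dp q c (prodl (cell S g i) (cell S g j))| <= (size (cell S g i))%:R * (2 * e q).
    apply: Dp_fix cq _ _; first by rewrite mulr_ge0.
    by move=> c' c'q; apply: D1_cell_le hy _ => // M hM; exact: he.
  apply: le_trans hf _; rewrite ler_wpM2r ?mulr_ge0//; apply: le_trans (cell_size S i (ltW g1)) _.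
  by rewrite ler_wpM2l// lerXn2r ?nnegrE ?exprn_ge0//; lra.
- rewrite -mulr_sumr -mulr_sumr.
  rewrite [leLHS](_ : _ = 320 * ((\sum_(q <- cball S n) e q) * L ^+ (ka + 2 * E))).
    by rewrite -mulrA; apply: ler_wpM2l; first exact: ler0n.
  by rewrite exprD mulnC exprM; ring.
Qed.

Definition pairC (C1 C2 : R) (k2 : nat) : R :=
  320 * C1 + bigconst S R * (2 * C2 * 4 ^+ k2 + 321).

(** The larger cell has radius [y]. If [y >= T = N ^ (1/4)], its primes are equidistributed
    modulo small conductors; if [y < T], then both cells are so short that the trivial bound
    saves a power of [N]. *)
Lemma any_pair (ka n i0 IQ i j : nat) (g N L T C1 C2 : R) (e : O -> R)
    (E := (ka + 3)%N) (k2 := (ka + 2 * E + 2)%N) :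
  1 < g -> 1 <= L -> 1 <= T -> N = T ^+ 4 -> 0 <= C1 -> 0 <= C2 ->
  g ^+ i.+1 * g ^+ j.+1 <= N ->
  (n < 2 ^ IQ)%N -> (i0 <= IQ)%N -> IQ%:R <= 5 * L -> (2 ^ IQ)%:R * L ^+ E <= 4 * N ->
  L ^+ E <= (2 ^ i0)%:R <= 2 * L ^+ E -> L ^+ (ka + E + 3) <= N -> L ^+ k2 <= N ->
  (forall q, 0 <= e q) ->
  (forall q, q \in cball S n -> forall M, 1 <= M <= N -> forall c, cop c q -> `|err1 M q c| <= e q) ->
  (\sum_(q <- cball S n) e q) * L ^+ (ka + 2 * E) <= C1 * N ^+ 2 ->
  (forall y, T <= y <= N -> forall r, r \in cball S (Num.truncn (2 * L ^+ E)) ->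
     forall M, 1 <= M <= y -> forall c, cop c r -> `|err1 M r c| <= C2 * 4 ^+ k2 * y ^+ 2 / L ^+ k2) ->
  exists F : O -> R, [/\ forall q, 0 <= F q,
    forall q, q \in cball S n -> forall c, cop c q -> `|Dp q c (prodl (cell S g i) (cell S g j))| <= F q &
    (\sum_(q <- cball S n) F q) * L ^+ ka <= pairC C1 C2 k2 * N ^+ 2].
Proof.
move=> g1 L1 T1 NT C10 C20 + nI i0I IQL IQN hi0 LN Lk2 e0 he hS hy2.
have L0 : 0 <= L by lra.
have gp m : 1 <= g ^+ m by apply: exprn_ege1; lra.
have N1 : 1 <= N by rewrite NT; apply: exprn_ege1.
have cN : 0 <= bigconst S R.
  by rewrite /bigconst; do ?[exact: ler0n | apply: exprn_ge0 | apply: mulr_ge0 | apply: addr_ge0].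
have pC1 : 320 * C1 <= pairC C1 C2 k2.
  rewrite lerDl; apply: mulr_ge0; first exact: cN.
  apply: addr_ge0; last exact: ler0n.
  apply: mulr_ge0; last by apply: exprn_ge0; exact: ler0n.
  by apply: mulr_ge0; [exact: ler0n | exact: C20].
have fin (m : R) (F : O -> R) : m <= pairC C1 C2 k2 ->
    (\sum_(q <- cball S n) F q) * L ^+ ka <= m * N ^+ 2 ->
    (\sum_(q <- cball S n) F q) * L ^+ ka <= pairC C1 C2 k2 * N ^+ 2.
  by move=> hm h; apply: le_trans h _; rewrite ler_wpM2r ?sqr_ge0.
(* Swapping the two factors leaves the error unchanged, so the smaller cell comes first. *)
wlog ij : i j / (i <= j)%N.
  move=> W hxy; have [ij|/ltnW ji] := leqP i j; first exact: W.
  have [|F [F0 hF hs]] := W j i ji; first by rewrite mulrC.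
  by exists F; split=> // q hq c cq; rewrite Dp_sym; exact: hF.
move=> hxy; have xy : g ^+ i.+1 <= g ^+ j.+1 by rewrite ler_eXn2l.
have yN : g ^+ j.+1 <= N by apply: le_trans hxy; rewrite ler_peMl ?(le_trans _ (gp _)).
have [hx|hx] := leP (g ^+ i.+1) (L ^+ E).
  have [F [F0 hF hs]] := small_pair g1 L0 hx yN e0 he hS.
  by exists F; split=> //; exact: fin hs.
set x := g ^+ i.+1 in hx xy hxy; set y := g ^+ j.+1 in xy hxy yN.
have x1 : 1 <= x := gp _; have y1 : 1 <= y := gp _.
have Lp m : 0 < L ^+ m by apply: exprn_gt0; lra.
pose C3 : R := 2 * C2 * 4 ^+ k2 + 321.
have C40 : 0 <= C2 * 4 ^+ k2 by rewrite mulr_ge0 ?exprn_ge0.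
have C31 : 1 <= C3 by rewrite /C3 -mulrA; lra.
suff [D [D0 hD hDel]] : exists D : R, [/\ 0 <= D, x ^+ 2 * D * L ^+ k2 <= C3 * N ^+ 2 &
    forall r, r != 0 -> can r = r -> (nrm r < 2 ^ i0)%N -> forall u, cop u r -> `|D1 r u (cell S g j)| <= D].
  have [F [F0 hF hs]] := pair_big g1 L1 (le_trans ler01 N1) (ltW hx) (le_trans (ltW hx) xy) hxy ij nI i0I IQL IQN hi0 D0 hD C31 LN hDel.
  exists F; split; [exact: F0 | exact: hF |].
  by apply: fin hs; rewrite lerDr; apply: mulr_ge0; [exact: ler0n | exact: C10].
have [yT|yT] := leP T y.
  exists (2 * (C2 * 4 ^+ k2 * y ^+ 2 / L ^+ k2)); split.
  - apply: mulr_ge0 => //; apply: divr_ge0; last exact: ltW.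
    by apply: mulr_ge0 => //; exact: sqr_ge0.
  - rewrite [leLHS](_ : _ = 2 * (C2 * 4 ^+ k2) * (x * y) ^+ 2 * (L ^+ k2 / L ^+ k2)); last by ring.
    rewrite divff ?gt_eqF// mulr1; apply: ler_pM; [exact: mulr_ge0|exact: sqr_ge0| |].
      by rewrite /C3 -mulrA; lra.
    by apply: lerXn2r => //; rewrite nnegrE; [apply: mulr_ge0; lra | lra].
  - move=> r r0 cr hr u ur; apply: (D1_cell_le g1 (lexx y)) => M hM.
    apply: hy2 => //; first by rewrite yT.
    have E0 : 0 <= 2 * L ^+ E by rewrite mulr_ge0// ltW.
    rewrite mem_cball r0 cr eqxx /= truncn_ge_nat//.
    by case/andP: hi0 => _; apply: le_trans; rewrite ler_nat ltnW.
exists (320 * y ^+ 2); split; first by apply: mulr_ge0; [exact: ler0n | exact: sqr_ge0].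
- have h4 : x ^+ 2 * y ^+ 2 <= N.
    rewrite NT [leRHS](_ : _ = T ^+ 2 * T ^+ 2); last by ring.
    have h (z : R) : 1 <= z -> z <= T -> z ^+ 2 <= T ^+ 2 by move=> *; apply: lerXn2r; rewrite ?nnegrE; lra.
    by apply: ler_pM; rewrite ?sqr_ge0//; apply: h; lra.
  apply: (@le_trans _ _ (320 * (N * N))).
    rewrite [leLHS](_ : _ = 320 * (x ^+ 2 * y ^+ 2 * L ^+ k2)); last by ring.
    apply: ler_wpM2l; first exact: ler0n.
    apply: ler_pM; [by apply: mulr_ge0; exact: sqr_ge0 | exact: ltW | exact: h4 | exact: Lk2].
  by rewrite -expr2 ler_wpM2r ?sqr_ge0// /C3 -mulrA; lra.
- move=> r r0 _ _ u _; apply: le_trans (D1_trivial S _ _ _ r0) _.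
  rewrite [leRHS](_ : _ = 2 * (160 * y ^+ 2)); last by ring.
  by rewrite ler_wpM2l//; apply: cell_size; exact: ltW.
Qed.


End Level.

(** * Transfer of the level to products *)

Section LevelConv.
Variables (O : comNzRingType) (S : quad_pid O) (R : realType).
Implicit Types (q r u c : O) (N M L : R).
Local Notation nrm := (nrm S).
Local Notation D1 := (D1 S R).
Local Notation Dp := (Dp S R).
Local Notation err1 := (@err1 O S R).
Local Notation err2 := (@err2 O S R).

(** This bounds by [d * I] the number of steps [1 + 1 / d] needed to exceed [2 ^ I]. *)
Lemma bernoulli (d : nat) : (0 < d)%N -> 2 <= (1 + d%:R^-1 : R) ^+ d.
Proof.
move=> d0; have h : forall m, 1 + m%:R * d%:R^-1 <= (1 + d%:R^-1 : R) ^+ m.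
  have v0 : 0 <= d%:R^-1 :> R by rewrite invr_ge0.
  elim=> [|m IH]; first by rewrite mul0r addr0 expr0.
  rewrite exprS; apply: le_trans (_ : (1 + d%:R^-1) * (1 + m%:R * d%:R^-1) <= _); last first.
    by rewrite ler_wpM2l// addr_ge0.
  rewrite -natr1 mulrDl !mul1r mulrDr mulr1 mulrDl mul1r.
  have : 0 <= d%:R^-1 * (m%:R * d%:R^-1) :> R by rewrite !mulr_ge0.
  lra.
by have := h d; rewrite mulfV ?pnatr_eq0 -?lt0n.
Qed.

Lemma logN_le (b m : nat) (N L : R) : 1 <= L -> 0 <= N -> (b <= m)%N ->
  (Num.truncn (N / L ^+ m) <= Num.truncn (N / L ^+ b))%N.
Proof.
move=> L1 N0 bm; apply: le_truncn; rewrite ler_wpM2l// lef_pV2 ?posrE ?exprn_gt0//; try lra.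
by rewrite ler_weXn2l.
Qed.

(** A single modulus is bounded by the sum over all moduli, and [log y] is comparable with [L]:
    an averaged bound gives a bound of Siegel-Walfisz strength for each small modulus. *)
Lemma level_near (k b : nat) (C L y n : R) (e : O -> R) : 4 <= L -> L / 4 <= ln y <= L -> 0 < y ->
  0 < C -> 0 <= n -> n * L ^+ b <= y ->
  (forall q, 0 <= e q) ->
  (forall q, q \in cball S (Num.truncn (y / ln y ^+ b)) ->
        forall M, 1 <= M <= y -> forall c, cop c q -> `|err1 M q c| <= e q) ->
  (\sum_(q <- cball S (Num.truncn (y / ln y ^+ b))) e q) * ln y ^+ k <= C * y ^+ 2 ->
  forall r, r \in cball S (Num.truncn n) ->
     forall M, 1 <= M <= y -> forall c, cop c r -> `|err1 M r c| <= C * 4 ^+ k * y ^+ 2 / L ^+ k.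
Proof.
move=> L4 /andP[ly1 ly2] y0 C0 n0 nL e0 he hs r rn M hM c cr.
have l0 : 0 < ln y by lra.
have rb : r \in cball S (Num.truncn (y / ln y ^+ b)).
  apply: cball_le rn; apply: le_truncn; rewrite ler_pdivlMr ?exprn_gt0//.
  apply: le_trans nL; apply: ler_wpM2l => //; apply: lerXn2r => //; rewrite nnegrE; lra.
apply: le_trans (he r rb M hM c cr) _.
have L0 : 0 < L by lra.
rewrite ler_pdivlMr ?exprn_gt0//.
apply: (@le_trans _ _ (e r * (4 * ln y) ^+ k)).
  by rewrite ler_wpM2l// lerXn2r ?nnegrE; lra.
rewrite exprMn [leLHS](_ : _ = 4 ^+ k * (e r * ln y ^+ k)); last by ring.
rewrite [leRHS](_ : _ = 4 ^+ k * (C * y ^+ 2)); last by ring.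
rewrite ler_wpM2l ?exprn_ge0//; apply: le_trans hs; rewrite ler_wpM2r ?exprn_ge0 ?(ltW l0)//.
by rewrite (big_rem _ rb) /= lerDl sumr_ge0.
Qed.

(** The exponents are chosen backwards: [d] saves the leftover pairs, [ka] pays for the number
    of cell pairs, and the hypothesis is used at exponents [ka + 2 E] for the moduli
    themselves and [k2] for the small conductors. *)
Theorem level_conv : level S err1 -> level S err2.
Proof.
move=> H k; pose a := (2 * k + 4)%N; pose ka := (k + 2 * a + 2)%N; pose E := (ka + 3)%N.
pose k2 := (ka + 2 * E + 2)%N.
have [b1 [N1 [C1 [C10 H1]]]] := H (ka + 2 * E)%N.
have [b2 [N2 [C2 [C20 H2]]]] := H k2.
pose b := (E + b1)%N.
pose A := (a + k2 + ka + 2 * E + 3 + b1 + b2)%N.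
have hA1 : (b <= A)%N by rewrite /b /A; lia.
have hA2 : (E + b <= A)%N by rewrite /b /A; lia.
have hA3 : (ka + E + 3 <= A)%N by rewrite /A; lia.
have hA4 : (k2 <= A)%N by rewrite /A; lia.
have hA5 : (E + b2 <= A)%N by rewrite /A; lia.
have hA6 : (a <= A)%N by rewrite /A; lia.
have eka0 : (ka = a.+1 + a.+1 + k)%N by rewrite /ka; lia.
have [L0 hL0] := polylog_le (2 + `|N2|) A.
pose PC := pairC S C1 C2 k2.
have PC0 : 0 <= PC.
  have cN : 0 <= bigconst S R.
    by rewrite /bigconst; do ?[exact: ler0n | apply: exprn_ge0 | apply: mulr_ge0 | apply: addr_ge0].
  apply: addr_ge0; first by apply: mulr_ge0; [exact: ler0n | exact: ltW].
  apply: mulr_ge0; first exact: cN.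
  apply: addr_ge0; last exact: ler0n.
  apply: mulr_ge0; last by apply: exprn_ge0; exact: ler0n.
  by apply: mulr_ge0; [exact: ler0n | exact: ltW].
exists b, (Num.max N1 (expR (Num.max 4 L0))), (100 * PC + `|bdconst S R| + 1); split.
  by rewrite ltr_pwDr// addr_ge0// mulr_ge0.
move=> N; rewrite ge_max => /andP[hN1 hN].
have N0 : 0 < N by apply: lt_le_trans hN; exact: expR_gt0.
set L := ln N.
have NL : expR L = N by rewrite /L lnK ?posrE.
have : Num.max 4 L0 <= L by rewrite -ler_expR NL.
rewrite ge_max => /andP[L4 LL0].
have [L1 hA] := hL0 _ LL0.
set T := expR (L / 4) in hA.
have NT : N = T ^+ 4 by rewrite -NL -expRM_natl; congr expR; field.
have Lp m : 1 <= L ^+ m by apply: exprn_ege1.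
have T1 : 1 <= T by apply: le_trans hA; apply: mulr_ege1 => //; have := normr_ge0 N2; lra.
have TN2 : N2 <= T.
  apply: le_trans hA; apply: le_trans (ler_norm _) _; apply: le_trans (_ : 2 + `|N2| <= _); first lra.
  by rewrite ler_peMr//; have := normr_ge0 N2; lra.
have T2 m : (m <= A)%N -> 2 * L ^+ m <= T.
  move=> mA; apply: le_trans hA; apply: ler_pM => //; first by apply: le_trans (Lp m).
    by rewrite lerDl.
  by rewrite ler_weXn2l.
have TN : T <= N by rewrite NT exprS ler_peMr ?exprn_ege1//; lra.
have LT m : (m <= A)%N -> L ^+ m <= N.
  by move=> /T2 h; apply: le_trans TN; apply: le_trans h; have := Lp m; lra.
have N1' : 1 <= N by exact: le_trans T1 TN.
pose d := (Num.truncn (L ^+ a)).+1.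
have [d1 d2] : L ^+ a <= d%:R /\ d%:R <= 2 * L ^+ a.
  have h := Lp a; have /andP[h1 h2] := truncn_itv (le_trans ler01 h).
  by split; [exact: ltW | rewrite /d -natr1; lra].
pose I := (Num.truncn (4 * L)).+1.
have [I1 I2] : 4 * L <= I%:R /\ I%:R <= 5 * L.
  have h : 0 <= 4 * L by lra.
  have /andP[h1 h2] := truncn_itv h; split; first exact: ltW.
  by rewrite /I -natr1; lra.
have N2I : N ^+ 2 < (2 ^ I)%:R.
  have h : 0 <= 4 * L by lra.
  have /andP[_ h2] := truncn_itv h.
  apply: lt_le_trans (expR_nat_half R I); rewrite -NL -expRM_natl ltr_expR.
  by rewrite ltr_pdivlMr//; move: h2; rewrite -/I; lra.
pose g : R := 1 + d%:R^-1.
have g1 : 1 < g by rewrite ltrDl invr_gt0 ltr0n.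
pose J := (d * I)%N.
have gJ : N ^+ 2 <= g ^+ (2 * J).
  apply: le_trans (ltW N2I) _; rewrite natrX; apply: (@le_trans _ _ (g ^+ J)).
    rewrite /J exprM; apply: lerXn2r; rewrite ?nnegrE; [exact: ler0n | | exact: bernoulli].
    by apply: exprn_ge0; exact: le_trans ler01 (ltW g1).
  by rewrite ler_weXn2l ?(ltW g1)// leq_pmull.
pose n := Num.truncn (N / L ^+ b).
have Lb : 0 < L ^+ b by exact: lt_le_trans ltr01 (Lp b).
have nb0 : 1 <= N / L ^+ b by rewrite ler_pdivlMr// mul1r; exact: LT.
have /andP[nb1 nb2] := truncn_itv (le_trans ler01 nb0); rewrite -/n in nb1 nb2.
have n0 : (0 < n)%N by rewrite truncn_gt0.
have nN : n%:R <= N by apply: le_trans nb1 _; rewrite ler_pdivrMr// ler_peMr ?Lp// ltW.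
pose IQ := (trunc_log 2 n).+1.
have /andP[q1 q2] := trunc_log_bounds (isT : (1 < 2)%N) n0.
have q1R : (2 ^ IQ)%:R <= 2 * n%:R :> R by rewrite -natrM ler_nat expnS leq_mul2l.
have [i0 hi0] := pow2_log (Lp E).
have IQI : (IQ <= I)%N.
  rewrite -(ltn_exp2l _ _ (isT : (1 < 2)%N)) -(ltr_nat R).
  apply: le_lt_trans N2I; apply: (@le_trans _ _ n%:R); first by rewrite ler_nat.
  by apply: le_trans nN _; rewrite expr2 ler_peMr// ltW.
have IQL : IQ%:R <= 5 * L by apply: le_trans I2; rewrite ler_nat.
have i0I : (i0 <= IQ)%N.
  rewrite -(leq_exp2l _ _ (isT : (1 < 2)%N)) -(ler_nat R).
  case/andP: hi0 => _ h; apply: le_trans h _; apply: (@le_trans _ _ (n.+1)%:R); last by rewrite ler_nat.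
  apply: le_trans (ltW nb2); rewrite ler_pdivlMr// -mulrA -exprD.
  by exact: le_trans (T2 _ hA2) TN.
have IQN : (2 ^ IQ)%:R * L ^+ E <= 4 * N.
  apply: (@le_trans _ _ (2 * n%:R * L ^+ E)); first by rewrite ler_wpM2r// (le_trans _ (Lp E)).
  apply: (@le_trans _ _ (2 * (n%:R * L ^+ b))).
    by rewrite -mulrA ler_wpM2l// ler_wpM2l// /b ler_weXn2l// leq_addr.
  move: nb1; rewrite ler_pdivlMr// => h; apply: le_trans (ler_wpM2l (ler0n R 2) h) _.
  by apply: ler_wpM2r; [exact: ltW | rewrite ler_nat].
have [e [e0 he hs]] := H1 _ hN1; rewrite -/L in he hs.
have nb : (n <= Num.truncn (N / L ^+ b1))%N by apply: logN_le; rewrite ?(ltW N0)// /b leq_addl.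
have he' q : q \in cball S n -> forall M, 1 <= M <= N -> forall c, cop c q -> `|err1 M q c| <= e q.
  by move=> hq; apply: he; exact: cball_le hq.
have hs' : (\sum_(q <- cball S n) e q) * L ^+ (ka + 2 * E) <= C1 * N ^+ 2.
  by apply: le_trans hs; rewrite ler_wpM2r ?sum_cball_le// (le_trans _ (Lp _)).
have hy2 y : T <= y <= N -> forall r, r \in cball S (Num.truncn (2 * L ^+ E)) ->
     forall M, 1 <= M <= y -> forall c, cop c r -> `|err1 M r c| <= C2 * 4 ^+ k2 * y ^+ 2 / L ^+ k2.
  move=> /andP[Ty yN]; have y0 : 0 < y by exact: lt_le_trans (lt_le_trans ltr01 T1) Ty.
  have [e2 [e20 he2 hs2]] := H2 y (le_trans TN2 Ty).
  apply: (level_near L4 _ y0 C20 _ _ e20 he2 hs2).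
  - by rewrite -ler_expR -[X in _ && X]ler_expR lnK ?posrE// NL Ty.
  - by apply: mulr_ge0; [exact: ler0n | apply: le_trans (Lp E)].
  - by apply: le_trans Ty; rewrite -mulrA -exprD; exact: T2.
have hP i j : exists F : O -> R, (forall q, 0 <= F q) /\ (good g N i j ->
    (forall q, q \in cball S n -> forall c, cop c q -> `|Dp q c (prodl (cell S g i) (cell S g j))| <= F q) /\
    (\sum_(q <- cball S n) F q) * L ^+ ka <= PC * N ^+ 2).
  have [hg|hg] := boolP (good g N i j); last by exists (fun=> 0).
  have [F [F0 hF hsF]] := any_pair g1 L1 T1 NT (ltW C10) (ltW C20) hg q2 i0I IQL IQN hi0 (LT _ hA3) (LT _ hA4) e0 he' hs' hy2.
  by exists F.
have {hP} [F hF] : exists F : nat * nat -> O -> R, forall p, (forall q, 0 <= F p q) /\ (good g N p.1 p.2 ->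
    (forall q, q \in cball S n -> forall c, cop c q -> `|Dp q c (prodl (cell S g p.1) (cell S g p.2))| <= F p q) /\
    (\sum_(q <- cball S n) F p q) * L ^+ ka <= PC * N ^+ 2).
  by have [F hF] := boolp.choice (fun p : nat * nat => hP p.1 p.2); exists F.
pose bd q : R := 2 * ((size (ball S 1) * I)%:R *
    (2 * (4 * Num.sqrt (N ^+ 2 / (nrm q)%:R) + 1) *
     (Num.sqrt (4 * N ^+ 2 / d%:R / (nrm q)%:R) + 1))).
have bd0 q : 0 <= bd q.
  by rewrite /bd; do ?[exact: ler0n | exact: ler01 | exact: sqrtr_ge0 | apply: addr_ge0 | apply: mulr_ge0].
exists (fun q => \sum_(i <- iota 0 J) \sum_(j <- iota 0 J | good g N i j) F (i, j) q + bd q); split.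
- move=> q; rewrite addr_ge0// sumr_ge0// => i _; rewrite sumr_ge0// => j _.
  by case: (hF (i, j)).
- move=> q hq M /andP[M1 MN] c cq.
  have q0 : q != 0 by move: hq; rewrite mem_cball => /and3P[].
  have M0 : 0 <= M by exact: le_trans ler01 M1.
  have MN2 : M ^+ 2 <= N ^+ 2 by rewrite lerXn2r ?nnegrE// ltW.
  apply: (good_le_cells (J := J) g1 M0 MN (le_trans MN2 gJ) (E := fun i j => F (i, j) q)).
  + by move=> i j; case: (hF (i, j)).
  + by move=> i j hg; have [_ /(_ hg)[h _]] := hF (i, j); exact: h.
  + apply: le_trans (rest_bound S c (I := I) q0 _ M0 (le_trans MN2 gJ) (le_lt_trans MN2 N2I)) _; first exact: ltn0Sn.
    have iv (x : nat) : 0 <= x%:R^-1 :> R by rewrite invr_ge0.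
    apply: ler_wpM2l; first exact: ler0n.
    apply: ler_wpM2l; first exact: ler0n.
    apply: ler_pM; do ?[exact: ler0n | exact: ler01 | exact: sqrtr_ge0 | apply: addr_ge0 | apply: mulr_ge0].
      apply: ler_wpM2l; first exact: ler0n.
      apply: lerD; last exact: lexx.
      apply: ler_wpM2l; first exact: ler0n.
      by apply: ler_wsqrtr; apply: ler_wpM2r; [exact: iv | exact: MN2].
    apply: lerD; last exact: lexx.
    apply: ler_wsqrtr; apply: ler_wpM2r; first exact: iv.
    apply: ler_wpM2r; first exact: iv.
    by apply: ler_wpM2l; [exact: ler0n | exact: MN2].
- rewrite big_split /= mulrDl -/L.
  have hbd : (\sum_(q <- cball S n) bd q) * L ^+ k <= bdconst S R * N ^+ 2.
    apply: (boundary_sum S L1 N1' d1 _ nN I2 (LT _ hA6)).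
    by rewrite -(ltr_nat R); apply: le_lt_trans N2I; apply: le_trans nN _; rewrite expr2 ler_peMr// ltW.
  have hp : (\sum_(q <- cball S n) \sum_(i <- iota 0 J) \sum_(j <- iota 0 J | good g N i j) F (i, j) q) * L ^+ k <= 100 * PC * N ^+ 2.
    have Lka : 0 < L ^+ ka by exact: lt_le_trans ltr01 (Lp ka).
    pose B := PC * N ^+ 2 / L ^+ ka.
    have B0 : 0 <= B by rewrite divr_ge0 ?mulr_ge0 ?sqr_ge0// ltW.
    have h1 : \sum_(q <- cball S n) \sum_(i <- iota 0 J) \sum_(j <- iota 0 J | good g N i j) F (i, j) q <= J%:R * (J%:R * B).
      have sJ (f : nat -> R) Y : (forall i, f i <= Y) -> \sum_(i <- iota 0 J) f i <= J%:R * Y.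
        by move=> hf; rewrite -[in leRHS](size_iota 0 J); apply: ler_sum_const => i _; exact: hf.
      rewrite exchange_big; apply: (sJ) => i.
      rewrite exchange_big big_mkcond; apply: (sJ) => j.
      case: ifP => // hg; rewrite /B ler_pdivlMr//.
      by have [_ /(_ hg)[_ h]] := hF (i, j).
    apply: (@le_trans _ _ (J%:R * (J%:R * B) * L ^+ k)); first by rewrite ler_wpM2r// (le_trans _ (Lp k)).
    have hJ : J%:R <= 10 * L ^+ a.+1.
      rewrite /J natrM exprSr [leRHS](_ : _ = (2 * L ^+ a) * (5 * L)); last by ring.
      exact: ler_pM.
    apply: (@le_trans _ _ ((10 * L ^+ a.+1) * ((10 * L ^+ a.+1) * B) * L ^+ k)).
      apply: ler_wpM2r; first exact: le_trans ler01 (Lp k).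
      by apply: ler_pM; [exact: ler0n | apply: mulr_ge0 | exact: hJ | apply: ler_wpM2r].
    have eka : L ^+ ka = L ^+ a.+1 * L ^+ a.+1 * L ^+ k by rewrite -!exprD -eka0.
    rewrite [leLHS](_ : _ = 100 * (PC * N ^+ 2 / L ^+ ka * (L ^+ a.+1 * L ^+ a.+1 * L ^+ k))); last by rewrite /B; ring.
    by rewrite -eka divfK ?gt_eqF// mulrA.
  have hb : bdconst S R * N ^+ 2 <= `|bdconst S R| * N ^+ 2 by rewrite ler_wpM2r ?sqr_ge0// ler_norm.
  have N20 : 0 <= N ^+ 2 by rewrite sqr_ge0.
  apply: le_trans (lerD hp (le_trans hbd hb)) _.
  by rewrite -mulrDl; apply: ler_wpM2r => //; rewrite lerDl.
Qed.

End LevelConv.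

(** * Quadratic fields *)

Section Quadratic.
Variable K : fieldExtType rat.
Variable e : {rmorphism rat -> K}.

Lemma ratmorphE (c : rat) : e c = c%:A.
Proof. by rewrite -[RHS]in_algE !fmorph_eq_rat. Qed.

(** Completing the square in the quadratic equation of any irrational element. *)
Lemma quadratic_generator : \dim {:K} = 2%N -> exists (th : K) (d : rat),
  th ^+ 2 = e d /\ (forall x, exists a b : rat, x = e a + e b * th) /\ th \notin 1%VS.
Proof.
move=> dK; have : ~~ ({:K} <= 1)%VS.
  by apply/negP => /dimvS; rewrite dK dimv1.
case/subvPn => y _ y1.
have f2 : free [:: y; 1] by rewrite free_cons span_seq1 y1 seq1_free oner_neq0.
have b2 : basis_of fullv [:: y; 1] by rewrite basisEfree f2 subvf /= dK.
have co x : exists p q : rat, x = e p * y + e q.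
  have : x \in span (in_tuple [:: y; 1]) by rewrite (span_basis b2) memvf.
  move/coord_span; rewrite !big_ord_recl big_ord0 addr0 /= => ->.
  by do 2 eexists; rewrite !ratmorphE mulr_algl.
have [p [q y2]] := co (y ^+ 2).
have e2 : e (1 / 2) * 2 = 1.
  by rewrite -(rmorph_nat e 2) -rmorphM -[RHS](rmorph1 e); congr (e _).
exists (y - e (p / 2)), (q + (p / 2) ^+ 2); split; [|split].
- rewrite sqrrB y2 rmorphD rmorphXn /= -mulr_natr.
  have -> : p / 2 = p * (1 / 2) by rewrite mul1r.
  rewrite rmorphM; set P := e p; set h := e (1 / 2).
  have eh : h * 2 = 1 := e2.
  have -> : y * (P * h) * 2 = P * y * (h * 2) by ring.
  by rewrite eh mulr1; ring.
- move=> x; have [p' [q' ->]] := co x; exists (q' + p' * (p / 2)), p'.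
  by rewrite rmorphD rmorphM /=; ring.
- by apply: contra y1 => h; rewrite -(subrK (e (p / 2)) y) rpredD// ratmorphE rpredZ// mem1v.
Qed.

(** A rational number is embedded in the algebraic complex numbers, where rational algebraic
    integers are known to be integers. *)
Lemma rat_integral (c : rat) : e c \in algint K -> exists n : int, c = n%:~R.
Proof.
case/asboolP => p pm pr.
have eint : intr =1 e \o (intr : int -> rat) by move=> z /=; rewrite rmorph_int.
have pr' : root (map_poly (intr : int -> rat) p) c.
  by move: pr; rewrite (eq_map_poly eint) map_poly_comp fmorph_root.
have : (ratr c : algC) \in Aint.
  apply: (@root_monic_Aint (map_poly intr p)).
  - rewrite (_ : map_poly _ _ = map_poly ratr (map_poly (intr : int -> rat) p)) ?fmorph_root//.
    by rewrite -map_poly_comp; apply: eq_map_poly => z /=; rewrite ratr_int.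
  - exact: monic_map.
  - by apply/polyOverP => i; rewrite coef_map; exact: intr_int.
move/(Cint_rat_Aint (Crat_rat c)) => /intrP[n hn]; exists n.
by apply: (fmorph_inj (ratr : {rmorphism rat -> algC})); rewrite /= hn ratr_int.
Qed.

Section Generator.
Variables (th : K) (d : rat).
Hypothesis thd : th ^+ 2 = e d.
Hypothesis gen : forall x, exists a b : rat, x = e a + e b * th.
Hypothesis th1 : th \notin 1%VS.

Lemma gen_free (a b : rat) : e a + e b * th = 0 -> a = 0 /\ b = 0.
Proof.
move=> h; have [b0|b0] := eqVneq b 0.
  by move: h; rewrite b0 rmorph0 mul0r addr0 => /eqP; rewrite fmorph_eq0 => /eqP.
case/negP: th1; have -> : th = e (- a / b).
  have eb : e b != 0 by rewrite fmorph_eq0.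
  apply: (mulfI eb); rewrite -rmorphM mulrCA divff// mulr1 rmorphN /=.
  by apply/eqP; rewrite -addr_eq0 addrC; apply/eqP.
by rewrite ratmorphE rpredZ// mem1v.
Qed.

(** With [L = K] and [s = - th] this is the conjugation, with [L] the complex numbers an
    embedding. *)
Lemma quad_morphism (L : fieldType) (io : {rmorphism rat -> L}) (s : L) : s ^+ 2 = io d ->
  exists f : {rmorphism K -> L}, forall a b : rat, f (e a + e b * th) = io a + io b * s.
Proof.
move=> sd.
have [AB hAB] := boolp.choice (fun x => let: ex_intro a (ex_intro b h) := gen x in
   ex_intro (fun p : rat * rat => x = e p.1 + e p.2 * th) (a, b) h).
have abE (a b : rat) : AB (e a + e b * th) = (a, b).
  have /esym := hAB (e a + e b * th); case: (AB _) => a' b' /= h.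
  have [] := @gen_free (a' - a) (b' - b).
    by move: h => /eqP; rewrite -subr_eq0 => /eqP h; rewrite !rmorphB -[RHS]h /=; ring.
  by move=> /eqP; rewrite subr_eq0 => /eqP-> /eqP; rewrite subr_eq0 => /eqP->.
pose f x := io (AB x).1 + io (AB x).2 * s.
have fE (a b : rat) : f (e a + e b * th) = io a + io b * s by rewrite /f abE.
have fB : zmod_morphism f.
  move=> x y; have [a [b ->]] := gen x; have [a' [b' ->]] := gen y.
  rewrite (_ : _ - _ = e (a - a') + e (b - b') * th); last by rewrite !rmorphB /=; ring.
  by rewrite !fE !rmorphB /=; ring.
have fM : monoid_morphism f.
  split; first by rewrite (_ : 1 = e 1 + e 0 * th) ?fE ?rmorph1 ?rmorph0 ?mul0r ?addr0.
  move=> x y; have [a [b ->]] := gen x; have [a' [b' ->]] := gen y.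
  rewrite (_ : _ * _ = e (a * a' + b * b' * d) + e (a * b' + b * a') * th); last first.
    by rewrite !(rmorphD, rmorphM) /= -thd; ring.
  by rewrite !fE !(rmorphD, rmorphM) /= -sd; ring.
pose fA := GRing.isZmodMorphism.Build K L f fB.
pose fR := GRing.isMonoidMorphism.Build K L f fM.
by exists (HB.pack f fA fR : {rmorphism K -> L}).
Qed.

(** The trace and the norm of an integral element are rational and integral. *)
Lemma integral_data (a b : rat) : e a + e b * th \in algint K ->
  exists T N : int, 2 * a = T%:~R /\ a ^+ 2 - d * b ^+ 2 = N%:~R.
Proof.
have [tau htau] := @quad_morphism _ e (- th) (etrans (sqrrN th) thd).
move=> hx; have hy : e a - e b * th \in algint K.
  have -> : e a - e b * th = tau (e a + e b * th) by rewrite htau mulrN.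
  apply/asboolP; move/asboolP: hx => /(integral_rmorph tau).
  case=> p pm pr; exists p => //; move: pr; congr (is_true (root _ _)).
  by apply: eq_map_poly => z /=; rewrite rmorph_int.
have [T hT] : exists n : int, 2 * a = n%:~R.
  apply: rat_integral.
  rewrite (_ : e (2 * a) = (e a + e b * th) + (e a - e b * th)); first exact: rpredD.
  by rewrite rmorphM rmorph_nat /=; ring.
have [N hN] : exists n : int, a ^+ 2 - d * b ^+ 2 = n%:~R.
  apply: rat_integral.
  rewrite (_ : e (a ^+ 2 - d * b ^+ 2) = (e a + e b * th) * (e a - e b * th)); first exact: rpredM.
  by rewrite rmorphB rmorphXn rmorphM rmorphXn -thd; ring.
by exists T, N.
Qed.

Hypothesis dneg : d < 0.

(** Take an integral element with the smallest nonzero [th]-coordinate in absolute value; its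
    discriminant [- 4 d b ^ 2] is a positive integer, so a minimum exists. Subtracting from
    another element the nearest integral multiple would produce a smaller one unless the
    difference is rational. *)
Lemma minimal_integer : exists (a0 b0 : rat), [/\ e a0 + e b0 * th \in algint K, b0 != 0 &
  forall a b : rat, e a + e b * th \in algint K ->
    exists m n : int, e a + e b * th = m%:~R + n%:~R * (e a0 + e b0 * th)].
Proof.
pose P (n : nat) := `[< exists a b : rat, [/\ e a + e b * th \in algint K, b != 0 & - 4 * d * b ^+ 2 = n%:R] >].
have disc (a b : rat) : e a + e b * th \in algint K -> exists n : nat, - 4 * d * b ^+ 2 = n%:R.
  move=> h; have [T [N [hT hN]]] := integral_data h.
  have hz : - 4 * d * b ^+ 2 = (4 * N - T ^+ 2)%:~R.
    by rewrite intrB intrM rmorphXn /= -hT -hN; ring.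
  have : 0 <= 4 * N - T ^+ 2.
    by rewrite -(ler0z rat) -hz mulr_ge0 ?sqr_ge0// mulr_le0 ?ltW.
  by case: (4 * N - T ^+ 2) hz => // n -> _; exists n.
have [n0 Pn0] : exists n, P n.
  have hb : e 0 + e (denq d)%:~R * th \in algint K.
    rewrite rmorph0 add0r; apply/asboolP; exists ('X^2 - (numq d * denq d)%:P).
      exact: monicXnsubC.
    rewrite rmorphB /= map_polyXn map_polyC /root !hornerE /=.
    rewrite exprMn thd -rmorphXn -rmorphM subr_eq0 -(rmorph_int e) /=; apply/eqP; congr (e _).
    by rewrite rmorphM /= -{2}(divq_num_den d); field; rewrite intr_eq0 denq_neq0.
  have [n hn] := disc _ _ hb; exists n; apply/asboolP.
  by exists 0, (denq d)%:~R; split=> //; rewrite intr_eq0 denq_neq0.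
case: (ex_minnP (ex_intro _ n0 Pn0)) => {Pn0} m /asboolP[a0 [b0 [h0 b00 hm]]] mmin.
exists a0, b0; split=> // a b h.
pose v := b / b0; pose n := Num.floor (v + 1 / 2).
have vb : b = v * b0 by rewrite divfK.
have [v1 v2] : - (1 / 2) <= v - n%:~R /\ v - n%:~R <= 1 / 2.
  have /andP[h1 h2] := floor_itv (v + 1 / 2); move: h2; rewrite -/n in h1 *.
  by rewrite intrD mulr1z; split; lra.
have h' : e (a - n%:~R * a0) + e (b - n%:~R * b0) * th \in algint K.
  rewrite (_ : _ + _ = (e a + e b * th) - n%:~R * (e a0 + e b0 * th)).
    by rewrite rpredB// rpredM// rpred_int.
  by rewrite !(rmorphB, rmorphM) !(rmorph_int e) /=; ring.
have bn : b - n%:~R * b0 = 0.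
  apply/eqP; apply: contraT => bn; have [k hk] := disc _ _ h'.
  have /mmin : P k by apply/asboolP; exists (a - n%:~R * a0), (b - n%:~R * b0).
  rewrite leqNgt => /negP[]; rewrite -(ltr_nat rat) -hk -hm {1}vb -mulrBl exprMn.
  have -> : - 4 * d * ((v - n%:~R) ^+ 2 * b0 ^+ 2) = (v - n%:~R) ^+ 2 * (- 4 * d * b0 ^+ 2) by ring.
  rewrite gtr_pMl; first by nra.
  apply: mulr_gt0; last by rewrite exprn_even_gt0.
  have := dneg; lra.
move: h'; rewrite bn rmorph0 mul0r addr0 => /rat_integral[k hk].
exists k, n; have -> : a = k%:~R + n%:~R * a0 by rewrite -hk; ring.
have -> : b = n%:~R * b0 by apply/eqP; rewrite -subr_eq0 bn.
by rewrite !(rmorphD, rmorphM) !(rmorph_int e) /=; ring.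
Qed.

End Generator.
End Quadratic.

(** * Rings of integers of class number one *)

Section RingOfIntegers.
Variables (R : realType) (K : fieldExtType rat).
Local Notation O := (ring_of_integers K).

Lemma integers_domain (a b c : O) : a != 0 -> a * b = a * c -> b = c.
Proof.
move=> a0 /(congr1 val); rewrite !rmorphM => h; apply: val_inj; apply: mulfI h.
by apply: contra a0 => /eqP h; apply/eqP; apply: val_inj; rewrite h rmorph0.
Qed.

(** A nonzero ideal is in the class of the unit ideal: [a O = b I], and a quotient of [a] by [b]
    generates [I]. *)
Lemma class_number_one_principal : class_number O = 1%N ->
  forall I : set O, is_ideal I -> exists w, I = principal w.
Proof.
move=> h I [I0 Iadd]; have [I1|I1] := pselect (I = [set 0]%classic).
  exists 0; rewrite I1; apply/seteqP; split=> x /=; first by move=> ->; exists 0; rewrite ?mul0r.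
  by case=> a _ <-; rewrite mulr0.
pose cl (J : set O) : set (set O) := [set J' | nz_ideal J' /\ same_class J J']%classic.
move: h; rewrite /class_number; set A := (X in fset_set X) => /eqP/cardfs1P[c hc].
have fA : finite_set A.
  by apply: contrapT => nf; move: hc; rewrite /fset_set; case: pselect => // _ /fsetP/(_ c); rewrite !inE eqxx.
have clA J : nz_ideal J -> cl J = c.
  move=> hJ; have : A (cl J) by exists J.
  by rewrite -(fset_setK fA) hc /= inE => /eqP.
have one0 : (1 : O) != 0 by exact: oner_neq0.
have nzI : nz_ideal I by split.
have nzT : nz_ideal [set: O]%classic.
  split; first by split.
  by move=> /seteqP[/(_ 1 Logic.I) /= /eqP]; rewrite (negbTE one0).
have : cl [set: O]%classic I.
  rewrite (clA _ nzT) -(clA _ nzI); split=> //; exists 1, 1; split=> //.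
case=> _ [a [b [a0 b0 hab]]].
have [y Iy hy] : exists2 y, I y & b * y = a.
  have : [set a * x | x in [set: O]]%classic a by exists 1; rewrite ?mulr1.
  by rewrite hab => -[y Iy <-]; exists y.
exists y; apply/seteqP; split=> x /=; last first.
  by case=> z _ <-; have := Iadd z y 0 Iy I0; rewrite addr0.
move=> Ix; have : [set b * y | y in I]%classic (b * x) by exists x.
rewrite -hab => -[z _ hz]; exists z => //; apply: (integers_domain b0).
by rewrite -hz -hy; ring.
Qed.

(** A positive [d] would give an embedding with real image. *)
Lemma imaginary_square (e : {rmorphism rat -> K}) (th : K) (d : rat) : imaginary_quadratic R K -> th ^+ 2 = e d ->
  (forall x, exists a b : rat, x = e a + e b * th) -> th \notin 1%VS ->
  d < 0 /\ exists sigma : {rmorphism K -> R[i]}, True.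
Proof.
move=> [_ im] thd gen th1.
have sd : sqrtC (ratr d : R[i]) ^+ 2 = ratr d by rewrite sqrtCK.
have [s hs] := quad_morphism thd gen th1 (L := R[i]) (io := ratr) sd.
split; last by exists s.
rewrite ltNge; apply/negP => d0; have [x] := im s.
case: (gen x) => a [b ->]; rewrite hs => /negP[].
have rr (c : rat) : (ratr c : R[i]) \is Num.real by rewrite rpred_rat.
apply: rpredD; first exact: rr.
by apply: rpredM; [exact: rr | apply: ger0_real; rewrite sqrtC_ge0 ler0q].
Qed.

(** [th] goes to a purely imaginary number, hence complex conjugation is the conjugation of the
    field, under every embedding. *)
Lemma quadratic_abs (e : {rmorphism rat -> K}) (th : K) (d a b : rat) (s : {rmorphism K -> R[i]}) : th ^+ 2 = e d -> d < 0 ->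
  `|s (e a + e b * th)| ^+ 2 = ratr (a ^+ 2 - d * b ^+ 2).
Proof.
move=> thd d0; have se (c : rat) : s (e c) = ratr c.
  by rewrite -[LHS]/((s \o e) c) fmorph_eq_rat.
set z := s th; have z2 : z ^+ 2 = ratr d by rewrite /z -rmorphXn thd se.
have cr (c : rat) : (ratr c : R[i])^* = ratr c.
  by apply/CrealP; rewrite rpred_rat.
have cz : z^* = - z.
  have : (z^*) ^+ 2 = z ^+ 2 by rewrite -rmorphXn z2; exact: cr.
  move/eqP; rewrite eqf_sqr => /orP[/eqP/CrealP zr|/eqP//].
  have : 0 <= z ^+ 2 by rewrite real_exprn_even_ge0.
  by rewrite z2 ler0q leNgt d0.
have hc : (ratr a + ratr b * z)^* = ratr a - ratr b * z.
  transitivity ((ratr a)^* + (ratr b)^* * z^*); last first.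
    by rewrite !cr cz mulrN.
  exact: etrans (rmorphD Num.conj _ _) (congr1 _ (rmorphM Num.conj _ _)).
rewrite rmorphD rmorphM !se -/z normCK hc.
rewrite rmorphB rmorphXn rmorphM rmorphXn /= -z2; ring.
Qed.

Theorem quadratic_ring : imaginary_quadratic R K -> class_number O = 1%N ->
  exists S : quad_pid O, (exists sigma : {rmorphism K -> R[i]}, True) /\
    forall (sigma : {rmorphism K -> R[i]}) x, cabs (sigma (val x)) ^+ 2 = (nrm S x)%:R.
Proof.
move=> iq cn1; have [e _] : exists e : {rmorphism rat -> K}, True by exists (in_alg K).
have [th [d [thd [gen th1]]]] := quadratic_generator e iq.1.
have [d0 [s0 _]] := imaginary_square iq thd gen th1.
have [a0 [b0 [h0 b00 hmin]]] := minimal_integer thd gen th1 d0.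
have [T [N [hT hN]]] := integral_data thd gen th1 h0.
pose w : O := Sub (e a0 + e b0 * th) h0.
have valw : val w = e a0 + e b0 * th by [].
have vint (n : int) : val (n%:~R : O) = n%:~R by rewrite rmorph_int.
have eint (n : int) : n%:~R = e n%:~R by rewrite rmorph_int.
have wsqr : w * w = T%:~R * w - N%:~R.
  apply: val_inj; rewrite rmorphB !rmorphM /= !vint !eint -hT -hN.
  by rewrite !(rmorphB, rmorphM, rmorphXn, rmorph_nat) -!thd; ring.
have wspan x : exists a b : int, x = a%:~R + b%:~R * w.
  have [a [b hx]] := gen (val x); have hi : e a + e b * th \in algint K by rewrite -hx; exact: valP.
  have [m [n hmn]] := hmin _ _ hi; exists m, n; apply: val_inj.
  by rewrite rmorphD rmorphM /= !vint hx.
have wfree (a b : int) : a%:~R + b%:~R * w = 0 -> a = 0 /\ b = 0.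
  move=> /(congr1 val); rewrite rmorphD rmorphM rmorph0 /= !vint !eint => h.
  have [] := gen_free (e := e) th1 (a := a%:~R + b%:~R * a0) (b := b%:~R * b0).
    by rewrite -[RHS]h !(rmorphD, rmorphM); ring.
  move=> + /eqP; rewrite mulf_eq0 (negbTE b00) orbF intr_eq0 => + /eqP b1.
  by rewrite b1 mul0r addr0 => /eqP; rewrite intr_eq0 => /eqP.
have wdisc : T ^+ 2 < 4 * N.
  rewrite -(ltr_int rat) rmorphXn intrM /= -hT -hN.
  have : 0 < b0 ^+ 2 by rewrite exprn_even_gt0.
  nra.
exists (QuadPid wsqr wspan wfree wdisc (class_number_one_principal cn1)); set S := QuadPid _ _ _ _ _.
split; first by exists s0.
move=> s x.
have hx : val x = e ((c0 S x)%:~R + (c1 S x)%:~R * a0) + e ((c1 S x)%:~R * b0) * th.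
  by rewrite {1}(qc_coord S x) /qc rmorphD rmorphM /= !vint !eint !(rmorphD, rmorphM); ring.
apply: (@complexI R); apply: etrans (rmorphXn (real_complex R) 2 _) _.
transitivity (`|s (val x)| ^+ 2).
  by congr (_ ^+ 2); apply: RRe_real; exact: normr_real.
rewrite hx (quadratic_abs _ _ s thd d0).
rewrite (_ : _ - _ = (nrmz S x)%:~R); last first.
  rewrite /nrmz -[qt S]/T -[qm S]/N !intrD !intrM -hT -hN; ring.
by rewrite -nrmzE ratr_int rmorph_nat.
Qed.

End RingOfIntegers.

(** * Ideals and their generators *)

Lemma card_fset_image (T U : choiceType) (s : seq T) (f : T -> U) (A : set U) :
  uniq s -> {in s &, injective f} -> (forall u, A u <-> exists2 x, x \in s & f x = u) ->
  #|` fset_set A| = size s.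
Proof.
move=> us fi hA; have -> : A = [set` map f s]%classic.
  apply/seteqP; split=> u /=; first by move=> /hA[x xs <-]; exact: map_f.
  by move=> /mapP[x xs ->]; apply/hA; exists x.
have fin : finite_set [set` map f s]%classic by exact: finite_seq.
rewrite (_ : fset_set _ = [fset u in map f s]%fset); last first.
  by apply/fsetP => u; rewrite in_fset_set// !inE; apply/idP/idP; [exact: set_mem | exact: mem_set].
by rewrite card_fseq undup_id ?map_inj_in_uniq// size_map.
Qed.

Section Ideals.
Variables (O : comNzRingType) (S : quad_pid O).
Implicit Types (x y q g : O).

Lemma residueE q x : residue_class (principal q) x = [set y | dv q (y - x)]%classic.
Proof. by apply/seteqP; split=> y /= /principalE. Qed.

Lemma residue_eq q x y : residue_class (principal q) x = residue_class (principal q) y <-> dv q (x - y).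
Proof.
rewrite !residueE; split=> [h|].
  have : [set z | dv q (z - x)]%classic x by rewrite /= -rep_eq.
  by rewrite h.
rewrite -rep_eq => /eqP h; apply/seteqP; split=> z /=; rewrite -!rep_eq h//.
Qed.

Lemma ideal_norm_principal q : q != 0 -> ideal_norm (principal q) = nrm S q.
Proof.
move=> q0; rewrite -(res_size S q0).
apply: (card_fset_image (f := residue_class (principal q)) (res_uniq S q)) => [x y hx hy /residue_eq|u].
  exact: res_inj q0 hx hy.
split=> [[x _ <-]|[x _ <-]]; last by exists x.
by exists (rep q x); [exact: rep_res | apply/residue_eq; exact: rep_congr].
Qed.

Lemma ideal_totient_principal q : q != 0 -> ideal_totient (principal q) = phi S q.
Proof.
move=> q0; rewrite phiE.
apply: (card_fset_image (f := residue_class (principal q)) (gres_uniq S q)) => [x y|u].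
  by rewrite !mem_filter => /andP[_ hx] /andP[_ hy] /residue_eq; exact: res_inj q0 hx hy.
split=> [[x [y /principalE hy] <-]|[x /gres_cop/cop_inv[y hy] <-]]; last first.
  by exists x => //; exists y; apply/principalE.
exists (rep q x); last by apply/residue_eq; exact: rep_congr.
apply: rep_gres q0 _; apply/copP; have /dvP[z hz] := hy.
by exists y, (- z); rewrite mulNr -hz; ring.
Qed.

Lemma coprime_principal g q : coprime_ideals (principal g) (principal q) <-> cop g q.
Proof.
split=> [[_ [_ [[a _ <-] [b _ <-] h]]]|/copP[a [b h]]]; first by apply/copP; exists a, b.
by exists (a * g), (b * q); split=> //; [exists a | exists b].
Qed.

Lemma nz_ideal_principal (I : set O) :
  nz_ideal I <-> exists q, [/\ q != 0, can q = q & I = principal q].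
Proof.
split=> [[Ii I0]|[q [q0 _ ->]]].
  have [w hw] := q_pid S Ii; have [h1 h2] := can_assoc w.
  have hcan : principal w = principal (can w).
    apply/seteqP; split=> x /principalE hx; apply/principalE; exact: dv_trans hx.
  exists (can w); rewrite can_id; split=> //; last by rewrite hw.
  apply: can_neq0; apply/eqP => w0; apply: I0; rewrite hw w0.
  apply/seteqP; split=> x /=; first by case=> a _ <-; rewrite mulr0.
  by move=> ->; exists 0; rewrite ?mul0r.
split; last first.
  move=> /seteqP[h _]; have : principal q q by exists 1; rewrite ?mul1r.
  by move/h => /= /eqP; rewrite (negbTE q0).
split; first by exists 0; rewrite ?mul0r.
by move=> a _ _ [u _ <-] [v _ <-]; exists (a * u + v) => //; ring.
Qed.

Lemma principal_can_inj : {in [pred q : O | can q == q] &, injective (@principal O)}.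
Proof.
move=> x y /eqP hx /eqP hy h; rewrite -hx -hy; apply: assoc_can; apply/principalE.
  by rewrite h; exists 1; rewrite ?mul1r.
by rewrite -h; exists 1; rewrite ?mul1r.
Qed.

Lemma Dp_trivial (R : realType) q c (l : seq (O * O)) : q != 0 -> `|Dp S R q c l| <= 2 * (size l)%:R.
Proof.
move=> q0; rewrite DpE; apply: le_trans (ler_norm_sum _ _ _) _.
rewrite mulrC; apply: ler_sum_const => x _; apply: le_trans (ler_normB _ _) _.
rewrite -[2]/(1 + 1) lerD//; first by case: (dv _ _); rewrite ?normr1 ?normr0.
have p0 : 0 < (phi S q)%:R :> R by rewrite ltr0n phi_gt0.
rewrite ger0_norm ?divr_ge0// ler_pdivrMr// mul1r ler_nat.
by apply: leq_trans (leq_b1 _) _; rewrite phi_gt0.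
Qed.

(** The elements [a + b w] with [1 <= a, b <= s] are enough. *)
Lemma ball_ge : exists c : nat, (0 < c)%N /\ forall s n : nat, (s ^ 2 * c <= n)%N -> (s ^ 2 <= size (nzball S n))%N.
Proof.
exists (1 + absz (qt S) + absz (qm S))%N; split=> // s n hs.
pose l := [seq qc S a%:Z b%:Z | a <- iota 1 s, b <- iota 1 s].
have ul : uniq l.
  apply: allpairs_uniq; rewrite ?iota_uniq// => -[a b] [a' b'] _ _ /= /qc_inj[h1 h2].
  by congr (_, _); apply/eqP; rewrite -eqz_nat; apply/eqP.
have <- : size l = (s ^ 2)%N by rewrite size_allpairs !size_iota mulnn.
apply: uniq_leq_size ul _ => x /allpairsP[[a b] /= [+ + ->]].
rewrite !mem_iota mem_nzball => /andP[a1 a2] /andP[b1 b2].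
have a2' : (a <= s)%N by lia. have b2' : (b <= s)%N by lia.
apply/andP; split.
  apply/eqP => /(congr1 (c0 S)); rewrite c0_qc c0_0; lia.
apply: leq_trans hs; rewrite -lez_nat nrmzE /nrmz c0_qc c1_qc.
set t := qt S; set m := qm S.
have ht : t * a%:Z * b%:Z <= (absz t)%:Z * (s%:Z * s%:Z).
  rewrite -mulrA; apply: (@le_trans _ _ ((absz t)%:Z * (a%:Z * b%:Z))).
    by apply: ler_wpM2r; rewrite ?mulr_ge0// abszE ler_norm.
  by apply: ler_wpM2l => //; apply: ler_pM.
have hm : m * b%:Z ^+ 2 <= (absz m)%:Z * (s%:Z * s%:Z).
  rewrite expr2; apply: (@le_trans _ _ ((absz m)%:Z * (b%:Z * b%:Z))).
    by apply: ler_wpM2r; rewrite ?mulr_ge0// abszE ler_norm.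
  by apply: ler_wpM2l => //; apply: ler_pM.
have ha : a%:Z ^+ 2 <= s%:Z * s%:Z by rewrite expr2; apply: ler_pM.
rewrite PoszM !PoszD -mulnn PoszM; apply: le_trans (lerD (lerD ha ht) hm) _.
by rewrite le_eqVlt; apply/orP; left; apply/eqP; ring.
Qed.

End Ideals.

(** * Errors of the arithmetic functions *)

Lemma fsbig_filter (T : choiceType) (V : nmodType) (s : seq T) (P : pred T) (f : T -> V) : uniq s ->
  \sum_(x \in [set` [seq x <- s | P x]]%classic) f x = \sum_(x <- s) (if P x then f x else 0).
Proof.
move=> us; rewrite -[RHS]big_mkcond -[RHS]big_filter; apply/esym.
exact: (fsbig_seq _ f (filter_uniq P us)).
Qed.

Section Bridge.
Variables (R : realType) (K : fieldExtType rat).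
Local Notation O := (ring_of_integers K).
Variable S : quad_pid O.
Hypothesis embedding : exists sigma : {rmorphism K -> R[i]}, True.
Hypothesis absE : forall (sigma : {rmorphism K -> R[i]}) x, cabs (sigma (val x)) ^+ 2 = (nrm S x)%:R.
Implicit Types (x y q g c : O) (M N : R) (f : O -> R[i]).
Local Notation C := (real_complex R).
Local Notation box M := (nzball S (Num.truncn ((M : R) ^+ 2))).

Lemma cabs_real (x : R) : cabs (C x) = `|x|.
Proof. by rewrite /cabs normc_def /= expr0n addr0 sqrtr_sqr. Qed.

Lemma A0E M : 0 <= M -> A0 M = [set` box M]%classic :> set O.
Proof.
move=> M0; have [s0 _] := embedding.
have ck (s : {rmorphism K -> R[i]}) x : (1 <= cabs (s (val x)) <= M) = (x \in box M).
  have c0 : 0 <= cabs (s (val x)) by rewrite /cabs normc_def /= sqrtr_ge0.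
  rewrite mem_nzball truncn_ge_nat ?sqr_ge0// -(absE s) ler_sqr// -[LHS]andbC -[RHS]andbC; congr (_ && _).
  rewrite -[1 <= _](ler_sqr (x := 1)) ?nnegrE// expr1n absE ler1n lt0n; congr (~~ _).
  by rewrite nrm_eq0.
apply/seteqP; split=> x h; last by move=> s; rewrite ck.
by change (x \in box M); rewrite -(ck s0); exact: h.
Qed.

Lemma cardA0E M : 0 <= M -> cardA0 K M = size (box M).
Proof.
move=> M0; rewrite /cardA0 A0E//; apply: (card_fset_image (f := id)) => [||u]; first exact: nzball_uniq.
  by [].
by split=> [h|[x h <-]//]; exists u.
Qed.

(** All sums of the definition are finite, so they become sums over the list of elements of the
    box. *)
Lemma epsE M q g f (F : O -> R) : 0 <= M -> q != 0 -> {in box M, forall x, f x = C (F x)} ->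
  eps M (principal q) g f =
  C (\sum_(x <- box M) ((dv q (x - g))%:R - (cop x q)%:R / (phi S q)%:R) * F x).
Proof.
move=> M0 q0 hf; rewrite /eps A0E// (ideal_totient_principal S)//.
have sumE (P : pred O) (B : set O) : (forall x, B x <-> P x) ->
    \sum_(x \in [set` box M]%classic `&` B) f x = C (\sum_(x <- box M) (P x)%:R * F x).
  move=> hB; rewrite (_ : _ `&` _ = [set` [seq x <- box M | P x]])%classic; last first.
    apply/seteqP; split=> x /=; rewrite (mem_filter P); first by case=> -> /hB ->.
    by move=> /andP[/hB ? ->].
  rewrite fsbig_filter ?nzball_uniq// rmorph_sum.
  by apply: eq_big_seq => x hx; case: (P x); rewrite ?mul1r ?mul0r ?rmorph0 ?hf.
rewrite (sumE (fun x => dv q (x - g))); last by move=> x; rewrite residueE.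
rewrite (sumE (fun x => cop x q)); last by move=> x; exact: coprime_principal.
rewrite -(rmorph_nat C) -fmorphV -rmorphM -rmorphB; congr (C _).
rewrite mulr_sumr -sumrB; apply: eq_bigr => x _; ring.
Qed.

Lemma eps_prime M q g : 0 <= M -> q != 0 -> cabs (eps M (principal q) g (@ind_prime R K)) = `|err1 S M q g|.
Proof.
move=> M0 q0; rewrite (@epsE M q g _ (fun x => (prm x)%:R))//; last first.
  by move=> x _; rewrite /ind_prime -/(prm x); case: (prm x); rewrite ?rmorph1 ?rmorph0.
rewrite cabs_real /err1 D1E; congr `|_|.
rewrite [RHS](perm_big [seq x <- box M | prm x]) /=; last first.
  apply: uniq_perm; [exact: (pr_uniq S) | exact: filter_uniq (nzball_uniq S _) | move=> x].
  rewrite mem_pr (mem_filter (@prm O)) mem_nzball truncn_ge_nat ?sqr_ge0//; case: (boolP (prm x)) => //= px.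
  by case: (prmP px) => ->.
by rewrite [RHS]big_filter [RHS]big_mkcond; apply: eq_bigr => x _; case: (prm x); rewrite ?mulr1 ?mulr0.
Qed.

Lemma convE M x : x \in box M ->
  dirichlet_conv (@ind_prime R K) (@ind_prime R K) x =
  C (\sum_(p <- pp S (M ^+ 2)) (p.1 * p.2 == x)%:R).
Proof.
rewrite mem_nzball truncn_ge_nat ?sqr_ge0// => /andP[x0 xM].
have ipE (y : O) : @ind_prime R K y = C (prm y)%:R.
  by rewrite /ind_prime -/(prm y); case: (prm y); rewrite ?rmorph1 ?rmorph0.
rewrite /dirichlet_conv -(@fsbig_widen _ _ _ _ [set` [seq p <- pp S (M ^+ 2) | p.1 * p.2 == x]]%classic).
- rewrite fsbig_filter ?pp_uniq// rmorph_sum.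
  apply: eq_big_seq => p; rewrite mem_pp => /and3P[p1 p2 _].
  by rewrite !ipE p1 p2; case: (_ == x); rewrite ?rmorph1 ?rmorph0 ?mulr1.
- by move=> p /=; rewrite mem_filter => /andP[/eqP].
- move=> p [/= px np]; rewrite !ipE -rmorphM -natrM mulnb.
  case: (boolP (prm p.1 && prm p.2)) => [/andP[p1 p2]|_]; last by rewrite rmorph0.
  by case: np; rewrite mem_filter px eqxx mem_pp p1 p2 px xM.
Qed.

Lemma eps_conv M q g : 0 <= M -> q != 0 ->
  cabs (eps M (principal q) g (dirichlet_conv (@ind_prime R K) (@ind_prime R K))) = `|err2 S M q g|.
Proof.
move=> M0 q0; rewrite (epsE g M0 q0 (@convE M)) cabs_real /err2 DpE; congr `|_|.
under eq_bigr do rewrite mulr_sumr.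
rewrite exchange_big /=; apply: eq_big_seq => p; rewrite mem_pp => /and3P[p1 p2 pM].
have hp : p.1 * p.2 \in box M.
  rewrite mem_nzball truncn_ge_nat ?sqr_ge0// pM andbT.
  by case: (prmP p1) => h1 _ _; case: (prmP p2) => h2 _ _; exact: (mulO_neq0 S).
rewrite (bigD1_seq _ hp (nzball_uniq _ _)) /= eqxx mulr1 big1 ?addr0// => x /negbTE hx.
by rewrite eq_sym hx mulr0.
Qed.

(** The summand of [total_error] at the ideal generated by [q]. *)
Definition sup_error N f q : \bar R :=
  ereal_sup [set ereal_sup [set (cabs (eps M (principal q) gamma f))%:E
        | gamma in [set gamma | coprime_ideals (principal gamma) (principal q)]]
      | M in [set M | 1 <= M <= N]]%classic.

Lemma sup_error_ge N f q M g : 1 <= M <= N -> cop g q ->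
  ((cabs (eps M (principal q) g f))%:E <= sup_error N f q)%E.
Proof.
move=> hM gq; apply: (@le_trans _ _ (ereal_sup [set (cabs (eps M (principal q) gamma f))%:E
        | gamma in [set gamma | coprime_ideals (principal gamma) (principal q)]]%classic)).
  by apply: ereal_sup_ubound; exists g => //; apply/coprime_principal.
by apply: ereal_sup_ubound; exists M.
Qed.

Lemma sup_error_le N f q (B : R) :
  (forall M, 1 <= M <= N -> forall g, cop g q -> cabs (eps M (principal q) g f) <= B) ->
  (sup_error N f q <= B%:E)%E.
Proof.
move=> hB; apply: ge_ereal_sup => _ [M hM <-]; apply: ge_ereal_sup => _ [g /coprime_principal hg <-].
by rewrite lee_fin; exact: hB.
Qed.

Lemma sup_error_ge0 N f q : 1 <= N -> (0 <= sup_error N f q)%E.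
Proof.
move=> N1; apply: le_trans (@sup_error_ge N f q 1 1 _ _); last 1 first.
- by apply/copP; exists 1, 0; rewrite mul0r addr0 mulr1.
- by rewrite lee_fin /cabs normc_def /= sqrtr_ge0.
- by rewrite lexx.
Qed.

Lemma total_errorE (Q N : R) f : 1 <= N ->
  total_error Q N f = (\sum_(q <- cball S (Num.truncn Q)) sup_error N f q)%E.
Proof.
move=> N1; rewrite /total_error.
have -> : [set I : set O | nz_ideal I /\ (ideal_norm I)%:R <= Q]%classic =
    [set` map (@principal O) (cball S (Num.truncn Q))]%classic.
  apply/seteqP; split=> [I /= [/(nz_ideal_principal S)[q [q0 cq ->]]]|I /= /mapP[q]].
    rewrite (ideal_norm_principal S)// => hQ; apply: map_f; rewrite mem_cball q0 cq eqxx /=.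
    by rewrite truncn_ge_nat// (le_trans _ hQ).
  rewrite mem_cball => /and3P[q0 /eqP cq hq] ->; split.
    by apply/(nz_ideal_principal S); exists q.
  rewrite (ideal_norm_principal S)//; have : (0 < nrm S q)%N by rewrite nrm_gt0.
  by move: hq; case: (nrm S q) => // m; rewrite truncn_gt_nat.
rewrite esum_fset; last 2 first.
- exact: finite_seq.
- move=> I /set_mem /= /mapP[q _ ->]; exact: sup_error_ge0.
rewrite -fsbig_seq ?big_map//.
rewrite map_inj_in_uniq ?cball_uniq// => x y; rewrite !mem_cball => /and3P[_ hx _] /and3P[_ hy _].
by apply: principal_can_inj.
Qed.

End Bridge.

(** * The two notions of level of distribution *)

Section Transfer.
Variables (R : realType) (K : fieldExtType rat).
Local Notation O := (ring_of_integers K).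
Variable S : quad_pid O.
Hypothesis embedding : exists sigma : {rmorphism K -> R[i]}, True.
Hypothesis absE : forall (sigma : {rmorphism K -> R[i]}) x, cabs (sigma (val x)) ^+ 2 = (nrm S x)%:R.
Implicit Types (q g c : O) (M N : R).

Lemma cardA0_le N : 1 <= N -> (cardA0 K N)%:R <= 40 * N ^+ 2.
Proof.
move=> N1; have N20 : 1 <= N ^+ 2 by rewrite exprn_ege1.
rewrite (cardA0E embedding absE); last by apply: le_trans N1.
apply: (@le_trans _ _ (size (ball S (Num.truncn (N ^+ 2))))%:R).
  by rewrite ler_nat size_filter count_size.
apply: le_trans (ball_size S R _) _; rewrite -natr1.
have := truncn_le (N ^+ 2); rewrite sqr_ge0 => h.
have : (Num.truncn (N ^+ 2))%:R <= N ^+ 2 by rewrite h.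
lra.
Qed.

Lemma cardA0_ge : exists k : nat, (0 < k)%N /\ forall N, 2 * k%:R <= N ->
  (N / (2 * k%:R)) ^+ 2 <= (cardA0 K N)%:R.
Proof.
have [k [k0 hk]] := ball_ge S; exists k; split=> // N hN.
have kR : 1 <= k%:R :> R by rewrite ler1n.
have k1 : 0 < k%:R :> R by apply: lt_le_trans kR.
have N0 : 0 <= N by lra.
have v1 : 2 <= N / k%:R by rewrite ler_pdivlMr.
have v0 : 0 <= N / k%:R by lra.
have /andP[s1 s2] := truncn_itv v0; set s := Num.truncn (N / k%:R) in s1 s2.
rewrite (cardA0E embedding absE)//.
have hs : (s ^ 2 <= size (nzball S (Num.truncn (N ^+ 2))))%N.
  apply: hk; rewrite truncn_ge_nat ?sqr_ge0// natrM natrX.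
  have h1 : s%:R * k%:R <= N by rewrite -ler_pdivlMr.
  have h2 : s%:R <= N by apply: le_trans s1 _; rewrite ler_pdivrMr// ler_peMr.
  by rewrite !expr2 -mulrA; apply: ler_pM => //; apply: mulr_ge0.
apply: (@le_trans _ _ ((s ^ 2)%:R)); last by rewrite ler_nat.
have -> : N / (2 * k%:R) = (N / k%:R) / 2 by field; rewrite gt_eqF.
rewrite natrX; apply: lerXn2r; rewrite ?nnegrE//; first by lra.
by move: s2; rewrite -natr1; lra.
Qed.

Lemma cardA0_ge1 N : 1 <= N -> 1 <= (cardA0 K N)%:R :> R.
Proof.
move=> N1; rewrite (cardA0E embedding absE); last by apply: le_trans N1.
rewrite ler1n lt0n size_eq0; apply/eqP => h.
have : (1 : O) \in nzball S (Num.truncn (N ^+ 2)).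
  rewrite mem_nzball oner_neq0 truncn_ge_nat ?sqr_ge0//.
  have -> : nrm S 1 = 1%N by apply/eqP; rewrite -(unit_nrm1 S) dvxx.
  by rewrite exprn_ege1.
by rewrite h.
Qed.

Lemma powR_half (x : R) : 0 <= x -> x `^ (1 / 2) = Num.sqrt x.
Proof. by move=> x0; rewrite mul1r powR12_sqrt. Qed.

(** As [cardA0 N] is of exact order [N ^ 2], the moduli up to [N / log N ^ b] are in the range
    of the hypothesis once [b >= B + 1]. Each supremum is finite, since the whole sum is. *)
Lemma level_of_hypothesis : level_of_distribution (1 / 2) (@ind_prime R K) -> level S (@err1 O S R).
Proof.
move=> H k; have A0 : 0 < k.+1%:R :> R by rewrite ltr0n.
have [B [C [C0 {}H]]] := H _ A0.
have [kc [kc0 hcard]] := cardA0_ge.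
pose b0 := Num.truncn `|B|; pose b := b0.+2.
have Bb : B <= b0.+1%:R.
  by apply: le_trans (ler_norm B) _; have /andP[_ /ltW] := truncn_itv (normr_ge0 B).
pose L0 : R := 2 * kc%:R + 1.
have kR : 1 <= kc%:R :> R by rewrite ler1n.
exists b, (Num.max 2 (Num.max L0 (expR L0))), (C * 40); split; first by rewrite mulr_gt0.
move=> N; rewrite !ge_max => /and3P[N2 hN1 hN2].
have N0 : 0 < N by lra. have N1 : 1 <= N by lra.
have NL : expR (ln N) = N by rewrite lnK ?posrE.
have hL : L0 <= ln N by rewrite -ler_expR NL.
set L := ln N in hL *; have L1 : 1 <= L by rewrite /L0 in hL; lra.
have Lp : 0 < L by lra.
set Q := (cardA0 K N)%:R `^ (1 / 2) / L `^ B in H.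
have nQ : N / L ^+ b <= Q.
  rewrite /Q powR_half// ler_pdivrMr ?exprn_gt0//.
  have hs : N / (2 * kc%:R) <= Num.sqrt (cardA0 K N)%:R.
    have h : 0 <= N / (2 * kc%:R) by rewrite divr_ge0 ?(ltW N0)// mulr_ge0.
    rewrite -[X in X <= _](ger0_norm h) -sqrtr_sqr; apply: ler_wsqrtr; apply: hcard.
    by rewrite /L0 in hN1; lra.
  have hB : L `^ B <= L ^+ b0.+1 by rewrite -powR_mulrn ?(ltW Lp)//; exact: ler_powR.
  have LB : 0 < L `^ B by rewrite powR_gt0.
  rewrite mulrAC ler_pdivlMr// (exprS L) mulrA.
  apply: ler_pM; [exact: ltW | exact: ltW | | exact: hB].
  apply: (@le_trans _ _ (N / (2 * kc%:R) * L)); last by rewrite ler_wpM2r// ltW.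
  rewrite mulrAC ler_pdivlMr ?mulr_gt0//; last by lra.
  by rewrite ler_wpM2l// ?(ltW N0)//; rewrite /L0 in hL; lra.
set n := Num.truncn (N / L ^+ b).
have nn : (n <= Num.truncn Q)%N by exact: le_truncn.
have := H N N2; rewrite (total_errorE S)// -/L -/Q => hT.
have G0 q : (0 <= sup_error N (@ind_prime R K) q)%E by exact: sup_error_ge0.
have fin q : q \in cball S n -> sup_error N (@ind_prime R K) q \is a fin_num.
  move=> qn; rewrite ge0_fin_numE//; apply: le_lt_trans (ltry _); apply: le_trans hT.
  by rewrite (big_rem _ (cball_le nn qn)) /=; apply: leeDl; apply: sume_ge0 => r _; exact: G0.
exists (fun q => fine (sup_error N (@ind_prime R K) q)); split.
- by move=> q; exact: fine_ge0.
- move=> q qn M MN c cq; rewrite -lee_fin fineK ?fin//.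
  have q0 : q != 0 by move: qn; rewrite mem_cball => /and3P[].
  have M0 : 0 <= M by case/andP: MN => h _; apply: le_trans h.
  by rewrite -(eps_prime embedding absE c M0 q0); exact: sup_error_ge.
- have hsum : \sum_(q <- cball S n) fine (sup_error N (@ind_prime R K) q) <= C * (cardA0 K N)%:R * L `^ (- k.+1%:R).
    rewrite -lee_fin; apply: le_trans hT.
    rewrite -sumEFin big_seq (eq_bigr (fun q => sup_error N (@ind_prime R K) q)); last by move=> q qn; rewrite fineK ?fin.
    rewrite -big_seq; apply: (@le_trans _ _ (\sum_(q <- [seq q <- cball S (Num.truncn Q) | q \in cball S n]) sup_error N (@ind_prime R K) q)%E).
      rewrite (perm_big [seq q <- cball S (Num.truncn Q) | q \in cball S n])//=.
      apply: uniq_perm; [exact: (cball_uniq S) | exact: filter_uniq (cball_uniq S _) | move=> q].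
      rewrite (mem_filter (fun q => q \in cball S n)); case: (boolP (q \in cball S n)) => //= h.
      by rewrite (cball_le nn h).
    rewrite big_filter big_mkcond /=; apply: lee_sum => q _; case: ifP => // _; exact: G0.
  apply: (@le_trans _ _ (C * (cardA0 K N)%:R * L `^ (- k.+1%:R) * L ^+ k)).
    by rewrite ler_wpM2r// exprn_ge0// ltW.
  rewrite powRN powR_mulrn ?(ltW Lp)// -!mulrA; apply: ler_wpM2l; first exact: ltW.
  apply: le_trans (cardA0_le N1); rewrite ler_piMr// exprS mulrC ler_pdivrMr ?mulr_gt0 ?exprn_gt0//.
  by rewrite mul1r ler_peMl// exprn_ge0// ltW.
Qed.

(** For [N] beyond a bound [N1] the level applies; below [N1] only finitely many moduli occur
    and the trivial bound is absorbed in the constant. *)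
Lemma conclusion_of_level : level S (@err2 O S R) ->
  level_of_distribution (1 / 2) (dirichlet_conv (@ind_prime R K) (@ind_prime R K)).
Proof.
move=> H A A0; set f := dirichlet_conv _ _.
pose k := (Num.truncn A).+1.
have Ak : A <= k%:R by have /andP[_ /ltW] := truncn_itv (ltW A0).
have [b [N0 [C [C0 {}H]]]] := H k.
have [kc [kc0 hcard]] := cardA0_ge.
have kR : 1 <= kc%:R :> R by rewrite ler1n.
pose N1 : R := Num.max (expR 7) (Num.max N0 (2 * kc%:R)).
have N17 : expR 7 <= N1 by rewrite le_max lexx.
have N1p : 0 < N1 by apply: lt_le_trans N17; exact: expR_gt0.
have N11 : 1 <= N1 by apply: le_trans N17; rewrite -(expR0 R) ler_expR.
have ln2 : 0 < ln (2 : R) by rewrite ln_gt0// ltr1n.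
pose Q1 : R := 7 * N1 / ln 2 ^+ b.+1.
pose W : R := (size (cball S (Num.truncn Q1)))%:R * (2 * (size (pp S (N1 ^+ 2)))%:R).
have W0 : 0 <= W by rewrite !mulr_ge0.
pose C' : R := C * (2 * kc%:R) ^+ 2 + W * ln N1 `^ A + 1.
have lnN1 : 0 <= ln N1 by exact: ln_ge0.
have CW : 0 <= C * (2 * kc%:R) ^+ 2 by rewrite mulr_ge0 ?sqr_ge0// ltW.
have WA : 0 <= W * ln N1 `^ A by rewrite mulr_ge0// powR_ge0.
exists b.+1%:R, C'; split; first by rewrite /C'; lra.
move=> N N2; have Np : 0 < N by lra. have N1' : 1 <= N by lra.
rewrite (total_errorE S)//; set L := ln N; set Q := _ `^ (1 / 2) / _.
have L2 : ln 2 <= L by rewrite ler_ln ?posrE.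
have Lp : 0 < L by exact: lt_le_trans L2.
have sq : Num.sqrt (cardA0 K N)%:R <= 7 * N.
  rewrite -[leRHS]ger0_norm ?mulr_ge0 ?(ltW Np)// -sqrtr_sqr; apply: ler_wsqrtr.
  apply: le_trans (cardA0_le N1') _; rewrite exprMn; apply: ler_wpM2r; first exact: sqr_ge0.
  by rewrite -natrX ler_nat.
have QE : Q = Num.sqrt (cardA0 K N)%:R / L ^+ b.+1.
  by rewrite /Q powR_half// powR_mulrn// ltW.
have LA : 0 < L `^ A by rewrite powR_gt0.
have card0 : 0 <= (cardA0 K N)%:R :> R by [].
have err_eq M q g : 0 <= M -> q != 0 -> cabs (eps M (principal q) g f) = `|err2 S M q g|.
  by move=> M0 q0; exact: (eps_conv embedding absE g M0 q0).
have [hN|hN] := leP N1 N.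
  move: hN; rewrite /N1 !ge_max => /and3P[hN7 hN0 hNk].
  have L7 : 7 <= L by rewrite -ler_expR lnK ?posrE.
  have [e [e0 he hs]] := H N hN0; rewrite -/L in he hs; set n := Num.truncn _ in he hs.
  have nn : (Num.truncn Q <= n)%N.
    apply: le_truncn; rewrite QE ler_pdivrMr ?exprn_gt0// (exprS L).
    rewrite [leRHS](_ : _ = N * L * (L ^+ b / L ^+ b)); last by ring.
    rewrite divff ?gt_eqF ?exprn_gt0// mulr1; apply: le_trans sq _.
    by rewrite mulrC ler_wpM2l// ltW.
  apply: (@le_trans _ _ (\sum_(q <- cball S (Num.truncn Q)) (e q)%:E)%E).
    rewrite big_seq [leRHS]big_seq; apply: lee_sum => q hq.
    apply: sup_error_le => // M MN g gq; rewrite err_eq.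
    - exact: he (cball_le nn hq) M MN g gq.
    - by case/andP: MN => h _; apply: le_trans h.
    - by move: hq; rewrite mem_cball => /and3P[].
  rewrite sumEFin lee_fin powRN ler_pdivlMr//.
  apply: le_trans (_ : (\sum_(q <- cball S n) e q) * L ^+ k <= _).
    apply: ler_pM; [exact: sumr_ge0 | exact: ltW | exact: sum_cball_le |].
    rewrite -powR_mulrn ?(ltW Lp)//; apply: ler_powR => //; lra.
  apply: le_trans hs _; apply: (@le_trans _ _ (C * (2 * kc%:R) ^+ 2 * (cardA0 K N)%:R)).
    rewrite -mulrA; apply: ler_wpM2l; first exact: ltW.
    apply: le_trans (_ : (2 * kc%:R) ^+ 2 * (N / (2 * kc%:R)) ^+ 2 <= _).
      by rewrite -exprMn mulrC divfK// gt_eqF// mulr_gt0//; lra.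
    by apply: ler_wpM2l; [exact: sqr_ge0 | exact: hcard].
  by apply: ler_wpM2r => //; rewrite /C'; lra.
have QQ1 : Q <= Q1.
  rewrite QE /Q1; apply: ler_pM; rewrite ?sqrtr_ge0 ?invr_ge0 ?exprn_ge0 ?(ltW Lp)//.
    by apply: le_trans sq _; rewrite ler_wpM2l// ltW.
  rewrite lef_pV2 ?posrE ?exprn_gt0//; apply: lerXn2r; rewrite ?nnegrE// ltW//.
apply: (@le_trans _ _ (\sum_(q <- cball S (Num.truncn Q)) (2 * (size (pp S (N1 ^+ 2)))%:R)%:E)%E).
  rewrite big_seq [leRHS]big_seq; apply: lee_sum => q; rewrite mem_cball => /and3P[q0 _ _].
  apply: sup_error_le => // M /andP[M1 MN] g gq; have M0 : 0 <= M by apply: le_trans M1.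
  rewrite err_eq//; apply: le_trans (Dp_trivial _ _ _ _ q0) _; apply: ler_wpM2l => //.
  rewrite ler_nat; apply: uniq_leq_size; first exact: pp_uniq.
  move=> p; rewrite !mem_pp => /and3P[-> -> /= h]; apply: le_trans h _.
  by apply: lerXn2r; rewrite ?nnegrE ?(ltW N1p)//; apply: le_trans MN (ltW hN).
rewrite sumEFin lee_fin powRN ler_pdivlMr//.
have hW : \sum_(q <- cball S (Num.truncn Q)) (2 * (size (pp S (N1 ^+ 2)))%:R : R) <= W.
  apply: le_trans (ler_sum_const (fun q _ => lexx _)) _.
  rewrite /W; apply: ler_wpM2r; first by rewrite mulr_ge0.
  rewrite ler_nat; apply: uniq_leq_size; first exact: cball_uniq.
  by move=> q; apply: cball_le; exact: le_truncn.
apply: (@le_trans _ _ (W * ln N1 `^ A)).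
  apply: ler_pM => //; first by apply: sumr_ge0 => q _; rewrite mulr_ge0.
    exact: ltW.
  apply: ge0_ler_powR; rewrite ?nnegrE ?(ltW A0) ?(ltW Lp)//.
  by rewrite ler_ln ?posrE// ltW.
apply: (@le_trans _ _ (C' * 1)); first by rewrite mulr1 /C'; lra.
by apply: ler_wpM2l; [rewrite /C'; lra | exact: cardA0_ge1].
Qed.

End Transfer.

(** * Products of two primes *)

Theorem corollary1p3 (R : realType) (K : fieldExtType rat)
    (K_imaginary_quadratic : imaginary_quadratic R K)
    (K_class_number_one : class_number (ring_of_integers K) = 1%N) :
  level_of_distribution (1 / 2) (@ind_prime R K) ->
  level_of_distribution (1 / 2)
    (dirichlet_conv (@ind_prime R K) (@ind_prime R K)).
Proof.
have [S [embedding absE]] := quadratic_ring K_imaginary_quadratic K_class_number_one.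
move=> /(level_of_hypothesis embedding absE)/level_conv.
exact: conclusion_of_level.
Qed.
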